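(* Set $M=\mathbb{C}\setminus\{p_1,\dots,p_n\}$ for arbitrary $n\in\mathbb{N}$. Then there exist choices for $p_1,\dots,p_n$ so that there exist complete CMC $1$ faces $f:M\to\mathbb{S}^3_1$ of finite type with $n$ regular elliptic ends and one irregular elliptic end.
   Context: De Sitter space: identify Lorentz space $\mathbb{R}^4_1$ (signature $-+++$) with the Hermitian $2\times2$ matrices via $(x_0,x_1,x_2,x_3)\leftrightarrow\begin{pmatrix}x_0+x_3&x_1+ix_2\\ x_1-ix_2&x_0-x_3\end{pmatrix}$, so $\langle X,X\rangle=-\det X$. Let $e_3=\mathrm{diag}(1,-1)$, $F^*={}^t\overline F$. Then $\mathbb{S}^3_1=\{X=X^*:\det X=-1\}=\{Fe_3F^*:F\in SL(2,\mathbb{C})\}$ with the induced Lorentzian metric. An immersion into $\mathbb{S}^3_1$ is spacelike if its induced metric is positive definite. ''CMC $1$'' means mean curvature identically $1$ with respect to the oriented timelike unit normal $N$: $\det(f_x,f_y,N,f)>0$ in the coordinates $(x_0,x_1,x_2,x_3)$ for positively oriented local coordinates $(x,y)$, $h(\partial_i,\partial_j)=\langle\partial_i\partial_jf,N\rangle$, mean curvature half the trace of $h$. CMC $1$ face: a smooth map $f:M\to\mathbb{S}^3_1$ from an oriented $2$-manifold is a CMC $1$ map if there is an open dense $W\subset M$ with $f|_W$ a spacelike CMC $1$ immersion. A point $p$ is singular if $ds^2=f^*(ds^2_{\mathbb{S}^3_1})$ is degenerate at $p$; it is admissible if (1) there is a neighborhood $U$ of $p$ and a $C^1$ function $\beta:U\cap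 W\to\mathbb{R}^+$ such that $\beta ds^2$ extends to a $C^1$ Riemannian metric on $U$, and (2) $df(p)\ne0$. A CMC $1$ face is a CMC $1$ map all of whose singular points are admissible. For a CMC $1$ face there is a unique complex structure on $M$ for which $f|_W$ is conformal and there is a holomorphic immersion $F=(F_{jk}):\widetilde M\to SL(2,\mathbb{C})$ on the universal cover $\varrho:\widetilde M\to M$ with $\det(dF)=0$ and $f\circ\varrho=Fe_3F^*$ (holomorphic null lift, unique up to right multiplication by a constant in $SU(1,1)=\{\begin{pmatrix}p&q\\\bar q&\bar p\end{pmatrix}:|p|^2-|q|^2=1\}$); $M$ carries this complex structure. The hyperbolic Gauss map is $G=dF_{11}/dF_{21}=dF_{12}/dF_{22}$, a meromorphic function on $M$. $f$ is complete (resp. of finite type) if there are a compact $C\subset M$ and a symmetric $(0,2)$-tensor $T$ vanishing on $M\setminus C$ such that $ds^2+T$ is a complete (resp. finite total curvature) Riemannian metric on $M$. The ends of $f$ are the punctures $p_1,\dots,p_n,\infty$. For a loop around an end with deck transformation $\tau$, $F\circ\tau=F\Phi$ with $\Phi\in SU(1,1)$; the end is elliptic if $\Phi$ is conjugate in $SU(1,1)$ to $\mathrm{diag}(e^{i\theta},e^{-i\theta})$ for some $\theta$. An end is regular if $G$ extends meromorphically across it, otherwise irregular. *)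

(* Defs.v *)
From HB Require Import structures.
From mathcomp Require Import all_boot all_order all_algebra.
From mathcomp Require Import complex.
From mathcomp Require Import all_classical all_reals all_analysis.

Set Implicit Arguments.
Unset Strict Implicit.
Unset Printing Implicit Defensive.

Import Order.TTheory GRing.Theory Num.Theory numFieldNormedType.Exports.

Local Open Scope classical_set_scope.
Local Open Scope ring_scope.
Local Open Scope complex_scope.

(* The libraries give R[i] its field structure and its norm, but no topology
   keyed on R[i] itself; it is imported from the regular module R[i]^o, as is
   done for R. *)
HB.instance Definition _ (R : realType) :=
  PseudoPointedMetric.copy R[i] R[i]^o.
HB.instance Definition _ (R : realType) := GRing.ComAlgebra.copy R[i] R[i]^o.
HB.instance Definition _ (R : realType) := Vector.copy R[i] R[i]^o.
HB.instance Definition _ (R : realType) := NormedModule.copy R[i] R[i]^o.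

Notation I01 := `[0%R, 1%R]%classic.

(* Functions on an open set of the plane are total functions on R[i]; their
   values off the open set under consideration are irrelevant. The real
   coordinates of z are (x, y) with z = x + i y; index 0 is x, index 1 is y. *)
Section PlaneCalculus.
Context {R : realType}.
Implicit Types (U : set R[i]) (u : R[i] -> R) (z : R[i]) (j : 'I_2).

Definition axis j : R[i] := if j == 0 then 1 else 0 +i* 1.

Definition coord j z : R := if j == 0 then complex.Re z else complex.Im z.

Definition along u z j (t : R) : R := u (z + t%:C * axis j).

Definition pd j u z : R := derive1 (along u z j) 0.

Fixpoint class_C (k : nat) U u : Prop :=
  (forall z, U z -> {for z, continuous u}) /\
  (if k is k'.+1 then
     forall j, (forall z, U z -> derivable (along u z j) 0 1) /\
               class_C k' U (pd j u)
   else True).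

Definition smooth U u : Prop := forall k, class_C k U u.

Definition pdv d j (f : R[i] -> 'rV[R]_d) z : 'rV[R]_d :=
  \row_k pd j (fun w => f w 0 k) z.

End PlaneCalculus.

Section DeSitter.
Context {R : realType}.

Definition mx2 (K : Type) (a b c d : K) : 'M[K]_2 :=
  \matrix_(i, j) if i == 0 then if j == 0 then a else b
                 else if j == 0 then c else d.

Definition lorentz (X Y : 'rV[R]_4) : R :=
  - (X 0 0 * Y 0 0) + X 0 1 * Y 0 1 + X 0 2 * Y 0 2 + X 0 3 * Y 0 3.

Definition herm (X : 'rV[R]_4) : 'M[R[i]]_2 :=
  mx2 ((X 0 0 + X 0 3) +i* 0) (X 0 1 +i* X 0 2)
      (X 0 1 -i* X 0 2) ((X 0 0 - X 0 3) +i* 0).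

Definition de_sitter : set 'rV[R]_4 := [set X | \det (herm X) = -1].

Definition e3 : 'M[R[i]]_2 := mx2 1 0 0 (-1).

Definition ctranspose (F : 'M[R[i]]_2) : 'M[R[i]]_2 := (map_mx conjc F)^T.

Definition SU11 : set 'M[R[i]]_2 :=
  [set S | exists p q : R[i],
     S = mx2 p q (conjc q) (conjc p) /\ `|p| ^+ 2 - `|q| ^+ 2 = 1].

End DeSitter.

(* A (0,2)-tensor on an open set of the plane is given by its matrix in the
   coordinates (x, y). *)
Section Tensors.
Context {R : realType}.
Notation tensor := (R[i] -> 'M[R]_2).
Implicit Types (M : set R[i]) (g : tensor) (z : R[i]).

Definition quad (A : 'M[R]_2) (v : 'rV[R]_2) : R := (v *m A *m v^T) 0 0.

Definition posdef (A : 'M[R]_2) : Prop :=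
  A^T = A /\ forall v, v != 0 -> 0 < quad A v.

Definition riemannian M g : Prop :=
  (forall i j, smooth M (fun z => g z i j)) /\ forall z, M z -> posdef (g z).

Definition velocity (c : R -> R[i]) (t : R) : 'rV[R]_2 :=
  \row_j derive1 (coord j \o c) t.

(* Any piecewise C^1 curve can be reparametrized to be C^1, by stopping at its
   corners, so C^1 curves give the usual Riemannian distance. *)
Definition C1_curve M (x y : R[i]) (c : R -> R[i]) : Prop :=
  [/\ forall j t, derivable (coord j \o c) t 1,
      forall j, continuous (derive1 (coord j \o c)),
      c 0 = x /\ c 1 = y &
      forall t : R, I01 t -> M (c t)].

Definition curve_length g (c : R -> R[i]) : \bar R :=
  (\int[lebesgue_measure]_(t in I01)
     (Num.sqrt (quad (g (c t)) (velocity c t)))%:E)%E.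

Definition riem_dist M g (x y : R[i]) : \bar R :=
  ereal_inf [set curve_length g c | c in C1_curve M x y].

Definition complete_metric M g : Prop :=
  forall u : nat -> R[i], (forall m, M (u m)) ->
  (forall e : R, 0 < e -> exists N, forall k m, (N <= k)%N -> (N <= m)%N ->
     (riem_dist M g (u k) (u m) < e%:E)%E) ->
  exists2 l, M l & forall e : R, 0 < e -> exists N, forall m, (N <= m)%N ->
     (riem_dist M g (u m) l < e%:E)%E.

Definition christoffel g (k i j : 'I_2) z : R :=
  2^-1 * \sum_l invmx (g z) k l *
    (pd i (fun w => g w j l) z + pd j (fun w => g w i l) z
     - pd l (fun w => g w i j) z).

(* The coefficient R^l_{kij} in R(d_i, d_j) d_k = \sum_l R^l_{kij} d_l, where
   R(X, Y) = [nabla_X, nabla_Y] - nabla_[X, Y]. *)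
Definition riem_tensor g (l k i j : 'I_2) z : R :=
  pd i (christoffel g l j k) z - pd j (christoffel g l i k) z
  + \sum_m (christoffel g m j k z * christoffel g l i m z
            - christoffel g m i k z * christoffel g l j m z).

(* <R(d_x, d_y) d_y, d_x> / (|d_x|^2 |d_y|^2 - <d_x, d_y>^2) *)
Definition gauss_curvature g z : R :=
  (\sum_l g z l 0 * riem_tensor g l 1 0 1 z) / \det (g z).

Definition finite_total_curvature M g : Prop :=
  (\int[lebesgue_measure \x lebesgue_measure]_
     (v in [set v : R * R | M (v.1 +i* v.2)])
     (`|gauss_curvature g (v.1 +i* v.2)|
        * Num.sqrt (\det (g (v.1 +i* v.2))))%:E < +oo)%E.

End Tensors.

Section CMC1Faces.
Context {R : realType}.
Implicit Types (M W : set R[i]) (f : R[i] -> 'rV[R]_4) (z : R[i]).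

Definition ds2 f z : 'M[R]_2 :=
  \matrix_(i, j) lorentz (pdv i f z) (pdv j f z).

(* Positive definiteness of the pulled back form implies that the differential
   is injective. *)
Definition spacelike_at f z : Prop := posdef (ds2 f z).

Definition oriented_normal f z (N : 'rV[R]_4) : Prop :=
  [/\ lorentz N N = -1,
      lorentz N (f z) = 0,
      forall j, lorentz N (pdv j f z) = 0 &
      0 < \det (\matrix_(i < 4)
                  nth 0 [:: pdv 0 f z; pdv 1 f z; N; f z] i)].

Definition second_form f z (N : 'rV[R]_4) : 'M[R]_2 :=
  \matrix_(i, j) lorentz (pdv i (pdv j f) z) N.

Definition mean_curvature f z (N : 'rV[R]_4) : R :=
  2^-1 * \tr (invmx (ds2 f z) *m second_form f z N).

(* The oriented normal is unique where f is spacelike. *)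
Definition cmc1_at f z : Prop :=
  exists2 N, oriented_normal f z N & mean_curvature f z N = 1.

Definition conformal_at f z : Prop := exists2 l : R, 0 < l & ds2 f z = l%:M.

Definition singular_at f z : Prop := ds2 f z \notin unitmx.

Definition admissible M W f (p : R[i]) : Prop :=
  (exists (U : set R[i]) (beta : R[i] -> R) (h : R[i] -> 'M[R]_2),
    [/\ [/\ open U, U p & U `<=` M],
        class_C 1 (U `&` W) beta /\
          (forall z, (U `&` W) z -> 0 < beta z),
        (forall i j, class_C 1 U (fun z => h z i j)) /\
          (forall z, U z -> posdef (h z)) &
        forall z, (U `&` W) z -> h z = beta z *: ds2 f z]) /\
  (exists j, pdv j f p != 0).

Definition cmc1_map M W f : Prop :=
  [/\ forall k, smooth M (fun z => f z 0 k),
      forall z, M z -> de_sitter (f z),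
      [/\ open W, W `<=` M & M `<=` closure W] &
      forall z, W z -> spacelike_at f z /\ cmc1_at f z].

(* The complex structure induced by a CMC 1 face on M is required to be the
   one M has as an open subset of the plane: the coordinate z is conformal. *)
Definition cmc1_face M f : Prop :=
  exists W, [/\ cmc1_map M W f,
    forall z, W z -> conformal_at f z &
    forall z, M z -> singular_at f z -> admissible M W f z].

Definition has_modified_metric M f (P : (R[i] -> 'M[R]_2) -> Prop) : Prop :=
  exists (K : set R[i]) (T : R[i] -> 'M[R]_2),
    [/\ compact K /\ K `<=` M,
        forall z, M z -> (T z)^T = T z,
        forall z, (M `\` K) z -> T z = 0,
        riemannian M (fun z => ds2 f z + T z) &
        P (fun z => ds2 f z + T z)].

Definition complete_face M f : Prop :=
  has_modified_metric M f (complete_metric M).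

Definition finite_type M f : Prop :=
  has_modified_metric M f (finite_total_curvature M).

End CMC1Faces.

(* The universal cover of M is taken in its standard model: homotopy classes,
   with fixed endpoints, of paths in M issuing from a base point z0, with
   projection g |-> g 1. A map on the universal cover is a map on paths which
   is constant on homotopy classes. *)
Section UniversalCover.
Context {R : realType}.
Notation path := (R -> R[i]).
Implicit Types (M : set R[i]) (z : R[i]) (g d : path).
Implicit Types (F : path -> 'M[R[i]]_2).

Definition path_from M (z0 : R[i]) g : Prop :=
  [/\ {within I01, continuous g},
      g 0 = z0 & forall t : R, I01 t -> M (g t)].

Definition path_homotopic M g d : Prop :=
  exists H : R * R -> R[i],
    [/\ {within I01 `*` I01, continuous H},
        forall s t : R, I01 s -> I01 t -> M (H (s, t)),
        forall t : R, I01 t -> H (0, t) = g t /\ H (1, t) = d t &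
        forall s : R, I01 s -> H (s, 0) = g 0 /\ H (s, 1) = g 1].

Definition path_cat g d : path :=
  fun t => if t <= 2^-1 then g (2 * t) else d (2 * t - 1).

Definition path_rev g : path := fun t => g (1 - t).

Definition segment (a b : R[i]) : path := fun t => a + t%:C * (b - a).

(* F near the point [g] of the universal cover, read in the local coordinate
   w given by the projection. *)
Definition branch F g (w : R[i]) : 'M[R[i]]_2 :=
  F (path_cat g (segment (g 1) w)).

Definition dlift F g : 'M[R[i]]_2 :=
  \matrix_(i, j) derive1 (fun w : R[i] => branch F g w i j) (g 1).

(* Holomorphy is complex differentiability at every point of the universal
   cover. *)
Definition null_lift M z0 (f : R[i] -> 'rV[R]_4) F : Prop :=
  (forall g d, path_from M z0 g -> path_from M z0 d ->
     path_homotopic M g d -> F g = F d) /\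
  (forall g, path_from M z0 g ->
     [/\ \det (F g) = 1,
         forall i j, derivable (fun w : R[i] => branch F g w i j) (g 1) 1,
         dlift F g != 0 /\ \det (dlift F g) = 0 &
         herm (f (g 1)) = F g *m e3 *m ctranspose (F g)]).

(* Points of the Riemann sphere are elements of option R[i], with None the
   point at infinity; ratio a b is only meaningful for (a, b) != (0, 0). *)
Definition ratio (a b : R[i]) : option R[i] :=
  if b == 0 then None else Some (a / b).

(* The two columns of dF have the same ratio; one of them may vanish at a
   point, but not both, so this determines G on M. *)
Definition hyperbolic_gauss_map M z0 F (G : R[i] -> option R[i]) : Prop :=
  forall g, path_from M z0 g ->
  forall k : 'I_2, col k (dlift F g) != 0 ->
    G (g 1) = ratio (dlift F g 0 k) (dlift F g 1 k).

End UniversalCover.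

Section Ends.
Context {R : realType} (n : nat) (p : 'I_n -> R[i]).

Definition punctured_plane : set R[i] := [set z | forall j, z != p j].

(* The end Some j is the puncture p j, and None is the puncture at infinity;
   the coordinate w is centered at the puncture. *)
Definition end_coord (e : option 'I_n) (w : R[i]) : R[i] :=
  if e is Some j then p j + w else w^-1.

(* A map to the sphere is meromorphic at a point iff it is locally [a : b]
   with a, b holomorphic without common zero. *)
Definition regular_end (G : R[i] -> option R[i]) (e : option 'I_n) : Prop :=
  exists a b : R[i] -> R[i],
    [/\ \forall w \near (0 : R[i]), derivable a w 1 /\ derivable b w 1,
        (a 0, b 0) != (0, 0) &
        \forall w \near (0 : R[i])^', G (end_coord e w) = ratio (a w) (b w)].

Definition end_circle (e : option 'I_n) (r : R) (t : R) : R[i] :=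
  end_coord e (r%:C * (cos (2 * pi * t) +i* sin (2 * pi * t))).

(* The deck transformation of a loop l based at z0 maps [g] to [l g]. *)
Definition elliptic_end z0 (F : (R -> R[i]) -> 'M[R[i]]_2) (e : option 'I_n)
    : Prop :=
  exists (r : R) (d : R -> R[i]),
    [/\ 0 < r /\
          (forall w : R[i], w != 0 -> `|w| <= r%:C ->
             punctured_plane (end_coord e w)),
        path_from punctured_plane z0 d /\ d 1 = end_circle e r 0 &
        exists Phi,
          [/\ SU11 Phi,
              forall g, path_from punctured_plane z0 g ->
                F (path_cat
                     (path_cat d (path_cat (end_circle e r) (path_rev d))) g)
                = F g *m Phi &
              exists2 S, SU11 S & exists theta : R,
                Phi = S *m mx2 (cos theta +i* sin theta) 0
                               0 (cos theta -i* sin theta) *m invmx S]].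

End Ends.

(* Main.v *)
(* Put p_j = j and let P be a small constant multiple of \prod_j ('X - p_j).
   The equation y'' = y has the solutions y_1 = e^z and y_2 = - e^(-z) / 2 of
   Wronskian 1. With a_i = y_i / P and u_i = P y_i' - P' y_i one has
   a_i' = o u_i and u_i' = g' a_i, where o = P^-2 and g is a polynomial with
   g' = P (P - P''); hence, for b_i = u_i - g a_i, the matrix
   F = [[a_1, b_1], [a_2, b_2]] is a null curve in SL(2, C). It is single-valued
   on the punctured plane, so f = F e3 F^* is a face all of whose ends are
   elliptic. With s = |g|^2 the induced metric is |o|^2 (1 - s)^2 |dz|^2; it
   degenerates exactly on the level set s = 1, which is compact and, P being
   small, avoids the punctures. Replacing (1 - s)^2 by a positive function near
   s = 1 gives a metric which is complete and has finite total curvature by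
   polynomial estimates. The hyperbolic Gauss map is u_1 / u_2, that is, up to a
   constant, e^(2z) (P - P') / (P + P'): it is meromorphic at each p_j and has
   an essential singularity at infinity. *)
From HB Require Import structures.
From mathcomp Require Import all_boot all_order all_algebra.
From mathcomp Require Import complex.
From mathcomp Require Import all_classical all_reals all_analysis.
From mathcomp Require Import measurable_realfun.
From mathcomp Require Import ring lra.
Require Import Defs.

Set Implicit Arguments.
Unset Strict Implicit.
Unset Printing Implicit Defensive.

Import Order.TTheory GRing.Theory Num.Theory numFieldNormedType.Exports.

Local Open Scope classical_set_scope.
Local Open Scope ring_scope.
Local Open Scope complex_scope.

(** * Real and imaginary parts, conjugation and modulus on [R[i]] *)

Section ComplexPlane.
Context {R : realType}.
Implicit Types (z w : R[i]) (t : R).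

(** Since [F^-1 F' = o [[g, -g^2], [1, -g]]], the pair [(g, o dz)] is Weierstrass data for [F]. The
    usual obstacle is the period problem: for given data the monodromy of the solution [F] has to
    lie in SU(1,1). Prescribing [F] instead of the data avoids it: with [y'' = y] the quotient
    [u_i' / a_i] is a polynomial, whose primitive [g] is single-valued, so no logarithm can occur.
    The exponentials enter [F] and the Gauss map only. The metric depends on [g] and [o] alone, both
    rational, which is why an essential singularity of the Gauss map is compatible with polynomial
    estimates. The second obstacle is that the metric may be modified on a compact set only, so the
    singular set |g| = 1 must not accumulate at an end. At infinity a nonconstant polynomial [g] is
    proper; at the punctures [g] has finite values, which are made small by scaling [P], as [g] is
    quadratic in [P]. Finally the degree 2n + 1 of [g] against the degree n of [P] leaves enough
    room at infinity both for completeness and for integrability of the curvature. *)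

Lemma ltr0c t : (0 < t%:C :> R[i]) = (0 < t).
Proof. exact: (ltcR 0 t). Qed.

Lemma cReD z w : complex.Re (z + w) = complex.Re z + complex.Re w.
Proof. by case: z; case: w. Qed.
Lemma cImD z w : complex.Im (z + w) = complex.Im z + complex.Im w.
Proof. by case: z; case: w. Qed.
Lemma cReN z : complex.Re (- z) = - complex.Re z.
Proof. by case: z. Qed.
Lemma cImN z : complex.Im (- z) = - complex.Im z.
Proof. by case: z. Qed.
Lemma cReM z w : complex.Re (z * w) =
  complex.Re z * complex.Re w - complex.Im z * complex.Im w.
Proof. by case: z; case: w. Qed.
Lemma cImM z w : complex.Im (z * w) =
  complex.Re z * complex.Im w + complex.Im z * complex.Re w.
Proof. by case: z => a b; case: w => c d /=; rewrite mulrC. Qed.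
(** Conjugation in coordinates, so that identities involving it reduce to real ones through [ReImE]
    and [ReImP]. *)
Definition cj z : R[i] := complex.Re z -i* complex.Im z.

Lemma cjE z : conjc z = cj z.
Proof. by case: z. Qed.

Lemma Reconj z : complex.Re (cj z) = complex.Re z.
Proof. by case: z. Qed.
Lemma Imconj z : complex.Im (cj z) = - complex.Im z.
Proof. by case: z. Qed.

Definition ReImE := (cReD, cImD, cReN, cImN, cReM, cImM, Reconj, Imconj).

Lemma ReImP z w : complex.Re z = complex.Re w -> complex.Im z = complex.Im w -> z = w.
Proof. by case: z => a b; case: w => c d /= -> ->. Qed.

Lemma conjD z w : (cj (z + w)) = (cj z) + (cj w).
Proof. by apply: ReImP; rewrite !ReImE //; ring. Qed.
Lemma conjN z : (cj (- z)) = - (cj z).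
Proof. by apply: ReImP; rewrite !ReImE. Qed.
Lemma conjM z w : (cj (z * w)) = (cj z) * (cj w).
Proof. by apply: ReImP; rewrite !ReImE; ring. Qed.
Lemma conjK z : (cj (cj z)) = z.
Proof. by apply: ReImP; rewrite !ReImE ?opprK. Qed.
Lemma conjR t : (cj (t%:C)) = t%:C :> R[i].
Proof. by apply: ReImP; rewrite !ReImE //= oppr0. Qed.

Lemma conj_nat n : cj n%:R = n%:R.
Proof. by rewrite -cjE rmorph_nat. Qed.

Lemma conj0 : cj 0 = 0.
Proof. exact: (conj_nat 0). Qed.
Lemma conj1 : cj 1 = 1.
Proof. exact: (conj_nat 1). Qed.

Definition conjE := (conjD, conjN, conjM, conjK, conjR, conj0, conj1, conj_nat).

Lemma rcD (x y : R) : (x + y)%:C = x%:C + y%:C :> R[i].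
Proof. by apply: ReImP; rewrite !ReImE //= addr0. Qed.
Lemma rcN (x : R) : (- x)%:C = - x%:C :> R[i].
Proof. by apply: ReImP; rewrite !ReImE //= oppr0. Qed.
Lemma rcM (x y : R) : (x * y)%:C = x%:C * y%:C :> R[i].
Proof. by apply: ReImP; rewrite !ReImE //=; ring. Qed.
Lemma rc_nat n : (n%:R)%:C = n%:R :> R[i].
Proof. exact: rmorph_nat. Qed.
Lemma rcX (x : R) n : (x ^+ n)%:C = x%:C ^+ n :> R[i].
Proof. exact: rmorphXn. Qed.

Lemma rcB (x y : R) : (x - y)%:C = x%:C - y%:C :> R[i].
Proof. by rewrite rcD rcN. Qed.
Lemma rc1 : (1 : R)%:C = 1 :> R[i].
Proof. by []. Qed.

Definition rcE := (rcB, rcN, rcM, rcX, rc1, rc_nat).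


(** The squared modulus as an element of [R]: the norm of [R[i]] takes its values in [R[i]]. *)
Definition sqn z : R := complex.Re z ^+ 2 + complex.Im z ^+ 2.

Lemma sqn_ge0 z : 0 <= sqn z.
Proof. by rewrite addr_ge0 ?sqr_ge0. Qed.

Lemma sqnE z : (sqn z)%:C = z * (cj z).
Proof. by apply: ReImP; rewrite !ReImE /= /sqn; ring. Qed.

Lemma sqn_norm z : (sqn z)%:C = `|z| ^+ 2.
Proof. by rewrite sqnE sqr_normc -cjE. Qed.

Lemma sqnM z w : sqn (z * w) = sqn z * sqn w.
Proof. by rewrite /sqn !ReImE; ring. Qed.

Lemma sqn_eq0 z : (sqn z == 0) = (z == 0).
Proof.
rewrite /sqn paddr_eq0 ?sqr_ge0// !sqrf_eq0; apply/andP/eqP => [[/eqP a /eqP b]|->//].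
exact: ReImP.
Qed.

Lemma sqn_gt0 z : (0 < sqn z) = (z != 0).
Proof. by rewrite lt_neqAle sqn_ge0 eq_sym sqn_eq0 andbT. Qed.

Lemma normC_real z : `|z| = (Num.sqrt (sqn z))%:C.
Proof. exact: normc_def. Qed.

Lemma ler_Re_norm z (c : R) : `|z| <= c%:C -> `|complex.Re z| <= c.
Proof.
by move=> h; rewrite -lecR; apply: le_trans h; exact: normc_ge_Re.
Qed.

(** Carries statements about real parts over to imaginary parts, at the cost of a factor of modulus
    1. *)
Lemma Im_mulNi z : complex.Im z = complex.Re (- 'i%C * z).
Proof. by rewrite !ReImE /= ; ring. Qed.

Lemma ler_Im_norm z (c : R) : `|z| <= c%:C -> `|complex.Im z| <= c.
Proof.
move=> h; rewrite Im_mulNi; apply: ler_Re_norm; rewrite normrM normrN.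
suff -> : `|'i%C : R[i]| = 1 by rewrite mul1r.
by rewrite normC_real /sqn /= expr0n expr1n add0r sqrtr1.
Qed.

Lemma continuous_Re : continuous (@complex.Re R : R[i] -> R).
Proof.
move=> z; apply/(@cvgrPdist_le _ _ _ _ (nbhs_filter z)) => e e0.
have /(@cvgrPdist_le _ _ _ _ (nbhs_filter z))/(_ e%:C) := @cvg_id R[i] (nbhs z).
rewrite ltr0c => /(_ e0); apply: filterS => w /=.
by rewrite -cReN -cReD => /ler_Re_norm.
Qed.

Lemma continuous_Im : continuous (@complex.Im R : R[i] -> R).
Proof.
move=> z; apply/(@cvgrPdist_le _ _ _ _ (nbhs_filter z)) => e e0.
have /(@cvgrPdist_le _ _ _ _ (nbhs_filter z))/(_ e%:C) := @cvg_id R[i] (nbhs z).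
rewrite ltr0c => /(_ e0); apply: filterS => w /=.
by rewrite -cImN -cImD => /ler_Im_norm.
Qed.

Lemma norm_le_ReIm z : `|z| <= (`|complex.Re z| + `|complex.Im z|)%:C.
Proof.
rewrite normC_real lecR -[leRHS]ger0_norm ?addr_ge0// -sqrtr_sqr ler_sqrt ?sqr_ge0//.
rewrite /sqn sqrrD !real_normK ?num_real//.
have := mulr_ge0 (normr_ge0 (complex.Re z)) (normr_ge0 (complex.Im z)); lra.
Qed.

Lemma cvg_complex (T : Type) (F : set_system T) (h : T -> R[i]) z : Filter F ->
  complex.Re (h t) @[t --> F] --> complex.Re z ->
  complex.Im (h t) @[t --> F] --> complex.Im z -> h t @[t --> F] --> z.
Proof.
move=> FF hr hi; apply/cvgrPdist_le => e e0.
have /complex_realP[c ec] : e \is Num.real by apply: gtr0_real.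
have c0 : 0 < c / 2 by rewrite divr_gt0// -ltr0c -ec.
move/cvgrPdist_le/(_ _ c0) in hr; move/cvgrPdist_le/(_ _ c0) in hi.
near=> t; apply: le_trans (norm_le_ReIm _) _; rewrite ec lecR (splitr c).
by rewrite !ReImE lerD//; near: t.
Unshelve. all: by end_near. Qed.

Lemma continuous_real_complex : continuous (real_complex R : R -> R[i]).
Proof. by move=> t; apply: cvg_complex; [exact: cvg_id|exact: cvg_cst]. Qed.

Lemma axisM_continuous z (j : 'I_2) : continuous (fun t : R => z + t%:C * axis j : R[i]).
Proof.
move=> t; apply: cvgD; [exact: cvg_cst|apply: cvgM; [|exact: cvg_cst]].
exact: continuous_real_complex.
Qed.

Lemma Re_mul_real z t : complex.Re (z * t%:C) = complex.Re z * t.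
Proof. by rewrite cReM /= mulr0 subr0. Qed.

Lemma Re_mul2 z : complex.Re (2 * z) = 2 * complex.Re z.
Proof. by rewrite mulrC -[2 in LHS]rc_nat Re_mul_real mulrC. Qed.

End ComplexPlane.

(** * Caratheodory slopes; derivatives of complex-valued functions of a real variable *)

Lemma caratheodory_ex (K : numFieldType) (f : K -> K) (x a : K) :
  is_derive x 1 f a -> exists q : K -> K,
    [/\ forall z, f z - f x = q z * (z - x), {for x, continuous q} & q x = a].
Proof.
move=> Hd.
exists (fun z => if z == x then a else (f z - f x) / (z - x)); split.
- move=> z; case: eqP => [->|/eqP]; first by rewrite !subrr mulr0.
  by rewrite -subr_eq0 => /divfK->.
- apply/continuous_withinNshiftx; rewrite eqxx /=.
  pose g1 h := (h^-1 *: ((f \o shift x) h%:A - f x)).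
  have F1 : g1 @ 0^' --> a by case: Hd => H1 <-.
  apply: cvg_trans F1; apply: near_eq_cvg; rewrite /g1 !fctE.
  near=> i.
  rewrite ifN; first by rewrite addrK mulrC /= [_%:A]mulr1.
  rewrite -subr_eq0 addrK.
  by near: i; rewrite near_withinE /= near_simpl; near=> x1.
- by rewrite eqxx.
Unshelve. all: by end_near. Qed.

Section CurveDerivative.
Context {R : realType}.
Implicit Types (c : R -> R[i]) (t : R) (d : R[i]).

(** The source is [R] while the target is normed over [R[i]], so the derivative is taken
    componentwise. *)
Definition cderive c t d : Prop :=
  is_derive t (1 : R) (fun s => complex.Re (c s)) (complex.Re d) /\
  is_derive t (1 : R) (fun s => complex.Im (c s)) (complex.Im d).

Lemma cderive_cst (a : R[i]) t : cderive (fun=> a) t 0.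
Proof. by split; exact: is_derive_cst. Qed.

Lemma cderiveD c e t d d' : cderive c t d -> cderive e t d' ->
  cderive (fun s => c s + e s) t (d + d').
Proof.
move=> [cr ci] [er ei]; split; under eq_fun do rewrite ReImE; rewrite ReImE; exact: is_deriveD.
Qed.

Lemma cderiveN c t d : cderive c t d -> cderive (fun s => - c s) t (- d).
Proof.
move=> [cr ci]; split; under eq_fun do rewrite ReImE; rewrite ReImE; exact: is_deriveN.
Qed.

Lemma cderive_conj c t d : cderive c t d -> cderive (fun s => (cj (c s))) t (cj d).
Proof.
move=> [cr ci]; split; under eq_fun do rewrite ReImE; rewrite ReImE => //; exact: is_deriveN.
Qed.

Lemma is_deriveM1 (u v : R -> R) t a b : is_derive t (1 : R) u a ->
  is_derive t (1 : R) v b -> is_derive t (1 : R) (fun s => u s * v s) (u t * b + v t * a).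
Proof. move=> ha hb; exact: is_deriveM. Qed.

Lemma cderiveM c e t d d' : cderive c t d -> cderive e t d' ->
  cderive (fun s => c s * e s) t (d * e t + c t * d').
Proof.
move=> [cr ci] [er ei]; split; under eq_fun do rewrite ReImE; rewrite !ReImE.
  apply: (@is_derive_eq _ _ _ _ _ _ _ _ (is_deriveB (is_deriveM1 cr er) (is_deriveM1 ci ei))); ring.
apply: (@is_derive_eq _ _ _ _ _ _ _ _ (is_deriveD (is_deriveM1 cr ei) (is_deriveM1 ci er))); ring.
Qed.

Lemma cderive_axis (z : R[i]) (j : 'I_2) t :
  cderive (fun s : R => z + s%:C * axis j) t (axis j).
Proof.
have H (a b : R) : is_derive t (1 : R) (fun s : R => a + s * b) b.
  apply: (@is_derive_eq _ _ _ _ _ _ _ _ (is_deriveD (is_derive_cst a t 1)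
     (is_deriveM1 (is_derive_id t 1) (is_derive_cst b t 1)))); rewrite /=; ring.
split; under eq_fun do rewrite !ReImE /= mul0r ?subr0 ?addr0; exact: H.
Qed.

Lemma cderive_continuous c t d : cderive c t d -> {for t, continuous c}.
Proof.
move=> [[/derivable1_diffP/differentiable_continuous cr _]
  [/derivable1_diffP/differentiable_continuous ci _]].
exact: cvg_complex cr ci.
Qed.

Lemma cderiveP c t d : cderive c t d <-> exists q : R -> R[i],
  [/\ forall s, c s - c t = q s * (s - t)%:C, {for t, continuous q} & q t = d].
Proof.
split.
  move=> [/is_derive1_caratheodory[p [pE pc pt]] /is_derive1_caratheodory[q [qE qc qt]]].
  exists (fun s => p s +i* q s); split.
  - by move=> s; apply: ReImP; rewrite !ReImE /= ?(pE, qE); ring.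
  - by apply: cvg_complex => //=.
  - by rewrite pt qt; case: (d).
move=> [q [qE qc qt]]; split; apply/is_derive1_caratheodory.
  exists (fun s => complex.Re (q s)); split; last by rewrite qt.
    by move=> s; rewrite -cReN -cReD qE ReImE /=; ring.
  exact: (@continuous_comp _ _ _ q (@complex.Re R) t qc (@continuous_Re _ _)).
exists (fun s => complex.Im (q s)); split; last by rewrite qt.
  by move=> s; rewrite -cImN -cImD qE ReImE /=; ring.
exact: (@continuous_comp _ _ _ q (@complex.Im R) t qc (@continuous_Im _ _)).
Qed.

Lemma complex_caratheodory (h : R[i] -> R[i]) (h' z : R[i]) : is_derive z 1 h h' ->
  exists q : R[i] -> R[i],
    [/\ forall w, h w - h z = q w * (w - z), {for z, continuous q} & q z = h'].
Proof. by move=> /caratheodory_ex[q [qE qc qz]]; exists q; split. Qed.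

Lemma continuousMc (c e : R -> R[i]) t : {for t, continuous c} -> {for t, continuous e} ->
  {for t, continuous (fun s => c s * e s)}.
Proof. by move=> cc ce; exact: (@cvgM R[i] _ _ _ c e _ _ cc ce). Qed.

(** The chain rule across the two scalar fields: the Caratheodory slopes of [h] and [c] multiply,
    and a product of continuous slopes is continuous. *)
Lemma cderive_comp (h : R[i] -> R[i]) (h' : R[i]) c t d :
  is_derive (c t) 1 h h' -> cderive c t d -> cderive (h \o c) t (h' * d).
Proof.
move=> /complex_caratheodory[p [pE pc pt]] cd; have cc := cderive_continuous cd.
move: cd => /cderiveP[q [qE qc qt]]; apply/cderiveP.
exists (fun s => p (c s) * q s); split.
- by move=> s /=; rewrite pE qE mulrA.
- apply: continuousMc qc; exact: (continuous_comp cc pc).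
- by rewrite pt qt.
Qed.

End CurveDerivative.

(** * Stability of the classes C^k on open sets of the plane *)

Section SmoothFunctions.
Context {R : realType}.
Implicit Types (U : set R[i]) (u v : R[i] -> R) (z : R[i]) (j : 'I_2).

Lemma cont_ext u v z : (\forall w \near z, u w = v w) ->
  {for z, continuous u} -> {for z, continuous v}.
Proof.
move=> uv cu; have uvz := @nbhs_singleton _ z _ uv.
rewrite /prop_for /continuous_at -uvz.
by apply: cvg_trans cu; apply: (@near_eq_cvg _ _ _ (nbhs_filter z)).
Qed.

Lemma contD u v z : {for z, continuous u} -> {for z, continuous v} ->
  {for z, continuous (fun w => u w + v w)}.
Proof. by move=> cu cv; exact: (@cvgD _ _ _ _ (nbhs_filter z) u v _ _ cu cv). Qed.

Lemma contM u v z : {for z, continuous u} -> {for z, continuous v} ->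
  {for z, continuous (fun w => u w * v w)}.
Proof. by move=> cu cv; exact: (@cvgM _ _ _ (nbhs_filter z) u v _ _ cu cv). Qed.

Lemma contV u z : u z != 0 -> {for z, continuous u} ->
  {for z, continuous (fun w => (u w)^-1)}.
Proof. by move=> uz cu; exact: (@cvgV _ _ _ (nbhs_filter z) u _ uz cu). Qed.

Lemma cont_cst (c : R) z : {for z, continuous (fun=> c : R)}.
Proof. exact: (@cvg_cst _ _ _ _ (nbhs_filter z)). Qed.

Definition is_pd j u z (d : R) : Prop := is_derive (0 : R) (1 : R) (along u z j) d.

Lemma along0 u z j : along u z j 0 = u z.
Proof. by rewrite /along mul0r addr0. Qed.

Lemma is_pd_pd j u z d : is_pd j u z d -> pd j u z = d.
Proof. by move=> [_ ud]; rewrite /pd derive1E. Qed.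

Lemma is_pd_derivable j u z d : is_pd j u z d -> derivable (along u z j) 0 1.
Proof. by case. Qed.

Lemma derivable_is_pd j u z : derivable (along u z j) 0 1 -> is_pd j u z (pd j u z).
Proof. by move=> ud; rewrite /pd derive1E; exact/derivableP. Qed.

Lemma is_pd_near j u v z d : (\forall w \near z, u w = v w) ->
  is_pd j u z d -> is_pd j v z d.
Proof.
move=> uv; apply: near_eq_is_derive.
have : (fun t : R => z + t%:C * axis j) t @[t --> (0 : R)] --> (z : R[i]).
  by have := @axisM_continuous R z j 0; rewrite /continuous_at mul0r addr0.
by move/(_ _ uv).
Qed.

Lemma is_pdD j u v z a b : is_pd j u z a -> is_pd j v z b ->
  is_pd j (fun w => u w + v w) z (a + b).
Proof. exact: is_deriveD. Qed.

Lemma is_pdN j u z a : is_pd j u z a -> is_pd j (fun w => - u w) z (- a).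
Proof. exact: is_deriveN. Qed.

Lemma is_pdM j u v z a b : is_pd j u z a -> is_pd j v z b ->
  is_pd j (fun w => u w * v w) z (a * v z + u z * b).
Proof.
move=> ha hb; have := is_deriveM1 ha hb; rewrite !along0 => h.
by apply: is_derive_eq; rewrite addrC mulrC.
Qed.

Lemma is_pd_cst j (c : R) z : is_pd j (fun=> c) z 0.
Proof. exact: is_derive_cst. Qed.

Lemma is_pd_comp j (h : R -> R) (h' : R) u z d :
  is_derive (u z) 1 h h' -> is_pd j u z d -> is_pd j (fun w => h (u w)) z (h' * d).
Proof.
move=> hh ud; rewrite -(along0 u z j) in hh.
exact: (is_derive1_comp hh ud).
Qed.

Lemma is_pdV j u z d : u z != 0 -> is_pd j u z d ->
  is_pd j (fun w => (u w)^-1) z (- (u z) ^- 2 * d).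
Proof.
move=> uz; apply: (is_pd_comp (h := fun x => x^-1)).
have h : is_derive (u z) (1 : R) (fun x : R => (idfun x)^-1) (- (u z) ^- 2 *: 'D_1 idfun (u z)).
  by split; [apply: derivableV|apply: deriveV].
by apply: is_derive_eq; rewrite derive_id -mulr_algl mulr1 [_ *: _]mulr1.
Qed.

Lemma class_C_cont k U u : class_C k U u -> forall z, U z -> {for z, continuous u}.
Proof. by case: k => [|k] []. Qed.

Lemma class_C_ext k U u v : open U -> (forall z, U z -> u z = v z) ->
  class_C k U u -> class_C k U v.
Proof.
move=> oU; elim: k u v => [|k IH] u v uv [cu du].
  split => // z Uz; apply: cont_ext (cu _ Uz).
  by apply: filterS (open_nbhs_nbhs (conj oU Uz)) => w /uv.
have uvn z : U z -> \forall w \near z, u w = v w.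
  by move=> Uz; apply: filterS (open_nbhs_nbhs (conj oU Uz)) => w /uv.
split.
  by move=> z Uz; apply: cont_ext (uvn _ Uz) (cu _ Uz).
move=> j; have [dj cj] := du j; split.
  by move=> z Uz; apply/is_pd_derivable/(is_pd_near (uvn _ Uz))/derivable_is_pd/dj.
apply: IH cj => z Uz; by apply/esym/is_pd_pd/(is_pd_near (uvn _ Uz))/derivable_is_pd/dj.
Qed.

Lemma class_C_sub k U V u : V `<=` U -> class_C k U u -> class_C k V u.
Proof.
move=> VU; elim: k u => [|k IH] u [cu du]; split; [by move=> z /VU/cu|by []|by move=> z /VU/cu|].
by move=> j; have [dj kj] := du j; split; [by move=> z /VU/dj|exact: IH].
Qed.

Lemma class_CW k U u : class_C k.+1 U u -> class_C k U u.
Proof.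
elim: k u => [|k IH] u [cu du]; first by split.
by split => // j; have [dj cj] := du j; split => //; exact: IH.
Qed.

(** Allows the partial derivatives to be given by explicit formulas that are valid on [U] only. *)
Lemma class_CS k U u : open U -> (forall z, U z -> {for z, continuous u}) ->
  (forall j, exists2 v, (forall z, U z -> is_pd j u z (v z)) & class_C k U v) ->
  class_C k.+1 U u.
Proof.
move=> oU cu du; split => // j; have [v uv cv] := du j; split.
  by move=> z /uv/is_pd_derivable.
by apply: class_C_ext cv => // z /uv/is_pd_pd.
Qed.

Lemma class_C_pd k U u : class_C k.+1 U u -> 
  (forall z j, U z -> is_pd j u z (pd j u z)) /\ (forall j, class_C k U (pd j u)).
Proof.
move=> [cu du]; split => [z j Uz|j]; last by case: (du j).
by apply: derivable_is_pd; case: (du j) => + _; apply.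
Qed.

Lemma class_C_cst k U c : open U -> class_C k U (fun=> c).
Proof.
move=> oU; have cc d z : U z -> {for z, continuous (fun=> d : R)}.
  by move=> _; exact: cont_cst.
elim: k c => [|k IH] c; first by split => // z Uz; exact: cc Uz.
by apply: class_CS => [//|z /cc//|j]; exists (fun=> 0) => // z _; exact: is_pd_cst.
Qed.

Lemma class_CD k U u v : open U -> class_C k U u -> class_C k U v ->
  class_C k U (fun z => u z + v z).
Proof.
move=> oU; elim: k u v => [|k IH] u v cu cv.
  by split => // z Uz; apply: contD; [exact: class_C_cont cu _ Uz|exact: class_C_cont cv _ Uz].
apply: class_CS => //.
  by move=> z Uz; apply: contD; [exact: class_C_cont cu _ Uz|exact: class_C_cont cv _ Uz].
have [[du cdu] [dv cdv]] := (class_C_pd cu, class_C_pd cv).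
move=> j; exists (fun z => pd j u z + pd j v z); last exact: IH.
by move=> z Uz; apply: is_pdD; [exact: du|exact: dv].
Qed.

Lemma class_CM k U u v : open U -> class_C k U u -> class_C k U v ->
  class_C k U (fun z => u z * v z).
Proof.
move=> oU; elim: k u v => [|k IH] u v cu cv.
  by split => // z Uz; apply: contM; [exact: class_C_cont cu _ Uz|exact: class_C_cont cv _ Uz].
apply: class_CS => //.
  by move=> z Uz; apply: contM; [exact: class_C_cont cu _ Uz|exact: class_C_cont cv _ Uz].
have [[du cdu] [dv cdv]] := (class_C_pd cu, class_C_pd cv).
move=> j; exists (fun z => pd j u z * v z + u z * pd j v z).
  by move=> z Uz; apply: is_pdM; [exact: du|exact: dv].
by apply: class_CD => //; apply: IH => //; exact: class_CW.
Qed.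

Lemma class_CN k U u : open U -> class_C k U u -> class_C k U (fun z => - u z).
Proof.
move=> oU cu; apply: (class_C_ext (u := fun z => -1 * u z)) => //.
  by move=> z _; rewrite mulN1r.
by apply: class_CM => //; exact: class_C_cst.
Qed.

Lemma class_CV k U u : open U -> (forall z, U z -> u z != 0) -> class_C k U u ->
  class_C k U (fun z => (u z)^-1).
Proof.
move=> oU u0; elim: k => [|k IH] cu.
  by split => // z Uz; apply: contV; [exact: u0|exact: class_C_cont cu _ Uz].
apply: class_CS => //.
  by move=> z Uz; apply: contV; [exact: u0|exact: class_C_cont cu _ Uz].
have [du cdu] := class_C_pd cu.
have cV := IH (class_CW cu).
move=> j; exists (fun z => - ((u z)^-1 * (u z)^-1) * pd j u z).
  by move=> z Uz; have := is_pdV (u0 _ Uz) (du z j Uz); rewrite expr2 invfM.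
by apply: class_CM => //; apply: class_CN => //; apply: class_CM.
Qed.

(** The induction on [k] composes [u] with the successive derivatives of [h]; a family [S] closed
    under differentiation keeps them all in view. It is used for the exponential, for the four
    functions [cos], [sin] and their opposites, and for the functions [flat p]. *)
Lemma class_C_comp (S : set (R -> R)) k U h u : open U ->
  (forall h, S h -> exists2 h', S h' & forall x, is_derive x (1 : R) h (h' x)) ->
  S h -> class_C k U u -> class_C k U (fun z => h (u z)).
Proof.
move=> oU SS; have ch q (x : R) : S q -> {for x, continuous q}.
  by case/SS => h' _ /(_ x) [] /derivable1_diffP/differentiable_continuous.
have chu q z : S q -> {for z, continuous u} -> {for z, continuous (fun w => q (u w))}.
  by move=> Sq cu; exact: (@continuous_comp _ _ _ u q z cu (ch _ _ Sq)).
elim: k h => [|k IH] h Sh cu.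
  by split => // z Uz; apply: chu => //; exact: class_C_cont cu _ Uz.
apply: class_CS => //.
  by move=> z Uz; apply: chu => //; exact: class_C_cont cu _ Uz.
have [du cdu] := class_C_pd cu.
have [h' Sh' hh'] := SS _ Sh.
move=> j; exists (fun z => h' (u z) * pd j u z).
  by move=> z Uz; exact: is_pd_comp (hh' _) (du _ _ Uz).
by apply: class_CM => //; apply: IH => //; exact: class_CW.
Qed.

Lemma class_C_Re k U : open U -> class_C k U (@complex.Re R).
Proof.
move=> oU; have cR z : U z -> {for z, continuous (@complex.Re R)}.
  by move=> _; exact: continuous_Re.
case: k => [|k]; first by split.
apply: class_CS => // j; exists (fun=> complex.Re (axis j : R[i])).
  by move=> z _; exact: (cderive_axis z j 0).1.
exact: class_C_cst.
Qed.

Lemma class_C_Im k U : open U -> class_C k U (@complex.Im R).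
Proof.
move=> oU; have cR z : U z -> {for z, continuous (@complex.Im R)}.
  by move=> _; exact: continuous_Im.
case: k => [|k]; first by split.
apply: class_CS => // j; exists (fun=> complex.Im (axis j : R[i])).
  by move=> z _; exact: (cderive_axis z j 0).2.
exact: class_C_cst.
Qed.

End SmoothFunctions.

(** * Smooth complex-valued functions *)

Section ComplexSmooth.
Context {R : realType}.
Variables (U : set R[i]) (oU : open U).
Implicit Types (f g : R[i] -> R[i]).

Definition csmooth f : Prop :=
  smooth U (fun z => complex.Re (f z)) /\ smooth U (fun z => complex.Im (f z)).

Lemma csmooth_id : csmooth id.
Proof. by split => k; [exact: class_C_Re|exact: class_C_Im]. Qed.

Lemma csmooth_cst a : csmooth (fun=> a).
Proof. by split => k; exact: class_C_cst. Qed.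

Lemma csmoothD f g : csmooth f -> csmooth g -> csmooth (fun z => f z + g z).
Proof.
move=> [fr fi] [gr gi]; split => k.
  by under eq_fun do rewrite ReImE; exact: class_CD.
by under eq_fun do rewrite ReImE; exact: class_CD.
Qed.

Lemma csmoothN f : csmooth f -> csmooth (fun z => - f z).
Proof.
move=> [fr fi]; split => k.
  by under eq_fun do rewrite ReImE; exact: class_CN.
by under eq_fun do rewrite ReImE; exact: class_CN.
Qed.

Lemma csmooth_conj f : csmooth f -> csmooth (fun z => (cj (f z))).
Proof.
move=> [fr fi]; split => k.
  by under eq_fun do rewrite ReImE; exact: fr.
by under eq_fun do rewrite ReImE; exact: class_CN.
Qed.

Lemma csmoothM f g : csmooth f -> csmooth g -> csmooth (fun z => f z * g z).
Proof.
move=> [fr fi] [gr gi]; split => k.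
  under eq_fun do rewrite ReImE; apply: class_CD => //; first exact: class_CM.
  by apply: class_CN => //; exact: class_CM.
by under eq_fun do rewrite ReImE; apply: class_CD => //; exact: class_CM.
Qed.

Lemma smooth_sqn f : csmooth f -> smooth U (fun z => sqn (f z)).
Proof.
by move=> [fr fi] k; apply: class_CD => //; under eq_fun do rewrite expr2; exact: class_CM.
Qed.

Lemma csmooth_real u : smooth U u -> csmooth (fun z => (u z)%:C).
Proof. by move=> su; split => // k; exact: class_C_cst. Qed.

(** By 1 / f = conj f / |f|^2, it suffices to invert the real function |f|^2. *)
Lemma csmoothV f : (forall z, U z -> f z != 0) -> csmooth f -> csmooth (fun z => (f z)^-1).
Proof.
move=> f0 sf; rewrite (_ : (fun z => _) = fun z => ((sqn (f z))^-1)%:C * (cj (f z))).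
  apply: csmoothM; last exact: csmooth_conj.
  apply: csmooth_real => k; apply: class_CV => //; last exact: smooth_sqn.
  by move=> z /f0; rewrite sqn_eq0.
by apply/funext => z; rewrite invc_norm cjE -sqn_norm -fmorphV.
Qed.

Lemma csmooth_horner (p : {poly R[i]}) : csmooth (fun z => p.[z]).
Proof.
elim/poly_ind: p => [|p c IH]; first by under eq_fun do rewrite horner0; exact: csmooth_cst.
under eq_fun do rewrite hornerMXaddC.
by apply: csmoothD; [apply: csmoothM => //; exact: csmooth_id|exact: csmooth_cst].
Qed.

End ComplexSmooth.

(** * Complex derivatives and the complex exponential *)

Lemma caratheodory_is_derive (K : numFieldType) (h q : K -> K) (z : K) :
  (forall w, h w - h z = q w * (w - z)) -> {for z, continuous q} ->
  is_derive z 1 h (q z).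
Proof.
move=> hE Cq.
suff Hf : t^-1 *: ((h \o shift z) t%:A - h z) @[t --> 0^'] --> q z.
  have F1 : 'D_1 h z = q z by apply: cvg_lim.
  by rewrite -F1 in Hf *; constructor.
have F1 : (q \o shift z) y @[y --> 0^'] --> q z.
  exact/continuous_withinNshiftx.
apply: cvg_trans F1; apply: near_eq_cvg.
near=> y.
rewrite /= hE /= addrK [_%:A]mulr1.
suff yNZ : y != 0 by rewrite [RHS]mulrC mulfK.
by near: y; rewrite near_withinE /= near_simpl; near=> x1.
Unshelve. all: by end_near. Qed.

Section Holomorphic.
Context {R : realType}.
Implicit Types (h k : R[i] -> R[i]) (z w : R[i]).

Lemma contc_cst (a : R[i]) z : {for z, continuous (fun=> a : R[i])}.
Proof. exact: (@cvg_cst _ _ _ _ (nbhs_filter z)). Qed.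

Lemma contcD h k z : {for z, continuous h} -> {for z, continuous k} ->
  {for z, continuous (fun w => h w + k w)}.
Proof. by move=> ch ck; exact: (@cvgD _ _ _ _ (nbhs_filter z) h k _ _ ch ck). Qed.

Lemma contcN h z : {for z, continuous h} -> {for z, continuous (fun w => - h w)}.
Proof. by move=> ch; exact: (@cvgN _ _ _ _ (nbhs_filter z) h _ ch). Qed.

Lemma contcM h k z : {for z, continuous h} -> {for z, continuous k} ->
  {for z, continuous (fun w => h w * k w)}.
Proof. by move=> ch ck; exact: (@cvgM _ _ _ (nbhs_filter z) h k _ _ ch ck). Qed.

Lemma is_derive_cont h z a : is_derive z 1 h a -> {for z, continuous h}.
Proof. by case=> /derivable1_diffP/differentiable_continuous ch _; exact: ch. Qed.

Lemma is_derive_caratheodory h z (q : R[i] -> R[i]) :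
  (forall w, h w - h z = q w * (w - z)) -> {for z, continuous q} ->
  is_derive z 1 h (q z).
Proof. exact: caratheodory_is_derive. Qed.

(* Vanishing of the conj (w - z) term is the Cauchy-Riemann condition. *)
Lemma is_derive_CR h z (A B : R[i] -> R[i]) :
  (forall w, h w - h z = A w * (w - z) + B w * (cj (w - z))) ->
  {for z, continuous A} -> {for z, continuous B} -> B z = 0 ->
  is_derive z 1 h (A z).
Proof.
move=> hE cA cB Bz.
(* The quotient of [cj (w - z)] by [w - z] has modulus at most 1, so [B z = 0] makes this slope
   continuous at [z]. *)
pose q w := A w + B w * ((cj (w - z)) / (w - z)).
have -> : A z = q z by rewrite /q Bz mul0r addr0.
apply: is_derive_caratheodory.
  move=> w; rewrite /q; have [->|wz] := eqVneq w z; first by rewrite !subrr mulr0.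
  by rewrite mulrDl hE -!mulrA mulVf ?mulr1// subr_eq0.
have qz : q z = A z + 0 by rewrite /q Bz mul0r.
rewrite /prop_for /continuous_at qz.
apply: (@cvgD _ _ _ _ (nbhs_filter z) A _ _ _ cA).
apply/(@cvgrPdist_le _ _ _ _ (nbhs_filter z)) => e e0.
move/(@cvgrPdist_le _ _ _ _ (nbhs_filter z)) : cB => /(_ _ e0).
apply: filterS => w; rewrite Bz !sub0r !normrN; apply: le_trans.
rewrite normrM ler_piMr// normrM normfV -cjE normcJ.
by have [->|n0] := eqVneq `|w - z| 0; rewrite ?mul0r// divff.
Qed.

Lemma is_derive_horner (p : {poly R[i]}) z : is_derive z 1 (horner p) (p^`()).[z].
Proof.
elim/poly_ind: p => [|p c IH].
  rewrite deriv0 horner0 (_ : horner 0 = fun=> 0); first exact: is_derive_cst.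
  by apply/funext => w; rewrite horner0.
rewrite (_ : horner _ = (horner p * id) + cst c); last first.
  by apply/funext => w; rewrite hornerMXaddC.
have h := is_deriveD (is_deriveM IH (is_derive_id z 1)) (is_derive_cst c z 1).
apply: (@is_derive_eq _ _ _ _ _ _ _ _ h).
rewrite derivD derivM derivX derivC !addr0 mulr1 hornerD hornerM hornerX.
by rewrite -[_%:A]/(_ * 1) -[_ *: _]/(z * _) mulr1 addrC [_ * z]mulrC.
Qed.

Lemma is_deriveDc h k z a b : is_derive z 1 h a -> is_derive z 1 k b ->
  is_derive z 1 (fun w => h w + k w) (a + b).
Proof. exact: is_deriveD. Qed.

Lemma is_deriveBc h k z a b : is_derive z 1 h a -> is_derive z 1 k b ->
  is_derive z 1 (fun w => h w - k w) (a - b).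
Proof. exact: is_deriveB. Qed.

Lemma is_deriveMc h k z a b : is_derive z 1 h a -> is_derive z 1 k b ->
  is_derive z 1 (fun w => h w * k w) (a * k z + h z * b).
Proof.
move=> ha kb; apply: is_derive_eq (is_deriveM ha kb) _.
by rewrite -[_ *: b]/(h z * b) -[_ *: a]/(k z * a) addrC [k z * a]mulrC.
Qed.

Lemma is_deriveVc h z a : h z != 0 -> is_derive z 1 h a ->
  is_derive z 1 (fun w => (h w)^-1) (- a / h z ^+ 2).
Proof.
move=> hz [dh ha]; apply: DeriveDef; first exact: derivableV.
by rewrite deriveV// ha -[_ *: a]/(- (h z ^- 2) * a) mulNr mulNr mulrC.
Qed.

Definition cexp z : R[i] := (expR (complex.Re z))%:C * (cos (complex.Im z) +i* sin (complex.Im z)).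

Lemma cexpD z w : cexp (z + w) = cexp z * cexp w.
Proof.
by rewrite /cexp !ReImE expRD cosD sinD; apply: ReImP; rewrite !ReImE /=; ring.
Qed.

Lemma cexp0 : cexp 0 = 1.
Proof. by rewrite /cexp /= expR0 cos0 sin0 mulr1. Qed.

Lemma cexpN z : cexp (- z) = (cexp z)^-1.
Proof.
have h : cexp z * cexp (- z) = 1 by rewrite -cexpD subrr cexp0.
have u : cexp z != 0 by apply: contra_eq_neq h => ->; rewrite mul0r eq_sym oner_neq0.
by apply: (mulfI u); rewrite h divff.
Qed.

Lemma cexp_neq0 z : cexp z != 0.
Proof.
apply/eqP => h; have := cexpD z (- z).
by rewrite subrr cexp0 h mul0r => /eqP; rewrite oner_eq0.
Qed.

Lemma cexp_real (x : R) : cexp x%:C = (expR x)%:C.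
Proof. by rewrite /cexp /= cos0 sin0 mulr1. Qed.

(** Passage from the real coordinates of [w] to [w] and its conjugate; the two coefficients have the
    shape of Wirtinger derivatives. *)
Lemma half_conj_sum (p d w : R[i]) :
  (p - 'i%C * d) / 2%:R * w + (p + 'i%C * d) / 2%:R * (cj w) =
  p * (complex.Re w)%:C + d * (complex.Im w)%:C.
Proof.
have -> : (2%:R : R[i])^-1 = (2%:R^-1 : R)%:C by rewrite fmorphV rmorph_nat.
by apply: ReImP; rewrite !ReImE /=; field.
Qed.

(** With [x + i y = w - z], the slopes [p], [c], [s] at 0 of the real functions give
    [cexp (w - z) - 1 = p x + D y], where [D = expR x * (c + i s)]. The Cauchy-Riemann condition at
    [z] is [p + i D = 0], which holds there because [p = 1] and [D = i]. *)
Lemma is_derive_cexp z : is_derive z 1 cexp (cexp z).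
Proof.
have /is_derive1_caratheodory[p [pE pc p0]] := is_derive_expR (0 : R).
have /is_derive1_caratheodory[c [cE cc c0]] := is_derive_cos (0 : R).
have /is_derive1_caratheodory[s [sE sc s0]] := is_derive_sin (0 : R).
rewrite expR0 in p0 pE; rewrite sin0 oppr0 in c0; rewrite cos0 in s0 cE; rewrite sin0 in sE.
pose x w := complex.Re (w - z); pose y w := complex.Im (w - z).
pose D w := (expR (x w))%:C * (c (y w) +i* s (y w)).
pose A w : R[i] := cexp z * (((p (x w))%:C - 'i%C * D w) / 2%:R).
pose B w : R[i] := cexp z * (((p (x w))%:C + 'i%C * D w) / 2%:R).
have xz : x z = 0 by rewrite /x subrr.
have yz : y z = 0 by rewrite /y subrr.
have Dz : D z = 'i%C.
  by rewrite /D xz yz c0 s0 expR0 mul1r.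
have two : (2%:R : R[i]) != 0 by rewrite pnatr_eq0.
have -> : cexp z = A z.
  rewrite /A Dz xz p0 -expr2 sqr_i opprK -[X in X + X]/(1 : R[i]).
  by rewrite -(natrD _ 1 1) divff// mulr1.
have cx : {for z, continuous x}.
  apply: (@continuous_comp _ _ _ (fun w => w - z) (@complex.Re R)); last exact: continuous_Re.
  by apply: (@cvgD _ _ _ _ (nbhs_filter z)); [exact: cvg_id|exact: (@cvg_cst _ _ _ _ (nbhs_filter z))].
have cy : {for z, continuous y}.
  apply: (@continuous_comp _ _ _ (fun w => w - z) (@complex.Im R)); last exact: continuous_Im.
  by apply: (@cvgD _ _ _ _ (nbhs_filter z)); [exact: cvg_id|exact: (@cvg_cst _ _ _ _ (nbhs_filter z))].
have comp (u v : _ -> R) : {for 0, continuous u} -> {for z, continuous v} -> v z = 0 ->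
    {for z, continuous (fun w => u (v w))}.
  by move=> cu cv vz; apply: (@continuous_comp _ _ _ v u _ cv); rewrite vz.
have px := comp _ _ pc cx xz; have cyy := comp _ _ cc cy yz; have sy := comp _ _ sc cy yz.
have ex : {for z, continuous (fun w => expR (x w))}.
  by apply: comp cx xz; exact: continuous_expR.
have rc (u : R[i] -> R) : {for z, continuous u} -> {for z, continuous (fun w => (u w)%:C)}.
  move=> cu; apply: (@continuous_comp _ _ _ u (real_complex R) z cu).
  exact: continuous_real_complex.
have cD : {for z, continuous D}.
  apply: (@cvgM _ _ _ (nbhs_filter z)); first exact: rc ex.
  by apply: (@cvg_complex _ _ _ _ _ (nbhs_filter z)).
apply: (is_derive_CR (B := B)).
- move=> w; rewrite -{1}(subrK z w) cexpD mulrC -{2}(mulr1 (cexp z)) -mulrBr.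
  rewrite /A /B -(mulrA (cexp z)) -(mulrA (cexp z)) -mulrDr; congr (_ * _).
  rewrite half_conj_sum -/(x w) -/(y w).
  rewrite /cexp -/(x w) -/(y w).
  move: (pE (x w)) (cE (y w)) (sE (y w)); rewrite !subr0 /D => pa cb sb.
  move: (x w) (y w) pa cb sb => a b pa cb sb.
  have -> : cos b = 1 + c b * b by rewrite -cb addrC subrK.
  have e1 : expR a = 1 + p a * a by rewrite -pa addrC subrK.
  by rewrite sb; apply: ReImP; rewrite !ReImE /= e1; ring.
- have h := contcD (rc _ px) (contcN (contcM (@contc_cst 'i%C z) cD)).
  exact: (contcM (@contc_cst (cexp z) z) (contcM h (@contc_cst 2%:R^-1 z))).
- have h := contcD (rc _ px) (contcM (@contc_cst 'i%C z) cD).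
  exact: (contcM (@contc_cst (cexp z) z) (contcM h (@contc_cst 2%:R^-1 z))).
- by rewrite /B Dz xz p0 -expr2 sqr_i subrr mul0r mulr0.
Qed.

Lemma csmooth_cexp (U : set R[i]) : open U -> csmooth U cexp.
Proof.
move=> oU; have sE : smooth U (fun z => expR (complex.Re z)).
  move=> k; apply: (class_C_comp (S := [set expR])) => //; last exact: class_C_Re.
  by move=> _ ->; exists expR => // x; exact: is_derive_expR.
have sS f : [set cos; sin; (fun x : R => - cos x); (fun x => - sin x)] f ->
    smooth U (fun z => f (complex.Im z)).
  move=> Sf k; apply: (class_C_comp (S := [set cos; sin; (fun x : R => - cos x); (fun x => - sin x)]))
    => //; last exact: class_C_Im.
  move=> _ [[[|]|]|] ->.
  - by exists (fun x => - sin x); [right|exact: is_derive_cos].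
  - by exists cos; [left; left; left|exact: is_derive_sin].
  - exists sin; [by left; left; right|move=> x].
    by have := is_deriveN (is_derive_cos x); rewrite opprK.
  - exists (fun x => - cos x); [by left; right|move=> x].
    exact: is_deriveN (is_derive_sin x).
apply: csmoothM => //; first exact: csmooth_real.
by split; apply: sS; left; left; [left|right].
Qed.

End Holomorphic.

(** * Explicit determinants of order 2, 3 and 4 *)

Section SmallDeterminants.

(** With entries indexed by [nat], the minors have the same form again, [bump] skipping the deleted
    column, so the expansion iterates by mere computation. *)
Lemma det_fun_mx (K : comPzRingType) n (e : nat -> nat -> K) :
  \det (\matrix_(i < n.+1, j < n.+1) e i j) =
  \sum_(0 <= j < n.+1) e 0%N j * ((-1) ^+ j * \det (\matrix_(i < n, l < n) e i.+1 (bump j l))).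
Proof.
rewrite (expand_det_row _ 0) big_mkord; apply: eq_bigr => j _.
rewrite /cofactor mxE add0n; congr (_ * (_ * \det _)).
by apply/matrixP => i l; rewrite !mxE.
Qed.

Lemma det_fun_mx2 (K : comPzRingType) (e : nat -> nat -> K) :
  \det (\matrix_(i < 2, j < 2) e i j) = e 0%N 0%N * e 1%N 1%N - e 0%N 1%N * e 1%N 0%N.
Proof.
by rewrite det_fun_mx /index_iota /= !big_cons big_nil !det_mx11 !mxE /=; ring.
Qed.

Lemma det_fun_mx3 (K : comPzRingType) (e : nat -> nat -> K) :
  \det (\matrix_(i < 3, j < 3) e i j) =
  e 0%N 0%N * (e 1%N 1%N * e 2%N 2%N - e 1%N 2%N * e 2%N 1%N)
  - e 0%N 1%N * (e 1%N 0%N * e 2%N 2%N - e 1%N 2%N * e 2%N 0%N)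
  + e 0%N 2%N * (e 1%N 0%N * e 2%N 1%N - e 1%N 1%N * e 2%N 0%N).
Proof.
rewrite det_fun_mx /index_iota /= !big_cons big_nil.
by rewrite !(det_fun_mx2 (fun i l => e i.+1 (bump _ l))) /=; ring.
Qed.

Lemma det_fun_mx4 (K : comPzRingType) (e : nat -> nat -> K) :
  let d3 (a b c : nat) :=
    e 1%N a * (e 2%N b * e 3%N c - e 2%N c * e 3%N b)
    - e 1%N b * (e 2%N a * e 3%N c - e 2%N c * e 3%N a)
    + e 1%N c * (e 2%N a * e 3%N b - e 2%N b * e 3%N a) in
  \det (\matrix_(i < 4, j < 4) e i j) =
  e 0%N 0%N * d3 1%N 2%N 3%N - e 0%N 1%N * d3 0%N 2%N 3%N
  + e 0%N 2%N * d3 0%N 1%N 3%N - e 0%N 3%N * d3 0%N 1%N 2%N.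
Proof.
rewrite det_fun_mx /index_iota /= !big_cons big_nil.
by rewrite !(det_fun_mx3 (fun i l => e i.+1 (bump _ l))) /=; ring.
Qed.

Lemma det_mx2 (K : comPzRingType) (a b c d : K) : \det (mx2 a b c d) = a * d - b * c.
Proof.
pose e i j := nth 0 (nth [::] [:: [:: a; b]; [:: c; d]] i) j.
rewrite (_ : mx2 a b c d = \matrix_(i < 2, j < 2) e i j); first by rewrite det_fun_mx2.
by apply/matrixP => -[[|[|//]] ?] [[|[|//]] ?]; rewrite !mxE.
Qed.

Lemma mul_mx2 (K : pzRingType) (a b c d a' b' c' d' : K) :
  mx2 a b c d *m mx2 a' b' c' d' =
  mx2 (a * a' + b * c') (a * b' + b * d') (c * a' + d * c') (c * b' + d * d').
Proof.
apply/matrixP => -[[|[|//]] ?] [[|[|//]] ?];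
  by rewrite !mxE !big_ord_recl big_ord0 !mxE /= addr0.
Qed.

End SmallDeterminants.

(** * The Lorentz product on Hermitian parts of rank-one matrices *)

Section LorentzAlgebra.
Context {R : realType}.
Implicit Types (a b c d k : R[i]) (p q r s : R[i] * R[i]).

(* The coordinates of the Hermitian part (X + X^H) / 2 of X = mx2 a b c d. *)
Definition lvec a b c d : 'rV[R]_4 := \row_(i < 4)
  nth 0 [:: (complex.Re a + complex.Re d) / 2; (complex.Re b + complex.Re c) / 2;
            (complex.Im b - complex.Im c) / 2; (complex.Re a - complex.Re d) / 2] i.

Lemma lvecD a b c d a' b' c' d' :
  lvec a b c d + lvec a' b' c' d' = lvec (a + a') (b + b') (c + c') (d + d').
Proof.
by apply/rowP => -[[|[|[|[|//]]]] h]; rewrite !mxE /= !ReImE; ring.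
Qed.

Lemma lvecZ (t : R) a b c d :
  t *: lvec a b c d = lvec (t%:C * a) (t%:C * b) (t%:C * c) (t%:C * d).
Proof.
by apply/rowP => -[[|[|[|[|//]]]] h]; rewrite !mxE /= !ReImE /=; ring.
Qed.

Lemma lvec_herm a b c d : lvec (a + (cj a)) (b + (cj c)) (c + (cj b)) (d + (cj d)) =
  lvec (2 * a) (2 * b) (2 * c) (2 * d).
Proof.
by apply/rowP => -[[|[|[|[|//]]]] h]; rewrite !mxE /= !ReImE /=; ring.
Qed.

Lemma herm_lvec a b c d : cj a = a -> cj d = d -> c = cj b -> herm (lvec a b c d) = mx2 a b c d.
Proof.
move: a b c d => [a a'] [b b'] [c c'] [d d'] [ha] [hd] [-> ->].
rewrite /herm !mxE /=; congr mx2; apply: ReImP => /=; by [field|lra].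
Qed.

(** The Hermitian part of [i X] is [i] times the anti-Hermitian part of [X], so both parts of [X]
    vanish. *)
Lemma lvec_i_eq0 a b c d : lvec a b c d = 0 ->
  lvec ('i%C * a) ('i%C * b) ('i%C * c) ('i%C * d) = 0 -> [/\ a = 0, b = 0, c = 0 & d = 0].
Proof.
move=> /rowP h /rowP k.
have := (h 0, h 1, h 2, h 3); rewrite !mxE /= => -[[[h0 h1] h2] h3].
have := (k 0, k 1, k 2, k 3); rewrite !mxE !ReImE /= => -[[[k0 k1] k2] k3].
by split; apply: ReImP => /=; lra.
Qed.

(** Polarization of -det, extended bilinearly to complex matrices. Expanding the product of the
    Hermitian parts of [X] and [Y] gives half the real part of the sum of its values at [(X, Y)] and
    at [X] and the adjoint of [Y]. *)
Lemma lorentz_lvec a b c d a' b' c' d' : lorentz (lvec a b c d) (lvec a' b' c' d') =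
  - 4^-1 * complex.Re ((a * d' + d * a' - b * c' - c * b') +
                       (a * (cj d') + d * (cj a') - b * (cj b') - c * (cj c'))).
Proof. by rewrite /lorentz !mxE /= !ReImE; field. Qed.

(** The Hermitian part of the rank-one matrix [k p q^*] for column vectors [p] and [q]. Position,
    tangent vectors and normal of the face are all combinations of such vectors. *)
Definition lout k p q : 'rV[R]_4 :=
  lvec (k * p.1 * (cj q.1)) (k * p.1 * (cj q.2)) (k * p.2 * (cj q.1)) (k * p.2 * (cj q.2)).

Definition cross p q : R[i] := p.1 * q.2 - p.2 * q.1.

(** The polarized determinant of two rank-one matrices factors into the determinants [cross] of
    their left and of their right vectors. *)
Lemma lorentz_lout k k' p q r s : lorentz (lout k p q) (lout k' r s) =
  - 4^-1 * complex.Re (k * k' * cross p r * (cj (cross q s)) +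
                       k * (cj k') * cross p s * (cj (cross q r))).
Proof.
rewrite lorentz_lvec; congr (_ * complex.Re _).
by rewrite /cross !conjE; ring.
Qed.

Lemma loutZ (t : R) k p q : t *: lout k p q = lout (t%:C * k) p q.
Proof. by rewrite /lout lvecZ !mulrA. Qed.

Lemma crossxx p : cross p p = 0.
Proof. by rewrite /cross mulrC subrr. Qed.

Lemma crossC p q : cross p q = - cross q p.
Proof. by rewrite /cross; ring. Qed.

Lemma lorentz_null k k' p q : lorentz (lout k p p) (lout k' p q) = 0.
Proof. by rewrite lorentz_lout !crossxx !conjE !(mulr0, mul0r) addr0 mulr0. Qed.

Lemma lorentz_null' k k' p q : lorentz (lout k p p) (lout k' q p) = 0.
Proof. by rewrite lorentz_lout !crossxx !conjE !(mulr0, mul0r) addr0 mulr0. Qed.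

Lemma lorentz_null_pair (t : R) p q :
  lorentz (lout 1 p p) (lout t%:C q q) = - (2^-1 * t * sqn (cross p q)).
Proof.
rewrite lorentz_lout.
have -> : 1 * t%:C * cross p q * cj (cross p q) + 1 * cj t%:C * cross p q * cj (cross p q) =
    (2 * t * sqn (cross p q))%:C by rewrite !rcM rc_nat sqnE !conjE; ring.
by rewrite /=; field.
Qed.

Lemma lout_split k p q :
  lout k p q = complex.Re k *: lout 1 p q + complex.Im k *: lout 'i%C p q.
Proof.
rewrite !loutZ /lout lvecD [in LHS](complexE k); congr lvec; ring.
Qed.

Lemma lorentzDr (X Y Z : 'rV[R]_4) : lorentz X (Y + Z) = lorentz X Y + lorentz X Z.
Proof. by rewrite /lorentz !mxE; ring. Qed.

Lemma lorentzDl (X Y Z : 'rV[R]_4) : lorentz (X + Y) Z = lorentz X Z + lorentz Y Z.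
Proof. by rewrite /lorentz !mxE; ring. Qed.

Lemma lorentzZl (t : R) (X Y : 'rV[R]_4) : lorentz (t *: X) Y = t * lorentz X Y.
Proof. by rewrite /lorentz !mxE; ring. Qed.

Lemma lorentzZr (t : R) (X Y : 'rV[R]_4) : lorentz X (t *: Y) = t * lorentz X Y.
Proof. by rewrite /lorentz !mxE; ring. Qed.

(** Settles orientations: this frame is negatively oriented as soon as [p] and [q] are
    independent. *)
Lemma det_lout p q :
  \det (\matrix_(i < 4) nth 0 [:: lout 1 p q; lout 'i%C p q; lout 1 p p; lout 1 q q] i) =
  - 8^-1 * sqn (cross p q) ^+ 2.
Proof.
case: p => [[p0 p1] [p2 p3]]; case: q => [[q0 q1] [q2 q3]].
pose e i j := nth 0 (nth [::] [::
  [:: (p0 * q0 + p1 * q1 + p2 * q2 + p3 * q3) / 2; (p0 * q2 + p1 * q3 + p2 * q0 + p3 * q1) / 2;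
      (p1 * q2 - p0 * q3 - p3 * q0 + p2 * q1) / 2; (p0 * q0 + p1 * q1 - p2 * q2 - p3 * q3) / 2];
  [:: (p0 * q1 - p1 * q0 + p2 * q3 - p3 * q2) / 2; (p0 * q3 - p1 * q2 + p2 * q1 - p3 * q0) / 2;
      (p0 * q2 + p1 * q3 - p2 * q0 - p3 * q1) / 2; (p0 * q1 - p1 * q0 - p2 * q3 + p3 * q2) / 2];
  [:: (p0 ^+ 2 + p1 ^+ 2 + p2 ^+ 2 + p3 ^+ 2) / 2; p0 * p2 + p1 * p3;
      p1 * p2 - p0 * p3; (p0 ^+ 2 + p1 ^+ 2 - p2 ^+ 2 - p3 ^+ 2) / 2];
  [:: (q0 ^+ 2 + q1 ^+ 2 + q2 ^+ 2 + q3 ^+ 2) / 2; q0 * q2 + q1 * q3;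
      q1 * q2 - q0 * q3; (q0 ^+ 2 + q1 ^+ 2 - q2 ^+ 2 - q3 ^+ 2) / 2] ] i) j.
rewrite (_ : (\matrix_(i < 4) _) = \matrix_(i < 4, j < 4) e i j); last first.
  apply/matrixP => i j; rewrite mxE [RHS]mxE.
  case: i => [[|[|[|[|//]]]] ?] /=; rewrite mxE /= /e /=.
  - by case: j => [[|[|[|[|//]]]] ?] /=; field.
  - by case: j => [[|[|[|[|//]]]] ?] /=; field.
  - by case: j => [[|[|[|[|//]]]] ?] /=; field.
  - by case: j => [[|[|[|[|//]]]] ?] /=; field.
by rewrite det_fun_mx4 /e /= /sqn /cross !ReImE /=; field.
Qed.

End LorentzAlgebra.

(** * Partial derivatives of sesquilinear expressions in holomorphic functions *)

Section VectorDerivatives.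
Context {R : realType}.
Implicit Types (a b c d p q r s : R[i] -> R[i]) (z : R[i]) (j : 'I_2).

Definition is_cpd j p z (k : R[i]) : Prop :=
  cderive (fun t : R => p (z + t%:C * axis j)) 0 k.

Lemma is_cpd_holo j p z k : is_derive z 1 p k -> is_cpd j p z (k * axis j).
Proof.
move=> pk; have z0 : z + (0 : R)%:C * axis j = z by rewrite mul0r addr0.
rewrite -{1}z0 in pk; exact: (cderive_comp pk (cderive_axis _ _ _)).
Qed.

Lemma is_cpd_sesq j (k : R[i]) p q r s z (p' q' r' s' : R[i]) :
  is_derive z 1 p p' -> is_derive z 1 q q' -> is_derive z 1 r r' -> is_derive z 1 s s' ->
  is_cpd j (fun w => k * (p w * cj (r w) - q w * cj (s w))) z
    (k * (axis j * (p' * cj (r z) - q' * cj (s z))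
          + cj (axis j) * (p z * cj r' - q z * cj s'))).
Proof.
have ax0 : z + (0 : R)%:C * axis j = z by rewrite mul0r addr0.
move=> /(is_cpd_holo j) hp /(is_cpd_holo j) hq /(is_cpd_holo j)/cderive_conj hr
  /(is_cpd_holo j)/cderive_conj hs.
have := cderiveM (cderive_cst k 0) (cderiveD (cderiveM hp hr) (cderiveN (cderiveM hq hs))).
rewrite !ax0 /is_cpd; congr cderive; rewrite !conjE mul0r add0r; ring.
Qed.

Lemma pdv_lvec j a b c d z (a' b' c' d' : R[i]) : is_cpd j a z a' -> is_cpd j b z b' ->
  is_cpd j c z c' -> is_cpd j d z d' ->
  (forall k, is_pd j (fun w => lvec (a w) (b w) (c w) (d w) 0 k) z (lvec a' b' c' d' 0 k)).
Proof.
move=> [ar ai] [br bi] [cr ci] [dr di].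
have half (u : R -> R) u' : is_derive (0 : R) (1 : R) u u' ->
    is_derive (0 : R) (1 : R) (fun t => u t / 2) (u' / 2).
  move=> hu; apply: (@is_derive_eq _ _ _ _ _ _ _ _ (is_deriveM1 hu (is_derive_cst _ _ _))).
  by rewrite mulr0 add0r mulrC.
case=> [[|[|[|[|//]]]] ?]; rewrite mxE /is_pd /along /=; under eq_fun do rewrite mxE /=.
- by apply: half; exact: is_deriveD.
- by apply: half; exact: is_deriveD.
- by apply: half; exact: is_deriveB.
- by apply: half; exact: is_deriveB.
Qed.

Lemma pdvE j (f : R[i] -> 'rV[R]_4) z (v : 'rV[R]_4) :
  (forall k, is_pd j (fun w => f w 0 k) z (v 0 k)) -> pdv j f z = v.
Proof. by move=> h; apply/rowP => k; rewrite mxE; exact: is_pd_pd. Qed.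

Lemma eq_pdv (M : set R[i]) j (f g : R[i] -> 'rV[R]_4) z : open M -> M z ->
  (forall w, M w -> f w = g w) ->
  (forall k, is_pd j (fun w => g w 0 k) z (pdv j g z 0 k)) ->
  pdv j f z = pdv j g z.
Proof.
move=> oM Mz fg gd; apply: pdvE => k; apply: is_pd_near (gd k).
by apply: filterS (open_nbhs_nbhs (conj oM Mz)) => w /fg ->.
Qed.

End VectorDerivatives.

Section Matrices2.
Context {R : realType}.

Lemma ctranspose_mx2 (a b c d : R[i]) :
  ctranspose (mx2 a b c d) = mx2 (cj a) (cj c) (cj b) (cj d).
Proof.
by apply/matrixP => -[[|[|//]] ?] [[|[|//]] ?]; rewrite !mxE /= cjE.
Qed.

Lemma posdef_scalar (l : R) : 0 < l -> posdef (l%:M : 'M[R]_2).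
Proof.
move=> l0; split; first by rewrite tr_scalar_mx.
move=> v v0; rewrite /quad mul_mx_scalar -scalemxAl mxE !mxE mulr_gt0//.
rewrite !big_ord_recl big_ord0 !mxE addr0 -!expr2 lt_neqAle addr_ge0 ?sqr_ge0// andbT eq_sym.
apply: contra_neq v0 => /eqP; rewrite paddr_eq0 ?sqr_ge0// !sqrf_eq0 => /andP[/eqP v0 /eqP v1].
apply/rowP => -[[|[|//]] h]; rewrite mxE.
  by rewrite -[RHS]v0; congr (v _ _); exact: val_inj.
by rewrite -[RHS]v1; congr (v _ _); exact: val_inj.
Qed.

End Matrices2.

(** * The face of a null curve with Weierstrass data [(g, o dz)]: metric, mean curvature, singular
    points *)

Section FaceOfLift.

Context {R : realType}.
Variables (M : set R[i]) (oM : open M).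
Variables (a1 a2 b1 b2 u1 u2 g o : R[i] -> R[i]).
Hypothesis da1 : forall z, M z -> is_derive z 1 a1 (o z * u1 z).
Hypothesis da2 : forall z, M z -> is_derive z 1 a2 (o z * u2 z).
Hypothesis db1 : forall z, M z -> is_derive z 1 b1 (- g z * (o z * u1 z)).
Hypothesis db2 : forall z, M z -> is_derive z 1 b2 (- g z * (o z * u2 z)).
Hypothesis du1 : forall z, M z -> derivable u1 z 1.
Hypothesis du2 : forall z, M z -> derivable u2 z 1.
Hypothesis dg : forall z, M z -> derivable g z 1.
Hypothesis do_ : forall z, M z -> derivable o z 1.
Hypothesis u1E : forall z, u1 z = a1 z * g z + b1 z.
Hypothesis u2E : forall z, u2 z = a2 z * g z + b2 z.
Hypothesis detF : forall z, M z -> a1 z * b2 z - a2 z * b1 z = 1.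
Hypothesis o0 : forall z, M z -> o z != 0.

Definition lift_vec (k : R[i]) (p1 p2 q1 q2 r1 r2 s1 s2 : R[i]) : 'rV[R]_4 :=
  lvec (k * (p1 * cj r1 - q1 * cj s1)) (k * (p1 * cj r2 - q1 * cj s2))
       (k * (p2 * cj r1 - q2 * cj s1)) (k * (p2 * cj r2 - q2 * cj s2)).

(* f = F e3 F^* for F = mx2 a1 b1 a2 b2 *)
Definition face z : 'rV[R]_4 :=
  lift_vec 1 (a1 z) (a2 z) (b1 z) (b2 z) (a1 z) (a2 z) (b1 z) (b2 z).

(** As columns, [mu = F (g, 1)] and [nu = F (1, cj g)]. The hypotheses say [F' = o mu (1, -g)],
    whence [F' e3 F^* = o mu nu^*] and [df] is twice the Hermitian part of [o mu nu^* dz]. *)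
Let mu z : R[i] * R[i] := (u1 z, u2 z).
Let nu z : R[i] * R[i] := (a1 z + cj (g z) * b1 z, a2 z + cj (g z) * b2 z).
Let s z := sqn (g z).

(** [F] has determinant 1, and the vectors [(g, 1)] and [(1, cj g)] have determinant |g|^2 - 1. Thus
    [mu] and [nu] become dependent exactly where |g| = 1. *)
Lemma cross_mu_nu z : M z -> cross (mu z) (nu z) = (s z - 1)%:C.
Proof.
move=> Mz; rewrite rmorphB /= rmorph1 /s sqnE /cross /= u1E u2E.
transitivity ((a1 z * b2 z - a2 z * b1 z) * (g z * cj (g z) - 1)); last by rewrite detF// mul1r.
by ring.
Qed.

Lemma face_pd j z k : M z -> is_pd j (fun w => face w 0 k) z
  (lout (2 * axis j * o z) (mu z) (nu z) 0 k).
Proof.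
move=> Mz.
pose X (x x' y' : R[i]) := axis j * (x * cj x' + g z * x * cj y').
rewrite (_ : lout _ _ _ = lvec
   (X (o z * u1 z) (a1 z) (b1 z) + cj (X (o z * u1 z) (a1 z) (b1 z)))
   (X (o z * u1 z) (a2 z) (b2 z) + cj (X (o z * u2 z) (a1 z) (b1 z)))
   (X (o z * u2 z) (a1 z) (b1 z) + cj (X (o z * u1 z) (a2 z) (b2 z)))
   (X (o z * u2 z) (a2 z) (b2 z) + cj (X (o z * u2 z) (a2 z) (b2 z)))); last first.
  by rewrite lvec_herm /lout /X /= !conjE; congr lvec; ring.
move: k; apply: pdv_lvec.
- have := is_cpd_sesq j 1 (da1 Mz) (db1 Mz) (da1 Mz) (db1 Mz).
  by congr is_cpd; rewrite /X !conjE; ring.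
- have := is_cpd_sesq j 1 (da1 Mz) (db1 Mz) (da2 Mz) (db2 Mz).
  by congr is_cpd; rewrite /X !conjE; ring.
- have := is_cpd_sesq j 1 (da2 Mz) (db2 Mz) (da1 Mz) (db1 Mz).
  by congr is_cpd; rewrite /X !conjE; ring.
- have := is_cpd_sesq j 1 (da2 Mz) (db2 Mz) (da2 Mz) (db2 Mz).
  by congr is_cpd; rewrite /X !conjE; ring.
Qed.

Lemma pdv_face j z : M z -> pdv j face z = lout (2 * axis j * o z) (mu z) (nu z).
Proof. by move=> Mz; apply: pdvE => k; exact: face_pd. Qed.

Lemma axis_conj (j : 'I_2) : axis j * cj (axis j) = 1 :> R[i].
Proof.
by rewrite /axis; case: ifP => _; apply: ReImP; rewrite !ReImE /=; ring.
Qed.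

(** All tangent vectors share the left vector [mu], and [cross mu mu = 0] removes the complex
    bilinear term of [lorentz_lout]: this is conformality. The remaining sesquilinear term is the
    square of [cross mu nu]. *)
Lemma ds2_face z : M z -> ds2 face z = (sqn (o z) * (1 - s z) ^+ 2)%:M.
Proof.
move=> Mz; apply/matrixP => i j; rewrite !mxE !pdv_face// lorentz_lout.
have -> : cross (mu z) (mu z) = 0 by rewrite /cross; ring.
rewrite mulr0 mul0r add0r.
have -> : cross (nu z) (mu z) = - cross (mu z) (nu z) by rewrite /cross; ring.
rewrite cross_mu_nu// !conjE.
have -> : 2 * axis i * o z * (2 * cj (axis j) * cj (o z)) * (s z - 1)%:C * - (s z - 1)%:C =
    axis i * cj (axis j) * (- 4 * (sqn (o z) * (1 - s z) ^+ 2))%:C.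
  by rewrite !rcE sqnE; ring.
rewrite Re_mul_real mulrA mulrC.
have -> : complex.Re (axis i * cj (axis j)) = (i == j)%:R :> R.
  by move: i j => [[|[|//]] ?] [[|[|//]] ?]; rewrite /axis /= ?ReImE /=; ring.
by case: (i == j); rewrite ?mulr1n ?mulr0n; field.
Qed.

Lemma herm_face z : herm (face z) =
  mx2 (a1 z) (b1 z) (a2 z) (b2 z) *m e3 *m ctranspose (mx2 (a1 z) (b1 z) (a2 z) (b2 z)).
Proof.
rewrite ctranspose_mx2 !mul_mx2 herm_lvec ?conjE; first by congr mx2; ring.
- ring.
- ring.
- ring.
Qed.

Lemma de_sitter_face z : M z -> de_sitter (face z).
Proof.
move=> Mz; rewrite /de_sitter /= herm_face ctranspose_mx2 !det_mulmx !det_mx2.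
transitivity (- ((a1 z * b2 z - a2 z * b1 z) * cj (a1 z * b2 z - a2 z * b1 z))).
  by rewrite !conjE; ring.
by rewrite detF// mul1r (conj_nat 1).
Qed.

(** Pulling [F] and its adjoint out, [nu nu^* - mu mu^*] is [F D F^*] with [D = (1 - s) e3]. So the
    face is a combination of two null vectors, which by [lorentz_null] are also orthogonal to its
    tangent vectors. *)
Lemma face_null_frame z : M z -> s z != 1 ->
  face z = (1 - s z)^-1 *: (lout 1 (nu z) (nu z) + lout (- 1) (mu z) (mu z)).
Proof.
move=> Mz s1; apply: (scalerI (a := 1 - s z)); first by rewrite subr_eq0 eq_sym.
rewrite scalerA divff ?subr_eq0 1?eq_sym// scale1r.
rewrite /face /lift_vec lvecZ /lout lvecD /= !rcE /s sqnE.
by rewrite !u1E !u2E !conjE; congr lvec; ring.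
Qed.

(** The pure second derivatives carry the factor [axis j ^+ 2], that is 1 and -1, and cancel. Four
    times the mixed derivative [F' e3 F'^*] remains, and [F' = o mu (1, -g)] turns it into a
    multiple of [mu mu^*]. *)
Lemma face_laplacian z : M z -> pdv 0 (pdv 0 face) z + pdv 1 (pdv 1 face) z =
  lout (4 * (sqn (o z) * (1 - s z)))%:C (mu z) (mu z).
Proof.
move=> Mz.
pose p1 w := o w * u1 w; pose p2 w := o w * u2 w.
pose q1 w := - g w * (o w * u1 w); pose q2 w := - g w * (o w * u2 w).
have [p1' dp1] : exists d, is_derive z 1 p1 d.
  by exists ('D_1 p1 z); apply/derivableP/derivableM; [exact: do_|exact: du1].
have [p2' dp2] : exists d, is_derive z 1 p2 d.
  by exists ('D_1 p2 z); apply/derivableP/derivableM; [exact: do_|exact: du2].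
have [q1' dq1] : exists d, is_derive z 1 q1 d.
  exists ('D_1 q1 z); apply/derivableP/derivableM; first exact/derivableN/dg.
  by apply/derivableM; [exact: do_|exact: du1].
have [q2' dq2] : exists d, is_derive z 1 q2 d.
  exists ('D_1 q2 z); apply/derivableP/derivableM; first exact/derivableN/dg.
  by apply/derivableM; [exact: do_|exact: du2].
have [x11 [x12 [x21 [x22 H]]]] : exists x11 x12 x21 x22 : R[i], forall j,
    pdv j (pdv j face) z = lvec
     (2 * (axis j ^+ 2 * x11 + axis j * cj (axis j) * (p1 z * cj (p1 z) - q1 z * cj (q1 z))))
     (2 * (axis j ^+ 2 * x12 + axis j * cj (axis j) * (p1 z * cj (p2 z) - q1 z * cj (q2 z))))
     (2 * (axis j ^+ 2 * x21 + axis j * cj (axis j) * (p2 z * cj (p1 z) - q2 z * cj (q1 z))))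
     (2 * (axis j ^+ 2 * x22 + axis j * cj (axis j) * (p2 z * cj (p2 z) - q2 z * cj (q2 z)))).
  exists (p1' * cj (a1 z) - q1' * cj (b1 z)), (p1' * cj (a2 z) - q1' * cj (b2 z)),
    (p2' * cj (a1 z) - q2' * cj (b1 z)), (p2' * cj (a2 z) - q2' * cj (b2 z)) => j.
  have jE w : M w -> pdv j face w = lvec
     (2 * axis j * (p1 w * cj (a1 w) - q1 w * cj (b1 w)))
     (2 * axis j * (p1 w * cj (a2 w) - q1 w * cj (b2 w)))
     (2 * axis j * (p2 w * cj (a1 w) - q2 w * cj (b1 w)))
     (2 * axis j * (p2 w * cj (a2 w) - q2 w * cj (b2 w))).
    by move=> Mw; rewrite pdv_face// /lout /p1 /p2 /q1 /q2 /= !conjE; congr lvec; ring.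
  have D := pdv_lvec (is_cpd_sesq j (2 * axis j) dp1 dq1 (da1 Mz) (db1 Mz))
    (is_cpd_sesq j (2 * axis j) dp1 dq1 (da2 Mz) (db2 Mz))
    (is_cpd_sesq j (2 * axis j) dp2 dq2 (da1 Mz) (db1 Mz))
    (is_cpd_sesq j (2 * axis j) dp2 dq2 (da2 Mz) (db2 Mz)).
  rewrite (eq_pdv oM Mz jE); last by rewrite (pdvE D).
  by rewrite (pdvE D) /p1 /p2 /q1 /q2; congr lvec; ring.
rewrite !H lvecD /axis /= -/('i%C).
have i2 : 'i%C ^+ 2 = -1 :> R[i] by exact: sqr_i.
have ii : 'i%C * cj 'i%C = 1 :> R[i] by apply: ReImP; rewrite !ReImE /=; ring.
rewrite !expr1n !(conj_nat 1) i2 ii /lout /p1 /p2 /q1 /q2 /= !rcE /s sqnE (sqnE (g z)) !conjE.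
by congr lvec; ring.
Qed.

(** In a conformal coordinate the mean curvature is the product of the Laplacian and the normal,
    divided by twice the conformal factor. The Laplacian is along the null vector [mu mu^*], so only
    the [nu nu^*] part of the normal contributes. *)
Lemma face_cmc1_at z : M z -> s z != 1 -> cmc1_at face z.
Proof.
move=> Mz s1.
have s1' : s z - 1 != 0 by rewrite subr_eq0.
have munu := cross_mu_nu Mz.
have sqmunu : sqn (cross (mu z) (nu z)) = (s z - 1) ^+ 2.
  by rewrite munu /sqn /= expr0n addr0.
have sqnumu : sqn (cross (nu z) (mu z)) = (s z - 1) ^+ 2.
  by rewrite crossC munu /sqn /= !sqrrN expr0n addr0.
have nm : lorentz (lout 1 (nu z) (nu z)) (lout 1 (mu z) (mu z)) = - (2^-1 * (s z - 1) ^+ 2).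
  by rewrite (lorentz_null_pair 1) sqnumu mulr1.
have mn : lorentz (lout 1 (mu z) (mu z)) (lout 1 (nu z) (nu z)) = - (2^-1 * (s z - 1) ^+ 2).
  by rewrite (lorentz_null_pair 1) sqmunu mulr1.
have nm' : lorentz (lout 1 (nu z) (nu z)) (lout (-1) (mu z) (mu z)) = 2^-1 * (s z - 1) ^+ 2.
  have -> : (- 1 : R[i]) = (- 1 : R)%:C by rewrite rcN.
  by rewrite lorentz_null_pair sqnumu mulrN1 mulNr opprK.
(* The null vectors whose difference gives the face give the normal as their sum; orientation
   dictates the sign of the factor. *)
exists ((s z - 1)^-1 *: (lout 1 (nu z) (nu z) + lout 1 (mu z) (mu z))).
  split.
  - rewrite lorentzZl lorentzZr !lorentzDl !lorentzDr !lorentz_null nm mn.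
    by move: (s z) s1' => t t1; field.
  - rewrite face_null_frame// lorentzZl lorentzZr !lorentzDl !lorentzDr !lorentz_null nm' mn; ring.
  - by move=> j; rewrite pdv_face// lorentzZl !lorentzDl lorentz_null lorentz_null' addr0 mulr0.
  - set T := (\matrix_(_ < 4) _).
    pose r := complex.Re (o z); pose w := complex.Im (o z); pose c := (s z - 1)^-1.
    pose e i j := nth 0 (nth [::] [:: [:: 2 * r; 2 * w; 0; 0]; [:: - (2 * w); 2 * r; 0; 0];
                                      [:: 0; 0; c; c]; [:: 0; 0; c; - c]] i) j.
    (* Change of basis from the frame of [det_lout]. Its determinant [-8 |o|^2 c^2] is negative,
       like that of the frame, so the product is positive. *)
    have -> : T = (\matrix_(i < 4, j < 4) e i j) *m
        (\matrix_(i < 4) nth 0 [:: lout 1 (mu z) (nu z); lout 'i%C (mu z) (nu z);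
          lout 1 (mu z) (mu z); lout 1 (nu z) (nu z)] i).
      apply/row_matrixP => i; rewrite row_mul mulmx_sum_row rowK !big_ord_recl big_ord0 !rowK !mxE.
      case: i => [[|[|[|[|//]]]] ?]; rewrite /e /=.
      - rewrite pdv_face// lout_split /axis /= !ReImE /= -/r -/w !scale0r !addr0.
        by congr (_ *: _ + _ *: _); ring.
      - rewrite pdv_face// lout_split /axis /= !ReImE /= -/r -/w !scale0r !addr0.
        by congr (_ *: _ + _ *: _); ring.
      - by rewrite !scale0r !add0r addr0 scalerDr addrC.
      - rewrite face_null_frame// !scale0r !add0r addr0 !loutZ scalerDr !loutZ addrC.
        have -> : (1 - s z)^-1 = - c by rewrite /c -invrN opprB.
        by rewrite rcN mulrN1 opprK !mulr1.
    rewrite det_mulmx det_fun_mx4 det_lout munu /e /=.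
    have -> : sqn (s z - 1)%:C = (s z - 1) ^+ 2 by rewrite /sqn /= expr0n addr0.
    have so : 0 < sqn (o z) by rewrite sqn_gt0 o0.
    have st : 0 < (s z - 1) ^+ 2 by rewrite exprn_even_gt0.
    set D := (X in _ < X); suff -> : D = sqn (o z) * (s z - 1) ^+ 2 by rewrite mulr_gt0.
    rewrite /D /c /sqn -/r -/w; field; exact: s1'.
rewrite /mean_curvature ds2_face// invmx_scalar mul_scalar_mx mxtraceZ.
rewrite /mxtrace !big_ord_recl big_ord0 addr0 !mxE.
have -> : lift ord0 ord0 = 1 :> 'I_2 by exact: val_inj.
rewrite -lorentzDl face_laplacian// -[_%:C]mulr1 -loutZ lorentzZl lorentzZr lorentzDr lorentz_null mn.
have : sqn (o z) != 0 by rewrite sqn_eq0 o0.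
have : 1 - s z != 0 by rewrite -opprB oppr_eq0.
move: (s z) (sqn (o z)) s1' => t l t1 t2 l0.
by field; rewrite t1 t2 l0.
Qed.

(** If both partial derivatives vanished, so would the whole matrix [o mu nu^*] by [lvec_i_eq0]; but
    [F] is invertible, so neither [mu] nor [nu] is ever zero. *)
Lemma face_differential z : M z -> exists j, pdv j face z != 0.
Proof.
move=> Mz; case: (pselect (exists j, pdv j face z != 0)) => // /forallNP h.
have h0 j : lout (2 * axis j * o z) (mu z) (nu z) = 0.
  by rewrite -pdv_face//; apply/eqP/negP => /negP; exact: h.
have [] := @lvec_i_eq0 _ _ _ _ _ (h0 0).
  rewrite -[RHS](h0 1) /lout /axis /=; congr lvec; rewrite -/('i%C); ring.
have k0 : 2 * axis 0 * o z != 0 by rewrite /axis /= mulr1 mulf_neq0// ?pnatr_eq0// o0.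
have cj0 (x : R[i]) : cj x = 0 -> x = 0 by move=> e; rewrite -(conjK x) e conj0.
have mz (x y : R[i]) : 2 * axis 0 * o z * x * cj y = 0 -> x = 0 \/ y = 0.
  move/eqP; rewrite -mulrA mulf_eq0 (negbTE k0) /= mulf_eq0 => /orP[/eqP|/eqP/cj0] ->; by [left|right].
move=> /mz e11 /mz e12 /mz e21 /mz e22.
have mu0 : u1 z = 0 -> u2 z = 0 -> False.
  move=> p1 p2; have := detF Mz.
  have -> : a1 z * b2 z - a2 z * b1 z = a1 z * u2 z - a2 z * u1 z by rewrite u1E u2E; ring.
  by rewrite p1 p2 !mulr0 subrr => /esym/eqP; rewrite oner_eq0.
have nu0 : (nu z).1 = 0 -> (nu z).2 = 0 -> False.
  move=> p1 p2; have := detF Mz.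
  have -> : a1 z * b2 z - a2 z * b1 z = (nu z).1 * b2 z - (nu z).2 * b1 z by rewrite /=; ring.
  by rewrite p1 p2 !mul0r subrr => /esym/eqP; rewrite oner_eq0.
by case: e11 e12 e21 e22 => [p|p] [q|q] [r|r] [t|t]; try (by case: (mu0 p r)); try (by case: (mu0 p t));
  try (by case: (mu0 q r)); try (by case: (mu0 q t)); try (by case: (nu0 p q)); case: (nu0 r t).
Qed.

Hypothesis sa1 : csmooth M a1.
Hypothesis sa2 : csmooth M a2.
Hypothesis sb1 : csmooth M b1.
Hypothesis sb2 : csmooth M b2.
Hypothesis sg : csmooth M g.
Hypothesis so : csmooth M o.

Lemma smooth_face k : smooth M (fun z => face z 0 k).
Proof.
have H (p q r t : R[i] -> R[i]) : csmooth M p -> csmooth M q -> csmooth M r -> csmooth M t ->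
    csmooth M (fun z => 1 * (p z * cj (r z) - q z * cj (t z))).
  move=> sp sq sr st; apply: csmoothM => //; first exact: csmooth_cst.
  apply: csmoothD => //; first by apply: csmoothM => //; exact: csmooth_conj.
  by apply: csmoothN => //; apply: csmoothM => //; exact: csmooth_conj.
have [h11r h11i] := H _ _ _ _ sa1 sb1 sa1 sb1; have [h12r h12i] := H _ _ _ _ sa1 sb1 sa2 sb2.
have [h21r h21i] := H _ _ _ _ sa2 sb2 sa1 sb1; have [h22r h22i] := H _ _ _ _ sa2 sb2 sa2 sb2.
have half u v (c : R) : smooth M u -> smooth M v -> smooth M (fun z => (u z + c * v z) / 2).
  move=> su sv l; apply: class_CM => //; last exact: class_C_cst.
  by apply: class_CD => //; apply: class_CM => //; exact: class_C_cst.
case: k => [[|[|[|[|//]]]] ?] l.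
- apply: class_C_ext (half _ _ 1 h11r h22r l) => // z _; by rewrite mxE /=; ring.
- apply: class_C_ext (half _ _ 1 h12r h21r l) => // z _; by rewrite mxE /=; ring.
- apply: class_C_ext (half _ _ (-1) h12i h21i l) => // z _; by rewrite mxE /=; ring.
- apply: class_C_ext (half _ _ (-1) h11r h22r l) => // z _; by rewrite mxE /=; ring.
Qed.

Lemma face_cmc1_face : M `<=` closure (M `&` [set z | s z != 1]) -> cmc1_face M face.
Proof.
move=> dense; have ss : smooth M s by exact: smooth_sqn.
have sw : smooth M (fun z => sqn (o z)) by exact: smooth_sqn.
have pos z : M z -> s z != 1 -> 0 < sqn (o z) * (1 - s z) ^+ 2.
  by move=> Mz s1; rewrite mulr_gt0 ?sqn_gt0 ?o0// exprn_even_gt0//= subr_eq0 eq_sym.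
have oW : open (M `&` [set z | s z != 1]).
  rewrite openE => z [Mz sz].
  have cs : {for z, continuous s} by exact: class_C_cont (ss 0%N) _ Mz.
  have : nbhs (s z) [set x : R | x != 1].
    by apply: open_nbhs_nbhs; split => //; exact: open_neq.
  move=> /cs; apply: filterS2 (open_nbhs_nbhs (conj oM Mz)) => w Mw sw1.
  by split.
exists (M `&` [set z | s z != 1]); split.
- split.
  + exact: smooth_face.
  + exact: de_sitter_face.
  + by split => // z [].
  + move=> z [Mz s1]; split; last exact: face_cmc1_at.
    by rewrite /spacelike_at ds2_face//; apply: posdef_scalar; exact: pos.
- by move=> z [Mz s1]; exists (sqn (o z) * (1 - s z) ^+ 2); [exact: pos|exact: ds2_face].
- move=> z Mz sing; split; last exact: face_differential.
  (* Dividing out the degenerate factor [(1 - s)^2] leaves |o|^2 |dz|^2, which is Riemannian across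
     the singular set. *)
  exists M, (fun w => (1 - s w)^-1 ^+ 2), (fun w => (sqn (o w))%:M); split.
  + by split.
  + split.
      have oMW : open (M `&` (M `&` [set z | s z != 1])) by exact: openI.
      have c1 : class_C 1 (M `&` (M `&` [set z | s z != 1])) (fun w => (1 - s w)^-1).
        apply: class_CV => //; first by move=> w [_ [_ h]]; rewrite subr_eq0 eq_sym.
        apply: class_CD => //; first exact: class_C_cst.
        apply: class_CN => //.
        exact: class_C_sub (ss 1%N).
      by apply: class_C_ext (class_CM oMW c1 c1) => // w _; rewrite expr2.
    by move=> w [_ [_ h]]; rewrite exprn_even_gt0//= invr_eq0 subr_eq0 eq_sym.
  + split.
      move=> i j; under eq_fun do rewrite mxE.
      case: (i == j); first exact: sw.
      exact: class_C_cst.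
    move=> w Mw; apply: posdef_scalar.
    by rewrite sqn_gt0 o0.
  + move=> w [_ [Mw h]]; rewrite ds2_face// scale_scalar_mx; congr (_%:M).
    have h' : 1 - s w != 0 by rewrite subr_eq0 eq_sym.
    by rewrite mulrCA exprVn mulVf ?mulr1// sqrf_eq0.
Qed.

End FaceOfLift.

(** * Derivation rules for real functions *)

Section RealDerivatives.
Context {R : realType}.
Implicit Types (u v h : R -> R) (t a b : R).

Lemma is_deriveD1 u v t a b : is_derive t (1 : R) u a -> is_derive t (1 : R) v b ->
  is_derive t (1 : R) (fun s => u s + v s) (a + b).
Proof. exact: is_deriveD. Qed.

Lemma is_deriveB1 u v t a b : is_derive t (1 : R) u a -> is_derive t (1 : R) v b ->
  is_derive t (1 : R) (fun s => u s - v s) (a - b).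
Proof. exact: is_deriveB. Qed.

Lemma is_derive_comp1 h u t a b : is_derive (u t) (1 : R) h a ->
  is_derive t (1 : R) u b -> is_derive t (1 : R) (fun s => h (u s)) (a * b).
Proof. exact: is_derive1_comp. Qed.

Lemma is_deriveV1 u t a : u t != 0 -> is_derive t (1 : R) u a ->
  is_derive t (1 : R) (fun s => (u s)^-1) (- (u t) ^- 2 * a).
Proof. exact: realfun.is_deriveV. Qed.

Lemma is_derive_continuous u t a : is_derive t (1 : R) u a -> {for t, continuous u}.
Proof. by case=> /derivable1_diffP/differentiable_continuous. Qed.

End RealDerivatives.

(** * The smooth function exp(-1/x), extended by zero *)

Section FlatFunction.
Context {R : realType}.
Implicit Types (p : {poly R}) (x t : R).

(** For exponent m + 1, raise [t / (m + 1) <= expR (t / (m + 1))] to the power m + 1. *)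
Lemma pow_expRN_le (m : nat) : exists2 C : R, 0 <= C &
  forall t, 0 < t -> t ^+ m * expR (- t) <= C.
Proof.
case: m => [|m].
  by exists 1 => // t t0; rewrite expr0 mul1r -expR0 ler_expR oppr_le0 ltW.
exists (m.+1%:R ^+ m.+1) => [|t t0]; first by rewrite exprn_ge0.
have m0 : 0 < m.+1%:R :> R by rewrite ltr0n.
rewrite expRN ler_pdivrMr ?expR_gt0//.
have -> : expR t = expR (t / m.+1%:R) ^+ m.+1.
  by rewrite -expRM_natl mulrC divfK// gt_eqF.
rewrite -exprMn lerXn2r ?nnegrE ?(ltW t0) ?mulr_ge0 ?expR_ge0 ?(ltW m0)//.
rewrite -ler_pdivrMl// mulrC; apply: le_trans (expR_ge1Dx _).
by rewrite lerDr.
Qed.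

Lemma poly_expRN_le p (m : nat) : exists2 C : R, 0 <= C &
  forall t, 0 < t -> `|p.[t]| * t ^+ m * expR (- t) <= C.
Proof.
elim/poly_ind: p m => [|p c IH] m.
  by exists 0 => // t _; rewrite horner0 normr0 !mul0r.
have [C C0 hC] := IH m.+1; have [D D0 hD] := pow_expRN_le m.
exists (C + `|c| * D) => [|t t0]; first by rewrite addr_ge0// mulr_ge0.
rewrite hornerMXaddC; apply: le_trans (_ : (`|p.[t]| * t + `|c|) * t ^+ m * expR (- t) <= _).
  rewrite !ler_wpM2r ?expR_ge0 ?exprn_ge0 ?(ltW t0)//.
  by apply: le_trans (ler_normD _ _) _; rewrite normrM (gtr0_norm t0).
rewrite !mulrDl lerD//.
  by rewrite -(mulrA `|p.[t]|) -exprS; exact: hC.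
by rewrite -mulrA ler_wpM2l// hD.
Qed.

(* q(1/x) exp(-1/x) for x > 0, extended by 0: this family is stable under
   differentiation. *)
Definition flat p x : R := if 0 < x then p.[x^-1] * expR (- x^-1) else 0.

Lemma flat_le0 p x : x <= 0 -> flat p x = 0.
Proof. by rewrite /flat leNgt => /negbTE ->. Qed.

Lemma flat_gt0 p x : 0 < x -> flat p x = p.[x^-1] * expR (- x^-1).
Proof. by rewrite /flat => ->. Qed.

Lemma is_derive_hornerR p x : is_derive x (1 : R) (horner p) (p^`()).[x].
Proof.
elim/poly_ind: p => [|p c IH].
  rewrite deriv0 horner0 (_ : horner 0 = fun=> 0); first exact: is_derive_cst.
  by apply/funext => w; rewrite horner0.
rewrite (_ : horner _ = (horner p * id) + cst c); last first.
  by apply/funext => w; rewrite hornerMXaddC.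
apply: (@is_derive_eq _ _ _ _ _ _ _ _
  (is_deriveD (is_deriveM IH (is_derive_id x 1)) (is_derive_cst c x 1))).
rewrite derivD derivM derivX derivC !addr0 mulr1 hornerD hornerM hornerX.
by rewrite -[_%:A]/(_ * 1) -[_ *: _]/(x * _) mulr1 addrC [_ * x]mulrC.
Qed.

Lemma is_derive_flat p x :
  is_derive x (1 : R) (flat p) (flat ('X^2 * (p - p^`())) x).
Proof.
have [x0|x0|->] := ltrgtP x 0.
- rewrite flat_le0 ?(ltW x0)//; apply: near_eq_is_derive (is_derive_cst (0 : R) x 1).
  have : nbhs x [set y : R | y < 0] by apply: open_nbhs_nbhs; split => //; exact: open_lt.
  by apply: filterS => y /= y0; rewrite flat_le0// ltW.
- have hV : is_derive x (1 : R) (fun y => y^-1) (- x ^- 2).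
    have := is_derive_id x (1 : R) => /(realfun.is_deriveV (lt0r_neq0 x0)) h.
    by apply: is_derive_eq; rewrite [_ *: _]mulr1.
  have hN := is_deriveN hV.
  have hE := @is_derive1_comp _ expR (fun y => - y^-1) x _ _ (is_derive_expR _) hN.
  have hP := @is_derive1_comp _ (horner p) (fun y => y^-1) x _ _ (is_derive_hornerR p _) hV.
  have h := is_deriveM1 hP hE.
  apply: near_eq_is_derive (@is_derive_eq _ _ _ _ _ _ _ _ h _).
    have : nbhs x [set y : R | 0 < y] by apply: open_nbhs_nbhs; split => //; exact: open_gt.
    by apply: filterS => y /= y0; rewrite flat_gt0.
  rewrite flat_gt0// !hornerE /=; field; exact: lt0r_neq0.
(* At 0 the slope of [flat p] is again in the family; it tends to 0 because the exponential beats
   one more factor [1 / x]. *)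
- apply/is_derive1_caratheodory; exists (flat ('X * p)); split.
  + move=> z; rewrite subr0 (flat_le0 p (lexx 0)) subr0.
    have [z0|z0] := leP z 0; first by rewrite !flat_le0// mul0r.
    rewrite !flat_gt0// hornerM hornerX; field; exact: lt0r_neq0.
  + have [C C0 hC] := poly_expRN_le ('X * p) 1.
    rewrite /prop_for /continuous_at flat_le0//; apply/cvgr0Pnorm_le => e e0.
    have : nbhs (0 : R) [set y | `|y| < e / (C + 1)].
      have d0 : 0 < e / (C + 1) by rewrite divr_gt0// ltr_wpDl.
      by have /cvgr0Pnorm_lt/(_ _ d0) := @cvg_id _ (nbhs (0 : R)).
    apply: filterS => y /= ye.
    have [y0|y0] := leP y 0; first by rewrite flat_le0// normr0 ltW.
    rewrite flat_gt0// normrM (ger0_norm (expR_ge0 _)).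
    have yV0 : 0 < y^-1 by rewrite invr_gt0.
    have := hC _ yV0; rewrite expr1 mulrAC ler_pdivrMr// => h.
    apply: le_trans h _; rewrite gtr0_norm// in ye.
    have : C * y <= (C + 1) * y by rewrite ler_wpM2r ?(ltW y0)// lerDl.
    move/le_trans; apply; move: ye; rewrite ltr_pdivlMr ?ltr_wpDl// => /ltW.
    by rewrite mulrC.
  + by rewrite !flat_le0.
Qed.

Lemma class_C_flat k (U : set R[i]) p u : open U -> class_C k U u ->
  class_C k U (fun z => flat p (u z)).
Proof.
move=> oU; apply: (class_C_comp (S := range flat) oU); last by exists p.
move=> _ [q _ <-]; exists (flat ('X^2 * (q - q^`()))); first by eexists.
by move=> x; exact: is_derive_flat.
Qed.

Lemma flat1_ge0 x : 0 <= flat 1 x.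
Proof. by rewrite /flat; case: ifP => // _; rewrite hornerE ?mul1r expR_ge0. Qed.

Lemma flat1_incr x y : x <= y -> flat 1 x <= flat 1 y.
Proof.
move=> xy; have [x0|x0] := leP x 0; first by rewrite flat_le0// flat1_ge0.
have y0 := lt_le_trans x0 xy.
by rewrite !flat_gt0// !hornerE ?mul1r ler_expR lerN2 lef_pV2.
Qed.

End FlatFunction.

(** * The radial profile replacing (1 - s)^2 *)

Section Profile.
Context {R : realType}.
Implicit Types s : R.

(* (1 - s)^2 made positive near s = 1. *)
Definition gap s : R := 4^-1 - (s - 1) ^+ 2.
Definition eta s : R := (1 - s) ^+ 2 + flat 1 (gap s).

Lemma eta_far s : 2^-1 <= `|s - 1| -> eta s = (1 - s) ^+ 2.
Proof.
move=> h; rewrite /eta flat_le0 ?addr0// /gap subr_le0.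
rewrite -real_normK ?num_real//.
have -> : 4^-1 = 2^-1 ^+ 2 :> R by rewrite exprVn; congr (_^-1); rewrite -natrX.
by rewrite lerXn2r ?nnegrE// invr_ge0.
Qed.

Lemma eta_lower : exists2 d : R, 0 < d & forall s, 0 <= s -> d * (1 + s) ^+ 2 <= eta s.
Proof.
have m0 : 0 < flat 1 (3 / 16 : R) by rewrite flat_gt0 ?divr_gt0// hornerE ?mul1r expR_gt0.
(* If |s - 1| <= 1/4 then [gap s >= 3/16] and (1 + s)^2 <= 81/16 < 6; otherwise 1 + s <= 9 |s -
   1|. *)
exists (Num.min (flat 1 (3 / 16) / 6) 81^-1) => [|s s0].
  by rewrite lt_min invr_gt0 ltr0n divr_gt0.
have sq0 : 0 <= (1 + s) ^+ 2 by rewrite sqr_ge0.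
have [h|h] := leP `|s - 1| 4^-1.
  apply: le_trans (_ : flat 1 (3 / 16) / 6 * (1 + s) ^+ 2 <= _).
    by rewrite ler_wpM2r// ge_min lexx.
  have : flat 1 (3 / 16) <= flat 1 (gap s).
    apply: flat1_incr; rewrite /gap; move: h; rewrite ler_norml => /andP[h1 h2]; nra.
  move: h; rewrite ler_norml => /andP[h1 h2].
  move=> fg; apply: (@le_trans _ _ (flat 1 (3 / 16))).
    rewrite mulrAC ler_pdivrMr// ler_pM2l//; nra.
  by apply: le_trans fg _; rewrite /eta lerDr sqr_ge0.
apply: le_trans (_ : 81^-1 * (1 + s) ^+ 2 <= _).
  by rewrite ler_wpM2r// ge_min lexx orbT.
apply: le_trans (_ : (1 - s) ^+ 2 <= _); last by rewrite /eta lerDl flat1_ge0.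
move: h; rewrite ltr_normr => /orP[] h; nra.
Qed.

Lemma eta_gt0 s : 0 <= s -> 0 < eta s.
Proof.
move=> s0; have [d d0 h] := eta_lower; apply: lt_le_trans (h _ s0).
by rewrite mulr_gt0// exprn_gt0// ltr_pwDl.
Qed.

Definition flat1' : R -> R := flat ('X^2 * (1 - 1^`())).
Definition flat1'' : R -> R := flat ('X^2 * ('X^2 * (1 - 1^`()) - ('X^2 * (1 - 1^`()))^`())).
Definition eta' s : R := 2 * (s - 1) * (1 - flat1' (gap s)).
Definition eta'' s : R := 2 * (1 - flat1' (gap s)) + (2 * (s - 1)) ^+ 2 * flat1'' (gap s).

Lemma is_derive_gap s : is_derive s (1 : R) gap (- (2 * (s - 1))).
Proof.
have h1 := is_deriveB1 (is_derive_id s 1) (is_derive_cst (1 : R) s 1).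
have h := is_deriveB1 (is_derive_cst (4^-1 : R) s 1) (is_deriveM1 h1 h1).
by apply: (@is_derive_eq _ _ _ _ _ _ _ _ h); rewrite /=; ring.
Qed.

Lemma is_derive_eta s : is_derive s (1 : R) eta (eta' s).
Proof.
have h1 := is_deriveB1 (is_derive_cst (1 : R) s 1) (is_derive_id s 1).
have h2 := is_derive_comp1 (is_derive_flat 1 (gap s)) (is_derive_gap s).
apply: (@is_derive_eq _ _ _ _ _ _ _ _ (is_deriveD1 (is_deriveM1 h1 h1) h2)).
by rewrite /eta' /flat1' /=; ring.
Qed.

Lemma is_derive_eta' s : is_derive s (1 : R) eta' (eta'' s).
Proof.
have h1 := is_deriveM1 (is_derive_cst (2 : R) s 1)
  (is_deriveB1 (is_derive_id s 1) (is_derive_cst (1 : R) s 1)).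
have h2 := is_deriveB1 (is_derive_cst (1 : R) s 1)
  (is_derive_comp1 (is_derive_flat ('X^2 * (1 - 1^`())) (gap s)) (is_derive_gap s)).
apply: (@is_derive_eq _ _ _ _ _ _ _ _ (is_deriveM1 h1 h2)).
by rewrite /eta'' /flat1' /flat1'' /=; ring.
Qed.

(* Half the logarithmic derivative of eta, and its derivative. *)
Definition dlog s : R := eta' s / (2 * eta s).
Definition dlog' s : R := (eta'' s * eta s - eta' s ^+ 2) / (2 * eta s ^+ 2).

Lemma is_derive_dlog s : 0 <= s -> is_derive s (1 : R) dlog (dlog' s).
Proof.
move=> s0; have e0 : eta s != 0 by rewrite gt_eqF// eta_gt0.
have e20 : 2 * eta s != 0 by rewrite mulf_neq0.
have h2 := is_deriveM1 (is_derive_cst (2 : R) s 1) (is_derive_eta s).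
have h := is_deriveM1 (is_derive_eta' s) (is_deriveV1 (u := fun s => 2 * eta s) e20 h2).
by apply: (@is_derive_eq _ _ _ _ _ _ _ _ h); rewrite /dlog' /=; field.
Qed.

(** This expression is the radial factor of the curvature density. On [0, 2] compactness bounds it;
    beyond 2 the correction is inactive, the expression equals -(s - 1)^-2, and (1 + s) / (s - 1) <=
    3 accounts for the 9. *)
Lemma dlog_bound : exists2 C : R, 0 <= C &
  forall s, 0 <= s -> `|dlog s + s * dlog' s| * (1 + s) ^+ 2 <= C.
Proof.
pose B s := (dlog s + s * dlog' s) * (1 + s) ^+ 2.
have c1 := is_derive_continuous (is_derive_eta _).
have c2 := is_derive_continuous (is_derive_eta' _).
have c3 s : {for s, continuous eta''}.
  have cg := is_derive_continuous (is_derive_gap s).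
  have cf p : {for s, continuous (fun x => flat p (gap x))}.
    exact: continuous_comp cg (is_derive_continuous (is_derive_flat p (gap s))).
  apply: cvgD; apply: cvgM.
  - exact: cvg_cst.
  - by apply: cvgB; [exact: cvg_cst|exact: cf].
  - by apply: cvgM; apply: cvgM; (try exact: cvg_cst); (apply: cvgB; [exact: cvg_id|exact: cvg_cst]).
  - exact: cf.
have cB s : 0 <= s -> {for s, continuous B}.
  move=> s0; have e0 : eta s != 0 by rewrite gt_eqF// eta_gt0.
  have e20 : 2 * eta s ^+ 2 != 0 by rewrite mulf_neq0// sqrf_eq0.
  apply: cvgM; last by apply: cvgM; apply: cvgD; [exact: cvg_cst|exact: cvg_id|exact: cvg_cst|exact: cvg_id].
  apply: cvgD; first exact: is_derive_continuous (is_derive_dlog s0).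
  apply: cvgM; first exact: cvg_id.
  apply: cvgM.
    apply: cvgB; last by apply: cvgM; exact: c2.
    by apply: cvgM; [exact: c3|exact: c1].
  apply: cvgV => //; apply: cvgM; first exact: cvg_cst.
  by apply: cvgM; exact: c1.
have cB02 : {within `[0, 2], continuous (fun s => `|B s|)}.
  apply: continuous_in_subspaceT => s; rewrite inE /= in_itv /= => /andP[s0 _].
  by apply: cvg_norm; exact: cB.
have [c _ cmax] := EVT_max (ler0n _ 2) cB02.
exists (`|B c| + 9) => [|s s0]; first by rewrite addr_ge0.
rewrite -(ger0_norm (sqr_ge0 (1 + s))) -normrM -/(B s).
have [s2|s2] := leP s 2.
  by apply: ler_wpDr => //; apply: cmax; rewrite in_itv /= s0.
apply: ler_wpDl => //.
have g0 : gap s <= 0 by rewrite /gap; nra.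
rewrite /B /dlog /dlog' /eta'' /eta' eta_far; last first.
  by rewrite ger0_norm; lra.
rewrite /flat1' /flat1'' !flat_le0//.
have s1 : s - 1 != 0 by rewrite subr_eq0 gt_eqF//; lra.
have -> : (2 * (s - 1) * (1 - 0) / (2 * (1 - s) ^+ 2) +
     s * (((2 * (1 - 0) + (2 * (s - 1)) ^+ 2 * 0) * (1 - s) ^+ 2 - (2 * (s - 1) * (1 - 0)) ^+ 2) /
      (2 * (1 - s) ^+ 2 ^+ 2))) * (1 + s) ^+ 2 = - ((1 + s) / (s - 1)) ^+ 2.
  by field; rewrite s1 -opprB oppr_eq0 s1.
rewrite normrN ger0_norm ?sqr_ge0//.
have -> : (9 : R) = 3 ^+ 2 by rewrite -natrX.
rewrite lerXn2r ?nnegrE ?divr_ge0//; try lra.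
rewrite ler_pdivrMr; lra.
Qed.

End Profile.

(** * Growth and zeros of complex polynomials *)

Section PolynomialGrowth.
Context {R : realType}.
Implicit Types (p A B : {poly R[i]}) (z w : R[i]).
Local Notation normc := (@ComplexField.Normc.normc R).

Lemma normc_sqn z : normc z ^+ 2 = sqn z.
Proof. by case: z => a b; rewrite /= sqr_sqrtr // addr_ge0 ?sqr_ge0. Qed.

Lemma normc_ge0 z : 0 <= normc z.
Proof. by case: z => a b; exact: sqrtr_ge0. Qed.

Lemma normc_gt0 z : z != 0 -> 0 < normc z.
Proof.
rewrite -sqn_gt0 -normc_sqn => h; rewrite lt_neqAle normc_ge0 andbT eq_sym.
by apply: contraTneq h => ->; rewrite expr0n ltxx.
Qed.

Lemma normcX z k : normc (z ^+ k) = normc z ^+ k.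
Proof.
elim: k => [|k IH]; first by rewrite !expr0 ComplexField.Normc.normc1.
by rewrite !exprS ComplexField.Normc.normcM IH.
Qed.

Lemma pow_le_1D (r : R) (i d : nat) : 0 <= r -> (i <= d)%N -> r ^+ i <= 1 + r ^+ d.
Proof.
move=> r0 id; have [r1|r1] := leP r 1.
  have h : r ^+ i <= 1 by rewrite exprn_ile1.
  by apply: le_trans h _; rewrite lerDl exprn_ge0.
by apply: le_trans (_ : r ^+ d <= _); [exact: ler_weXn2l (ltW r1) _ _ id|rewrite lerDr].
Qed.

Lemma horner_upper p d : (size p <= d.+1)%N -> exists2 C : R, 0 <= C &
  forall z, normc p.[z] <= C * (1 + normc z ^+ d).
Proof.
move=> sp; exists (\sum_(i < size p) normc p`_i) => [|z].
  by apply: sumr_ge0 => i _; exact: normc_ge0.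
rewrite horner_coef mulr_suml.
apply: le_trans (_ : \sum_(i < size p) normc (p`_i * z ^+ i) <= _).
  elim/big_ind2: _ => [|x1 y1 x2 y2 h1 h2|i _]; rewrite ?ComplexField.Normc.normc0//.
  by apply: le_trans (le_normcD _ _) _; rewrite lerD.
apply: ler_sum => i _; rewrite ComplexField.Normc.normcM normcX ler_wpM2l ?normc_ge0//.
by apply: pow_le_1D; rewrite ?normc_ge0// -ltnS; apply: leq_trans sp.
Qed.

Lemma horner_lower A d : size A = d.+1 -> exists2 C : R, 0 <= C &
  forall z, normc z ^+ d <= C * (1 + normc A.[z]).
Proof.
case: d => [|d] sA.
  by exists 1 => // z; rewrite expr0 mul1r lerDl normc_ge0.
pose c := lead_coef A; pose A' := A - c *: 'X^(d.+1).
have c0 : 0 < normc c by rewrite normc_gt0// lead_coef_eq0 -size_poly_eq0 sA.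
have sA' : (size A' <= d.+1)%N.
  apply/leq_sizeP => j; rewrite leq_eqVlt => /predU1P[<-|dj]; rewrite coefB coefZ coefXn.
    by rewrite eqxx mulr1 /c lead_coefE sA subrr.
  by rewrite gtn_eqF// mulr0 subr0 nth_default// sA.
have [b b0 hb] := horner_upper sA'.
(* Beyond radius [rho] the lower-order terms amount to at most half of the leading one. *)
pose rho := Num.max 1 (4 * b / normc c).
have rho1 : 1 <= rho by rewrite le_max lexx.
exists (rho ^+ d.+1 + 2 / normc c) => [|z].
  by rewrite addr_ge0 ?exprn_ge0 ?(le_trans ler01 rho1)// divr_ge0 ?(ltW c0).
set r := normc z; have r0 : 0 <= r by exact: normc_ge0.
have C20 : 0 <= 2 / normc c by rewrite divr_ge0// ltW.
have [rr|rr] := leP r rho.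
  apply: le_trans (_ : rho ^+ d.+1 <= _).
    by rewrite lerXn2r ?nnegrE// (le_trans ler01).
  rewrite -[leLHS]mulr1 ler_pM ?exprn_ge0 ?(le_trans ler01)//.
    by rewrite lerDl.
  by rewrite lerDl normc_ge0.
have r1 : 1 <= r by apply: le_trans rho1 (ltW rr).
have rb : 4 * b <= normc c * r.
  rewrite -ler_pdivrMl// mulrC; apply: le_trans (ltW rr).
  by rewrite le_max lexx orbT.
have rd1 : 1 <= r ^+ d by rewrite exprn_ege1.
have : normc c * r ^+ d.+1 <= normc A.[z] + b * (1 + r ^+ d).
  rewrite -normcX -ComplexField.Normc.normcM.
  have -> : c * z ^+ d.+1 = A.[z] - A'.[z].
    by rewrite /A' hornerD hornerN hornerZ hornerXn opprB addrC subrK.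
  apply: le_trans (le_normcD _ _) _; rewrite lerD2l normcN; exact: hb.
rewrite exprS => h.
have h2 : b * (1 + r ^+ d) <= normc c * r / 2 * r ^+ d.
  apply: le_trans (_ : b * (2 * r ^+ d) <= _).
    by rewrite ler_wpM2l// mulr_natl mulr2n lerD2r.
  by rewrite mulrA ler_wpM2r ?exprn_ge0//; lra.
have h3 : normc c * (r * r ^+ d) <= 2 * normc A.[z].
  have -> : normc c * (r * r ^+ d) = 2 * (normc c * (r * r ^+ d) - normc c * r / 2 * r ^+ d) by field.
  rewrite ler_pM2l// lerBlDr; apply: le_trans h _; by rewrite lerD2l.
apply: le_trans (_ : 2 / normc c * normc A.[z] <= _).
  by rewrite mulrAC ler_pdivlMr// mulrC.
apply: ler_pM => //; rewrite ?normc_ge0//.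
  by rewrite lerDr exprn_ge0// (le_trans ler01).
by rewrite lerDr.
Qed.

(** Reduces growth comparisons to comparisons of degrees; the additive 1 takes care of the zeros of
    [A]. *)
Lemma sqn_horner_le A B : (size B <= size A)%N -> exists2 C : R, 0 <= C &
  forall z, sqn B.[z] <= C * (1 + sqn A.[z]).
Proof.
case sA : (size A) => [|d] sB.
  exists 0 => // z; move: sB; rewrite leqn0 size_poly_eq0 => /eqP ->.
  by rewrite horner0 mul0r /sqn /= !expr0n addr0.
have [b b0 hb] := horner_upper sB; have [c c0 hc] := horner_lower sA.
exists (2 * (b * (1 + c)) ^+ 2) => [|z]; first by rewrite mulr_ge0 ?sqr_ge0.
have h : normc B.[z] <= b * (1 + c) * (1 + normc A.[z]).
  apply: le_trans (hb z) _; rewrite -mulrA ler_wpM2l//.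
  rewrite mulrDl mul1r -addrA lerD2l; apply: le_trans (hc z) _.
  by rewrite lerDr normc_ge0.
rewrite -!normc_sqn; have a0 := normc_ge0 A.[z]; have B0 := normc_ge0 B.[z].
apply: le_trans (_ : (b * (1 + c) * (1 + normc A.[z])) ^+ 2 <= _).
  by rewrite lerXn2r ?nnegrE// !mulr_ge0 ?addr_ge0.
move: (normc _) a0 => x x0; set Y := b * (1 + c).
rewrite exprMn [leRHS](_ : _ = Y ^+ 2 * (2 * (1 + x ^+ 2))); last by ring.
by rewrite ler_wpM2l ?sqr_ge0//; have := sqr_ge0 (1 - x); rewrite !expr2; lra.
Qed.

Definition primitive p : {poly R[i]} := \poly_(i < (size p).+1) (p`_i.-1 / i%:R).

Lemma deriv_primitive p : (primitive p)^`() = p.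
Proof.
apply/polyP => i; rewrite coef_deriv coef_poly ltnS.
case: ltnP => ip; last by rewrite mul0rn nth_default.
by rewrite -(mulr_natr (_ / _)) divfK// pnatr_eq0.
Qed.

Lemma horner_near0 p z : (\forall w \near z, p.[w] = 0) -> p = 0.
Proof.
move=> h; apply/eqP/negP => /negP p0.
have cz : (fun t : R => z + t%:C * axis 0) t @[t --> (0 : R)] --> (z : R[i]).
  by have := @axisM_continuous R z 0 0; rewrite /continuous_at mul0r addr0.
have : \forall t \near (0 : R), p.[z + t%:C] = 0.
  have h2 : nbhs (0 : R) [set t : R | p.[z + t%:C * axis 0] = 0] by exact: cz h.
  by apply: filterS h2 => t /=; rewrite /axis /= mulr1.
case/nbhs_ballP => e /= e0 he.
(* Distinct roots on a real segment; the shift by 2 keeps the first of them strictly inside the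
   ball. *)
pose pt (i : nat) : R[i] := z + (e / i.+2%:R)%:C.
have rt i : root p (pt i).
  apply/eqP/he; rewrite /ball /= sub0r normrN gtr0_norm ?divr_gt0//.
  by rewrite ltr_pdivrMr ?ltr0n// ltr_pMr// ltr1n.
have : (size [seq pt i | i <- iota 0 (size p)] < size p)%N.
  apply: max_poly_roots => //; first by apply/allP => x /mapP[i _ ->]; exact: rt.
  rewrite map_inj_uniq ?iota_uniq// => i j /addrI/complexI/(mulfI (lt0r_neq0 e0))/invr_inj.
  by move/eqP; rewrite eqr_nat => /eqP [].
by rewrite size_map size_iota ltnn.
Qed.

End PolynomialGrowth.

(** * The level set |g| = 1 has empty interior *)

Section SquaredNorm.
Context {R : realType}.

Lemma is_pd_sqn j (h : R[i] -> R[i]) (z h' : R[i]) : is_derive z 1 h h' ->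
  is_pd j (fun w => sqn (h w)) z (2 * complex.Re (cj (h z) * h' * axis j)).
Proof.
move=> hh; have z0 : z + (0 : R)%:C * axis j = z by rewrite mul0r addr0.
have [hr hi] : cderive (fun t : R => h (z + t%:C * axis j)) 0 (h' * axis j).
  by rewrite -{1}z0 in hh; exact: (cderive_comp hh (cderive_axis _ _ _)).
have := is_deriveD1 (is_deriveM1 hr hr) (is_deriveM1 hi hi).
by rewrite z0 => D; apply: is_derive_eq D _; rewrite !ReImE; ring.
Qed.

(** On an open set where |g| = 1 both partial derivatives of |g|^2 vanish, so [cj g * g'] is zero;
    there [g] does not vanish, hence [g'] is zero near a point and thus everywhere. *)
Lemma sqn_horner_dense (g : {poly R[i]}) (M : set R[i]) : open M -> g^`() != 0 ->
  M `<=` closure (M `&` [set z | sqn g.[z] != 1]).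
Proof.
move=> oM g0 z Mz U Uz.
apply: contrapT => /set0P/negP/negPn/eqP h.
have s1 : \forall w \near z, sqn g.[w] = 1.
  apply: filterS2 (open_nbhs_nbhs (conj oM Mz)) Uz => w Mw Uw.
  apply/eqP/negP => /negP w1; have : set0 w by rewrite -h; split.
  by [].
suff : g^`() = 0 by apply/eqP.
apply: (@horner_near0 _ _ z).
have oi : open (interior [set w | sqn g.[w] = 1]) by exact: open_interior.
have zi : interior [set w | sqn g.[w] = 1] z by exact: s1.
apply: filterS (open_nbhs_nbhs (conj oi zi)) => w wi.
have w1 : sqn g.[w] = 1 by exact: interior_subset wi.
have H j : complex.Re (cj g.[w] * (g^`()).[w] * axis j) = 0.
  have h1 := is_pd_pd (is_pd_sqn j (is_derive_horner g w)).
  have h2 : is_pd j (fun w => sqn g.[w]) w 0.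
    by apply: is_pd_near (is_pd_cst j 1 w); apply: filterS wi => v /= ->.
  by move: h1; rewrite (is_pd_pd h2) => /esym/eqP; rewrite mulf_eq0 pnatr_eq0 /= => /eqP.
have e : cj g.[w] * (g^`()).[w] = 0.
  have := (H 0, H 1); rewrite /axis /= mulr1 => -[h1]; rewrite -/('i%C) cReM /= mulr0 mulr1 sub0r.
  by move=> h2; apply: ReImP => //=; apply/eqP; rewrite -oppr_eq0 h2.
move/eqP: e; rewrite mulf_eq0 => /orP[/eqP e|/eqP//].
by move: w1; rewrite -(conjK g.[w]) e conj0 /sqn /= expr0n addr0 => /esym/eqP; rewrite oner_eq0.
Qed.

End SquaredNorm.

(** * Monotonicity of the integral as a supremum *)

Section MonotoneIntegral.
Local Open Scope ereal_scope.
Context d (T : measurableType d) (R : realType) (mu : {measure set T -> \bar R}).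

(** The integral of a nonnegative function is the supremum of the integrals of the simple functions
    below it, and a larger function admits more of them. Lengths and total curvatures are compared
    in this way. *)
Lemma ge0_le_integral_nomeas (D : set T) (f g : T -> \bar R) :
  (forall x, D x -> 0 <= f x) -> (forall x, D x -> f x <= g x) ->
  \int[mu]_(x in D) f x <= \int[mu]_(x in D) g x.
Proof.
move=> f0 fg; rewrite integral_mkcond [leRHS]integral_mkcond.
rewrite !ge0_integralTE; first last.
- by move=> x; rewrite patchE; case: ifPn => // /set_mem/f0.
- by move=> x; rewrite patchE; case: ifPn => // /set_mem Dx; apply: le_trans (fg _ Dx); exact: f0.
apply: le_ereal_sup => _ [h hf <-]; exists h => // x; apply: le_trans (hf x) _.
by rewrite !patchE; case: ifPn => // /set_mem/fg.
Qed.

End MonotoneIntegral.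

(** * Lengths, distances and completeness for conformal metrics *)

Section ConformalLength.
Context {R : realType}.
Implicit Types (M : set R[i]) (E : R[i] -> R) (c : R -> R[i]).
Local Notation conf E := (fun z : R[i] => (E z)%:M : 'M[R]_2).

Definition cvel c (t : R) : R[i] := derive1 (coord 0 \o c) t +i* derive1 (coord 1 \o c) t.

Lemma quad_velocity (l : R) c t : quad l%:M (velocity c t) = l * sqn (cvel c t).
Proof.
rewrite /quad mul_mx_scalar -scalemxAl mxE !mxE; congr (_ * _).
rewrite !big_ord_recl big_ord0 !mxE addr0 /sqn /cvel /= !expr2.
by congr (_ * _ + _ * _); congr (derive1 _ _); congr (coord _ \o _); exact: val_inj.
Qed.

Lemma C1_cderive M x y c t : C1_curve M x y c -> cderive c t (cvel c t).
Proof.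
move=> [dc _ _ _]; split => /=.
  by have := dc 0 t => /derivableP; rewrite -derive1E.
by have := dc 1 t => /derivableP; rewrite -derive1E.
Qed.

Lemma continuous_cvel M x y c : C1_curve M x y c -> continuous (cvel c).
Proof. by move=> [_ cc _ _] t; apply: cvg_complex; exact: cc. Qed.

(** The bound on [h'] says that [k h] does not increase lengths from the metric E |dz|^2 to the
    Euclidean one; the fundamental theorem of calculus is applied to the real part of [h] along the
    curve. *)
Lemma curve_length_ge M E (h h' : R[i] -> R[i]) (k : R) x y c : 0 <= k ->
  (forall z, M z -> is_derive z 1 h (h' z)) ->
  (forall z, M z -> {for z, continuous h'}) ->
  (forall z, M z -> k ^+ 2 * sqn (h' z) <= E z) ->
  C1_curve M x y c ->
  ((k * `|complex.Re (h y) - complex.Re (h x)|)%:E <= curve_length (conf E) c)%E.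
Proof.
move=> k0 dh ch hE C1; have [_ _ [c0 c1] cM] := C1.
pose phi t := complex.Re (h (c t)); pose phi' t := complex.Re (h' (c t) * cvel c t).
have dphi (t : R) : I01 t -> is_derive t (1 : R) phi (phi' t).
  by move=> /cM Mc; exact: (cderive_comp (dh _ Mc) (C1_cderive t C1)).1.
have cphi (t : R) : I01 t -> {for t, continuous phi}.
  by move/dphi/is_derive_continuous.
have cphi' : {within I01, continuous phi'}.
  apply: continuous_in_subspaceT => t; rewrite inE => It.
  have ccc := cderive_continuous (C1_cderive t C1).
  have e1 : {for t, continuous (fun s => h' (c s))} := continuous_comp ccc (ch _ (cM _ It)).
  have e2 := continuousMc e1 (@continuous_cvel _ _ _ _ C1 t).
  exact: (@continuous_comp _ _ _ _ (@complex.Re R) t e2 (@continuous_Re _ _)).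
have I0 : I01 (0 : R) by rewrite /= in_itv /= lexx ler01.
have I1 : I01 (1 : R) by rewrite /= in_itv /= lexx ler01.
have FTC : (\int[lebesgue_measure]_(t in I01) (phi' t)%:E = (phi 1 - phi 0)%:E)%E.
  rewrite (@continuous_FTC2 _ _ phi _ _ ltr01 cphi') ?EFinB//.
    split.
    - by move=> t /subset_itv_oo_cc It; case: (dphi t It).
    - by apply: cvg_at_right_filter; exact: cphi.
    - by apply: cvg_at_left_filter; exact: cphi.
  by move=> t /subset_itv_oo_cc It; rewrite derive1E; have [_ ->] := dphi t It.
have /integrableP[mphi _] := continuous_compact_integrable (@segment_compact R 0 1) cphi'.
have -> : complex.Re (h y) - complex.Re (h x) = phi 1 - phi 0 by rewrite /phi c0 c1.
apply: (@le_trans _ _ (k%:E * \int[lebesgue_measure]_(t in I01) `|(phi' t)%:E|)%E).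
  rewrite EFinM lee_wpmul2l ?lee_fin//.
  by rewrite -[X in (X <= _)%E]/(`|(phi 1 - phi 0)%:E|)%E -FTC; exact: le_abse_integral.
have mabs := measurableT_comp (@abse_measurable R setT) mphi.
rewrite -ge0_integralZl//.


apply: ge0_le_integral_nomeas => t It; first by rewrite mule_ge0// lee_fin.
rewrite quad_velocity /= -EFinM lee_fin.
rewrite -[leLHS]ger0_norm ?mulr_ge0// -sqrtr_sqr ler_wsqrtr//.
have Mc := cM _ It; apply: le_trans (_ : k ^+ 2 * sqn (h' (c t)) * sqn (cvel c t) <= _).
  rewrite exprMn -mulrA ler_wpM2l ?sqr_ge0// real_normK ?num_real// -sqnM.
  by rewrite /sqn lerDl sqr_ge0.
by rewrite ler_wpM2r ?sqn_ge0// hE.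
Qed.

Lemma C1_segment M x y : (forall t : R, I01 t -> M (x + t%:C * (y - x))) ->
  C1_curve M x y (fun t => x + t%:C * (y - x)).
Proof.
have H (a b : R) (t : R) : is_derive t (1 : R) (fun s : R => a + s * b) b.
  apply: (@is_derive_eq _ _ _ _ _ _ _ _ (is_deriveD1 (is_derive_cst a t 1)
     (is_deriveM1 (is_derive_id t 1) (is_derive_cst b t 1)))); rewrite /=; ring.
have cE j : coord j \o (fun t : R => x + t%:C * (y - x)) = fun t => coord j x + t * coord j (y - x).
  apply/funext => t; rewrite /coord /=; case: ifP => _; rewrite !ReImE /=; ring.
move=> sM; split => //.
- by move=> j t; rewrite cE; case: (H (coord j x) (coord j (y - x)) t).
- move=> j; rewrite cE (_ : derive1 _ = fun=> coord j (y - x)); first exact: cst_continuous.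
  by apply/funext => t; rewrite derive1E; have [_ ->] := H (coord j x) (coord j (y - x)) t.
- by rewrite mul0r addr0 mul1r addrC subrK.
Qed.

Lemma cvel_segment x y t : cvel (fun t : R => x + t%:C * (y - x)) t = y - x.
Proof.
have H (a b : R) : derive1 (fun s : R => a + s * b) t = b.
  rewrite derive1E; apply: derive_val.
  apply: (@is_derive_eq _ _ _ _ _ _ _ _ (is_deriveD1 (is_derive_cst a t 1)
     (is_deriveM1 (is_derive_id t 1) (is_derive_cst b t 1)))); rewrite /=; ring.
rewrite /cvel.
have -> : coord 0 \o (fun t : R => x + t%:C * (y - x)) = fun t => complex.Re x + t * complex.Re (y - x).
  apply/funext => s; rewrite /coord /= !ReImE /=; ring.
have -> : coord 1 \o (fun t : R => x + t%:C * (y - x)) = fun t => complex.Im x + t * complex.Im (y - x).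
  apply/funext => s; rewrite /coord /= !ReImE /=; ring.
by rewrite !H; case: (y - x).
Qed.

Lemma segment_length_le E (K : R) (x y : R[i]) :
  (forall t : R, I01 t -> E (segment x y t) <= K) ->
  (curve_length (conf E) (segment x y) <= (Num.sqrt (K * sqn (y - x)))%:E)%E.
Proof.
move=> EK; apply: (@le_trans _ _ (\int[lebesgue_measure]_(t in I01) (cst (Num.sqrt (K * sqn (y - x)))%:E) t)%E).
  apply: ge0_le_integral_nomeas => t It; first by rewrite lee_fin sqrtr_ge0.
  by rewrite quad_velocity cvel_segment lee_fin ler_wsqrtr// ler_wpM2r ?sqn_ge0// EK.
rewrite integral_cst//= lebesgue_measure_itv /= lte_fin ltr01 oppr0 adde0 mule1.
by [].
Qed.

Lemma nbhs_sqn z (A : set R[i]) : nbhs z A ->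
  exists2 r : R, 0 < r & forall w, sqn (w - z) < r -> A w.
Proof.
move=> /nbhs_ballP[e /= e0 he].
have /complex_realP[c ec] : e \is Num.real by apply: gtr0_real.
have c0 : 0 < c by rewrite -ltr0c -ec.
exists (c ^+ 2); first by rewrite exprn_gt0.
move=> w wz; apply: he; rewrite /ball /= distrC ec normC_real ltcR.
rewrite -[ltRHS]ger0_norm ?(ltW c0)// -sqrtr_sqr ltr_sqrt//.
by rewrite exprn_gt0.
Qed.

Lemma cauchy_seq_cvg (a : nat -> R) :
  (forall e : R, 0 < e -> exists N, forall k m, (N <= k)%N -> (N <= m)%N -> `|a k - a m| < e) ->
  exists l : R, (a i @[i --> \oo] --> l)%classic.
Proof.
move=> ca; suff : cvg (a i @[i --> \oo])%classic by move=> h; exists (lim (a @ \oo)%classic).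
apply/cauchy_cvgP/cauchy_exP => e /ca[N hN].
exists (a N); exists N => // m /= Nm.
by rewrite /ball /=; apply: hN.
Qed.

(** A Cauchy sequence for the metric is also Cauchy for the identity, since [E >= k^2], and for [h].
    So it converges in the plane while [h] stays bounded along it, and the last hypothesis puts the
    limit in [M]. Near the limit [E] is bounded, and straight segments show convergence for the
    metric. *)
Lemma complete_conformal M E (h h' : R[i] -> R[i]) (k : R) : open M -> 0 < k ->
  (forall z, M z -> {for z, continuous E}) -> 
  (forall z, M z -> is_derive z 1 h (h' z)) ->
  (forall z, M z -> {for z, continuous h'}) ->
  (forall z, M z -> k ^+ 2 <= E z) ->
  (forall z, M z -> k ^+ 2 * sqn (h' z) <= E z) ->
  (forall B l, (forall e : R, 0 < e -> exists w, [/\ M w, sqn (w - l) < e & sqn (h w) <= B]) -> M l) ->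
  complete_metric M (conf E).
Proof.
move=> oM k0 cE dh ch kE hE Mcl u uM uC.
have low (f f' : R[i] -> R[i]) :
    (forall z, M z -> is_derive z 1 f (f' z)) -> (forall z, M z -> {for z, continuous f'}) ->
    (forall z, M z -> k ^+ 2 * sqn (f' z) <= E z) ->
    forall e : R, 0 < e -> exists N, forall i j, (N <= i)%N -> (N <= j)%N ->
      `|complex.Re (f (u i)) - complex.Re (f (u j))| < e.
  move=> df cf fE e e0; have [N hN] := uC _ (mulr_gt0 k0 e0).
  exists N => i j Ni Nj; have := hN _ _ Nj Ni => /ereal_inf_lt[_ [c C1 <-]] lc.
  have := curve_length_ge (ltW k0) df cf fE C1 => /le_lt_trans/(_ lc).
  by rewrite lte_fin ltr_pM2l.
have cst1 (a z : R[i]) : {for z, continuous (fun=> a : R[i])} by exact: contc_cst.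
have lowi (f f' : R[i] -> R[i]) :
    (forall z, M z -> is_derive z 1 f (f' z)) -> (forall z, M z -> {for z, continuous f'}) ->
    (forall z, M z -> k ^+ 2 * sqn (f' z) <= E z) ->
    forall e : R, 0 < e -> exists N, forall i j, (N <= i)%N -> (N <= j)%N ->
      `|complex.Im (f (u i)) - complex.Im (f (u j))| < e.
  move=> df cf fE e e0.
  (* The imaginary part of [f] is the real part of [-i f]. *)
  have [|||N hN] := low (fun z => - 'i%C * f z) (fun z => - 'i%C * f' z) _ _ _ _ e0.
  - move=> z Mz; have := is_deriveM (is_derive_cst (- 'i%C : R[i]) z 1) (df z Mz) => H.
    apply: (@is_derive_eq _ _ _ _ _ _ _ _ H).
    by rewrite -[_ *: _ + _]/(- 'i%C * f' z + f z * 0) mulr0 addr0.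
  - by move=> z Mz; apply: contcM => //; exact: cf.
  - move=> z Mz; rewrite sqnM; have -> : sqn (- 'i%C : R[i]) = 1.
      by rewrite /sqn /=; ring.
    by rewrite mul1r; exact: fE.
  exists N => i j Ni Nj; have := hN _ _ Ni Nj; by rewrite -!Im_mulNi.
have did (z : R[i]) : M z -> is_derive z 1 (fun w : R[i] => w) (1 : R[i]).
  by move=> _; exact: is_derive_id.
have kE1 (z : R[i]) : M z -> k ^+ 2 * sqn (1 : R[i]) <= E z.
  by move=> /kE; rewrite (_ : sqn 1 = 1) ?mulr1// /sqn /=; ring.
have [lx hlx] := cauchy_seq_cvg (low _ _ did (fun z _ => cst1 _ z) kE1).
have [ly hly] := cauchy_seq_cvg (lowi _ _ did (fun z _ => cst1 _ z) kE1).
pose l : R[i] := lx +i* ly.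
have ul (e : R) : 0 < e -> exists N, forall m, (N <= m)%N -> sqn (u m - l) < e.
  move=> e0; have d0 : 0 < Num.sqrt (e / 2) by rewrite sqrtr_gt0 divr_gt0.
  have sq (x : R) : `|x| < Num.sqrt (e / 2) -> x ^+ 2 < e / 2.
    move=> hx; rewrite -real_normK ?num_real// -[ltRHS]sqr_sqrtr ?divr_ge0 ?(ltW e0)//.
    by rewrite ltrXn2r ?nnegrE ?sqrtr_ge0.
  move/cvgrPdist_lt : hlx => /(_ _ d0) [N1 _ h1].
  move/cvgrPdist_lt : hly => /(_ _ d0) [N2 _ h2].
  exists (maxn N1 N2) => m; rewrite geq_max => /andP[m1 m2].
  rewrite /sqn !ReImE /= (splitr e) ltrD//; apply: sq; rewrite distrC; [exact: h1|exact: h2].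
have Ml : M l.
  have [N1 h1] := low _ _ dh ch hE 1 ltr01; have [N2 h2] := lowi _ _ dh ch hE 1 ltr01.
  pose N := maxn N1 N2.
  apply: (Mcl ((`|complex.Re (h (u N))| + 1) ^+ 2 + (`|complex.Im (h (u N))| + 1) ^+ 2)) => e e0.
  have [N3 h3] := ul _ e0.
  exists (u (maxn N N3)); split => //; first by apply: h3; exact: leq_maxr.
  have NN : (N <= maxn N N3)%N by exact: leq_maxl.
  have b (x y : R) : `|x - y| < 1 -> x ^+ 2 <= (`|y| + 1) ^+ 2.
    move=> xy; rewrite -[leLHS]real_normK ?num_real// lerXn2r ?nnegrE ?addr_ge0//.
    rewrite -[x in `|x|](subrK y) addrC; apply: le_trans (ler_normD _ _) _.
    by rewrite lerD2l ltW.
  rewrite /sqn lerD//; apply: b; [apply: h1|apply: h2] => //;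
    rewrite ?(leq_trans _ NN) ?leq_maxl ?leq_maxr//.
exists l => // e e0.
have [r r0 hr] : exists2 r : R, 0 < r & forall w, sqn (w - l) < r -> M w /\ E w <= E l + 1.
  apply: nbhs_sqn; have := cE _ Ml.
  move/(@cvgrPdist_le _ _ _ _ (nbhs_filter l)) => /(_ _ ltr01).
  apply: filterS2 (open_nbhs_nbhs (conj oM Ml)) => w Mw El; split => //.
  by rewrite -lerBlDl; move: El; rewrite distrC ler_norml => /andP[].
pose K := E l + 1; have K0 : 0 < K by rewrite ltr_pwDr// (le_trans _ (kE _ Ml))// sqr_ge0.
have d0 : 0 < Num.min r (e ^+ 2 / K) by rewrite lt_min r0 divr_gt0// exprn_gt0.
have [N hN] := ul _ d0.
exists N => m Nm; have := hN _ Nm; rewrite lt_min => /andP[ur ue].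
have seg (t : R) : I01 t -> sqn (u m + t%:C * (l - u m) - l) < r.
  rewrite /= in_itv /= => /andP[t0 t1].
  have -> : u m + t%:C * (l - u m) - l = (1 - t)%:C * (u m - l) by rewrite !rcE; ring.
  apply: le_lt_trans ur; rewrite sqnM ler_piMl ?sqn_ge0//.
  by rewrite /sqn /= expr0n addr0 expr_le1//; lra.
apply: (@le_lt_trans _ _ (Num.sqrt (K * sqn (l - u m)))%:E).
  apply: ge_ereal_inf; exists (curve_length (conf E) (fun t => u m + t%:C * (l - u m))).
    by exists (fun t : R => u m + t%:C * (l - u m)) => //; apply: C1_segment => t /seg/hr[].
  by apply: segment_length_le => t /seg/hr[].
rewrite lte_fin -[ltRHS]ger0_norm ?(ltW e0)// -sqrtr_sqr ltr_sqrt ?exprn_gt0//.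
have -> : sqn (l - u m) = sqn (u m - l) by rewrite /sqn !ReImE; ring.
by rewrite mulrC -ltr_pdivlMr.
Qed.

End ConformalLength.

(** * Gauss curvature of a conformal metric *)

Section ConformalCurvature.
Context {R : realType}.
Variables (M : set R[i]) (oM : open M) (E : R[i] -> R).
Local Notation conf := (fun z : R[i] => (E z)%:M : 'M[R]_2).
(* phi is the differential of (ln E) / 2, and phi' the two terms of its Laplacian. *)
Variables phi phi' : 'I_2 -> R[i] -> R.
Hypothesis E0 : forall z, M z -> 0 < E z.
Hypothesis dE : forall j z, M z -> is_pd j E z (2 * E z * phi j z).
Hypothesis dphi : forall j z, M z -> is_pd j (phi j) z (phi' j z).

Lemma pd_conf i j l z : pd i (fun w => conf w j l) z = pd i E z *+ (j == l).
Proof.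
under eq_fun do rewrite mxE.
case: (j == l) => /=; first by rewrite mulr1n; congr (pd i _ z); apply/funext => w; rewrite mulr1n.
rewrite mulr0n; under eq_fun do rewrite mulr0n; exact: is_pd_pd (is_pd_cst i 0 z).
Qed.

Lemma christoffel_conf k i j z : M z -> christoffel conf k i j z =
  phi i z *+ (j == k) + phi j z *+ (i == k) - phi k z *+ (i == j).
Proof.
move=> Mz; have E0z := E0 Mz.
rewrite /christoffel invmx_scalar (bigD1 k) //= big1 ?addr0; last first.
  by move=> l lk; rewrite !mxE eq_sym (negbTE lk) mulr0n mul0r.
rewrite !pd_conf !mxE eqxx mulr1n !(is_pd_pd (dE _ Mz)).
by case: (j == k); case: (i == k); case: (i == j); rewrite /= ?mulr1n ?mulr0n; field; rewrite gt_eqF.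
Qed.

(** The quadratic terms in the Christoffel symbols cancel in dimension two, leaving minus the
    Laplacian of (ln E) / 2, divided by E. *)
Lemma gauss_curvature_conf z : M z ->
  gauss_curvature conf z = - (phi' 0 z + phi' 1 z) / E z.
Proof.
move=> Mz; have E0z := E0 Mz.
have near_christoffel k i j : \forall w \near z, phi i w *+ (j == k) + phi j w *+ (i == k) - phi k w *+ (i == j)
    = christoffel conf k i j w.
  by apply: filterS (open_nbhs_nbhs (conj oM Mz)) => w Mw; rewrite christoffel_conf.
have d0 : pd 0 (christoffel conf 0 1 1) z = - phi' 0 z.
  apply/is_pd_pd/(is_pd_near (near_christoffel 0 1 1)) => /=.
  rewrite (_ : (fun w => _) = fun w => - phi 0 w); last by apply/funext => w; rewrite !mulr0n mulr1n !add0r.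
  by apply: is_pdN; exact: dphi.
have d1 : pd 1 (christoffel conf 0 0 1) z = phi' 1 z.
  apply/is_pd_pd/(is_pd_near (near_christoffel 0 0 1)) => /=.
  rewrite (_ : (fun w => _) = phi 1); last by apply/funext => w; rewrite !mulr0n mulr1n add0r subr0.
  exact: dphi.
have i1 : lift ord0 ord0 = 1 :> 'I_2 by exact: val_inj.
rewrite /gauss_curvature det_scalar /riem_tensor !big_ord_recl !big_ord0 !mxE.
rewrite !i1 -[ord0]/(0 : 'I_2) /= mulr1n mulr0n mul0r d0 d1 !christoffel_conf//=.
rewrite !mulr1n !mulr0n; field; by rewrite gt_eqF.
Qed.

Lemma curvature_density_conf z : M z ->
  `|gauss_curvature conf z| * Num.sqrt (\det (conf z)) = `|phi' 0 z + phi' 1 z|.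
Proof.
move=> Mz; rewrite gauss_curvature_conf// det_scalar sqrtr_sqr normrM normrN normfV.
by rewrite mulfVK// normr_eq0 gt_eqF// E0.
Qed.

End ConformalCurvature.

(** * Curvature of the modified metric *)

Section ProfileCurvature.
Context {R : realType}.
Variables (M : set R[i]) (oM : open M) (g P : {poly R[i]}).
Hypothesis P0 : forall z, M z -> P.[z] != 0.
Let s z : R := sqn g.[z].

(** The conformal factor |o|^2 (1 - s)^2 of the face, with |o| = |P|^-2 and [eta] in place of (1 -
    s)^2. *)
Definition profile (z : R[i]) : R := eta (s z) * (sqn P.[z])^-1 ^+ 2.

Let ds j z : R := 2 * complex.Re (cj g.[z] * (g^`()).[z] * axis j).
Let L z : R[i] := (P^`()).[z] / P.[z].

(** Half the differential of ln [profile]; the second term comes from ln |P|^-4. *)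
Definition profile_phi j z : R := dlog (s z) * ds j z - 2 * complex.Re (L z * axis j).

Lemma is_pd_s j z : is_pd j s z (ds j z).
Proof. exact: is_pd_sqn (is_derive_horner g z). Qed.

Lemma profile_gt0 z : M z -> 0 < profile z.
Proof.
move=> Mz; rewrite mulr_gt0 ?eta_gt0 ?sqn_ge0// exprn_gt0// invr_gt0 sqn_gt0.
exact: P0.
Qed.

Lemma is_pd_profile j z : M z -> is_pd j profile z (2 * profile z * profile_phi j z).
Proof.
move=> Mz; have p0 : sqn P.[z] != 0 by rewrite sqn_eq0 P0.
have e0 : eta (s z) != 0 by rewrite gt_eqF// eta_gt0// sqn_ge0.
have hP := is_pdV (u := fun w => sqn P.[w]) p0 (is_pd_sqn j (is_derive_horner P z)).
have hE := is_pd_comp (u := s) (is_derive_eta (s z)) (is_pd_s j z).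
have h := is_pdM hE (is_pdM hP hP).
have -> : profile = fun w => eta (s w) * ((sqn P.[w])^-1 * (sqn P.[w])^-1).
  by apply/funext => w; rewrite /profile expr2.
apply: is_derive_eq h _; rewrite /profile /profile_phi /dlog.
have -> : complex.Re (L z * axis j) = complex.Re (cj P.[z] * (P^`()).[z] * axis j) / sqn P.[z].
  rewrite /L invc_norm cjE -sqn_norm -fmorphV -Re_mul_real; congr complex.Re.
  by rewrite -[real_complex _ _]/((sqn P.[z])^-1%:C); ring.
move: (complex.Re _) => r; field; by rewrite p0 e0.
Qed.

Lemma is_pd_ds j z : is_pd j (ds j) z
  (2 * (sqn (g^`()).[z] + complex.Re (cj g.[z] * (g^`()^`()).[z] * axis j ^+ 2))).
Proof.
have z0 : z + (0 : R)%:C * axis j = z by rewrite mul0r addr0.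
have h1 := is_cpd_holo j (is_derive_horner g z).
have h2 := is_cpd_holo j (is_derive_horner g^`() z).
have h := cderiveM (cderive_cst 2 0) (cderiveM (cderiveM (cderive_conj h1) h2) (cderive_cst (axis j) 0)).
have {h} [hr _] := h; rewrite z0 in hr.
rewrite /is_pd (_ : along (ds j) z j = fun t : R => complex.Re (2 *
    (cj g.[z + t%:C * axis j] * (g^`()).[z + t%:C * axis j] * axis j))); last first.
  by apply/funext => t; rewrite /along /ds Re_mul2.
apply: is_derive_eq hr _.
have -> : 0 * (cj g.[z] * (g^`()).[z] * axis j) + 2 *
    ((cj ((g^`()).[z] * axis j) * (g^`()).[z] + cj g.[z] * ((g^`()^`()).[z] * axis j)) * axis j
     + cj g.[z] * (g^`()).[z] * 0) =
    2 * ((g^`()).[z] * cj (g^`()).[z] * (axis j * cj (axis j)) + cj g.[z] * (g^`()^`()).[z] * axis j ^+ 2).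
  by rewrite !conjE; ring.
by rewrite axis_conj mulr1 -sqnE Re_mul2 cReD.
Qed.

(** The function ln |P| is harmonic, so its terms cancel. For s = |g|^2 the squared gradient is 4 s
    |g'|^2 and the Laplacian 4 |g'|^2, which gives the remaining terms. *)
Lemma profile_laplacian z : M z ->
  pd 0 (profile_phi 0) z + pd 1 (profile_phi 1) z =
  4 * sqn (g^`()).[z] * (dlog (s z) + s z * dlog' (s z)) /\
  forall j, is_pd j (profile_phi j) z (pd j (profile_phi j) z).
Proof.
move=> Mz; have [d dL] : exists d, is_derive z 1 L d.
  exists ('D_1 L z); apply/derivableP/derivableM.
    by case: (is_derive_horner P^`() z).
  by apply: derivableV; [exact: P0|case: (is_derive_horner P z)].
have H j : is_pd j (profile_phi j) z
   (dlog' (s z) * ds j z ^+ 2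
    + dlog (s z) * (2 * (sqn (g^`()).[z] + complex.Re (cj g.[z] * (g^`()^`()).[z] * axis j ^+ 2)))
    - 2 * complex.Re (d * axis j ^+ 2)).
  have hs := is_pd_comp (u := s) (is_derive_dlog (sqn_ge0 g.[z])) (is_pd_s j z).
  have [hL _] := cderiveM (is_cpd_holo j dL) (cderive_cst (axis j) 0).
  have hL' : is_pd j (fun w => complex.Re (L w * axis j)) z (complex.Re (d * axis j ^+ 2)).
    by apply: is_derive_eq hL _; rewrite mulr0 addr0 expr2 mulrA.
  have h := is_pdD (is_pdM hs (is_pd_ds j z)) (is_pdN (is_pdM (is_pd_cst j 2 z) hL')).
  by apply: is_derive_eq h _; ring.
split; last by move=> j; rewrite (is_pd_pd (H j)).
rewrite !(is_pd_pd (H _)) /axis /= -/('i%C).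
have -> : ('i%C : R[i]) ^+ 2 = -1 by exact: sqr_i.
rewrite /ds /axis /= -/('i%C) expr1n !mulr1 !mulrN1 !cReN.
have -> : complex.Re (cj g.[z] * (g^`()).[z] * 'i%C) = - complex.Im (cj g.[z] * (g^`()).[z]).
  by rewrite cReM /= mulr0 mulr1 sub0r.
have : complex.Re (cj g.[z] * (g^`()).[z]) ^+ 2 + complex.Im (cj g.[z] * (g^`()).[z]) ^+ 2 = s z * sqn (g^`()).[z].
  rewrite -[LHS]/(sqn _) sqnM; congr (_ * _); rewrite /s /sqn /=; ring.
move: (complex.Re (cj g.[z] * (g^`()).[z])) (complex.Im (cj g.[z] * (g^`()).[z])) => a b ab.
transitivity (4 * dlog' (s z) * (a ^+ 2 + b ^+ 2) + 4 * dlog (s z) * sqn (g^`()).[z]); first by ring.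
by rewrite ab; ring.
Qed.

Lemma profile_curvature_density z : M z ->
  `|gauss_curvature (fun w => (profile w)%:M) z| * Num.sqrt (\det ((profile z)%:M : 'M[R]_2)) =
  4 * sqn (g^`()).[z] * `|dlog (s z) + s z * dlog' (s z)|.
Proof.
move=> Mz; have d2 j w (Mw : M w) := (profile_laplacian Mw).2 j.
rewrite (curvature_density_conf oM profile_gt0 is_pd_profile d2 Mz) (profile_laplacian Mz).1.
by rewrite normrM ger0_norm// mulr_ge0// sqn_ge0.
Qed.

End ProfileCurvature.

(** * A criterion for finite total curvature *)

Section TotalCurvature.
Context {R : realType}.
Local Notation mu := (@lebesgue_measure R).

Lemma integral_cauchy_density : (\int[mu]_x (1 + x ^+ 2)^-1%:E = pi%:E)%E.
Proof.
rewrite ge0_symfun_integralT//=.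
- rewrite (_ : [set x | _] = `[0, +oo[%classic); last first.
    by apply/seteqP; split => x/=; rewrite in_itv/= andbT.
  by rewrite integral0y_oneDsqr -EFinM mulrCA divff// mulr1.
- by move=> x; rewrite invr_ge0 addr_ge0// sqr_ge0.
- exact: continuous_oneDsqrV.
- by move=> x/=; rewrite sqrrN.
Qed.

Let cauchy (x : R) : R := (1 + x ^+ 2)^-1.

Let cauchy_gt0 x : 0 < cauchy x.
Proof. by rewrite invr_gt0 ltr_pwDl// sqr_ge0. Qed.

Let measurable_cauchy : measurable_fun setT cauchy.
Proof. by apply: continuous_measurable_fun; exact: continuous_oneDsqrV. Qed.

Lemma integral_cauchy_density2 (C : R) : 0 <= C ->
  (\int[mu \x mu]_v (C * (cauchy v.1 * cauchy v.2))%:E < +oo)%E.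
Proof.
move=> C0; rewrite fubini_tonelli1; first last.
- by move=> v; rewrite lee_fin !mulr_ge0// ltW.
- apply/measurable_EFinP/measurable_funM; first exact: measurable_cst.
  apply: measurable_funM; apply: measurableT_comp => //.
rewrite /fubini_F.
have E x : (\int[mu]_y (C * (cauchy x * cauchy y))%:E = (C * pi)%:E * (cauchy x)%:E)%E.
  under eq_integral do rewrite mulrA EFinM.
  rewrite ge0_integralZl//.
  - by rewrite integral_cauchy_density -!EFinM; congr EFin; ring.
  - exact/measurable_EFinP.
  - by move=> y _; rewrite lee_fin ltW.
  - by rewrite lee_fin mulr_ge0// ltW.
under eq_integral do rewrite E.
rewrite ge0_integralZl//.
- by rewrite integral_cauchy_density -EFinM ltry.
- exact/measurable_EFinP.
- by move=> y _; rewrite lee_fin ltW.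
- by rewrite lee_fin mulr_ge0// pi_ge0.
Qed.

(** Since (1 + x^2)(1 + y^2) <= (1 + x^2 + y^2)^2, the density is dominated by a product of two
    Cauchy densities, which Tonelli integrates. *)
Lemma finite_total_curvature_bound (M : set R[i]) (h : R[i] -> 'M[R]_2) (C : R) : 0 <= C ->
  (forall z, M z -> `|gauss_curvature h z| * Num.sqrt (\det (h z)) <= C / (1 + sqn z) ^+ 2) ->
  finite_total_curvature M h.
Proof.
move=> C0 hC; rewrite /finite_total_curvature integral_mkcond.
apply: le_lt_trans (integral_cauchy_density2 C0).
apply: ge0_le_integral_nomeas => [v _|v _]; rewrite patchE.
  by case: ifPn => // _; rewrite lee_fin mulr_ge0// sqrtr_ge0.
have pos : 0 <= C * (cauchy v.1 * cauchy v.2) by rewrite !mulr_ge0// ltW.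
case: ifPn => [/set_mem Mv|_]; rewrite lee_fin//.
apply: le_trans (hC _ Mv) _; rewrite ler_wpM2l// /cauchy -invfM lef_pV2 ?posrE; first last.
- by rewrite mulr_gt0// ltr_pwDl// sqr_ge0.
- by rewrite exprn_gt0// ltr_pwDl// sqn_ge0.
rewrite /sqn /=; have := sqr_ge0 v.1; have := sqr_ge0 v.2.
move: (v.1 ^+ 2) (v.2 ^+ 2) => a b; nra.
Qed.

End TotalCurvature.

(** * Choice of the punctures and of the polynomials [P] and [g] *)

Section PolynomialData.
Context {R : realType} (n : nat).

Definition puncture (j : 'I_n) : R[i] := j%:R.

Lemma puncture_inj : injective puncture.
Proof.
by move=> i j /eqP; rewrite /puncture eqr_nat => /eqP; exact: val_inj.
Qed.

Lemma polynomial_data : exists P g : {poly R[i]},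
  [/\ size P = n.+1, forall z, P.[z] = 0 <-> exists j, z = puncture j,
      forall j, (P^`()).[puncture j] != 0, g^`() = P * (P - P^`()^`()) &
      forall j, sqn g.[puncture j] <= 4^-1].
Proof.
pose P0 : {poly R[i]} := \prod_(j < n) ('X - (puncture j)%:P).
pose g0 := primitive (P0 * (P0 - P0^`()^`())).
pose S := \sum_(j < n) sqn g0.[puncture j].
have S0 : 0 <= S by apply: sumr_ge0 => j _; exact: sqn_ge0.
have d0 : 0 < 4 * (1 + S) by rewrite mulr_gt0// ltr_pwDl.
(* Scaling [P] by [k] scales [g] by [k^2] and |g|^2 by [k^4 <= k]; then [k S <= 1/4]. *)
pose k : R := (4 * (1 + S))^-1.
have k0 : 0 < k by rewrite invr_gt0.
have k1 : k <= 1 by rewrite invf_le1//; lra.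
have kC : k%:C != 0 :> R[i] by rewrite -ltr0c in k0; rewrite gt_eqF.
have rootP z : P0.[z] = 0 <-> exists j, z = puncture j.
  rewrite horner_prod; split => [/eqP|[j ->]].
    rewrite prodf_seq_eq0 => /hasP[j _ /=]; rewrite hornerXsubC subr_eq0 => /eqP ->.
    by exists j.
  by rewrite (bigD1 j)//= hornerXsubC subrr mul0r.
exists (k%:C *: P0), ((k%:C ^+ 2) *: g0); split.
- rewrite size_scale// /P0.
  rewrite -(big_map (fun j => puncture j) xpredT (fun x => 'X - x%:P)) size_prod_XsubC.
  by rewrite size_map /index_enum -enumT size_enum_ord.
- move=> z; rewrite hornerZ -rootP; split => [/eqP|->]; last by rewrite mulr0.
  by rewrite mulf_eq0 (negbTE kC) => /eqP.
- move=> j; rewrite derivZ hornerZ mulf_neq0//.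
  rewrite /P0 (bigD1 j)//= derivM derivXsubC mul1r hornerD hornerM hornerXsubC subrr mul0r addr0.
  rewrite horner_prod; apply/prodf_neq0 => i ij; rewrite hornerXsubC subr_eq0.
  by apply: contra ij => /eqP/puncture_inj ->.
- by rewrite derivZ deriv_primitive !derivZ -scalerBr -scalerAl -scalerAr scalerA expr2.
- move=> j; rewrite hornerZ sqnM expr2 sqnM.
  have -> : sqn k%:C = k ^+ 2 by rewrite /sqn /= expr0n addr0.
  have gS : sqn g0.[puncture j] <= S.
    by rewrite /S (bigD1 j)//= lerDl sumr_ge0// => i _; exact: sqn_ge0.
  have k0' := ltW k0.
  apply: (@le_trans _ _ (k * S)).
    apply: ler_pM => //; rewrite ?sqn_ge0 ?mulr_ge0 ?sqr_ge0//.
    have k2 : k ^+ 2 <= k by rewrite expr2 ler_piMr// ltW.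
    have k21 : k ^+ 2 <= 1 by apply: le_trans k1.
    by apply: le_trans k2; rewrite ler_piMr// sqr_ge0.
  by rewrite /k mulrC ler_pdivrMr//; lra.
Qed.

End PolynomialData.

(** * Lifts that depend only on the endpoint of a path *)

Section SingleValuedLift.
Context {R : realType}.
Implicit Types (c d : R -> R[i]) (F : R[i] -> 'M[R[i]]_2).

Lemma path_cat1 c d : path_cat c d 1 = d 1.
Proof.
rewrite /path_cat ifF; first by congr d; ring.
by apply/negbTE; rewrite -ltNge invf_lt1// ltr1n.
Qed.

Lemma segment1 (a b : R[i]) : segment a b 1 = b.
Proof. by rewrite /segment mul1r addrC subrK. Qed.

Lemma segment_continuous (a b : R[i]) : continuous (segment a b : R -> R[i]).
Proof.
move=> t; apply: cvgD; first exact: cvg_cst.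
by apply: cvgM; [exact: continuous_real_complex|exact: cvg_cst].
Qed.

Lemma branch_single F c w : branch (fun d => F (d 1)) c w = F w.
Proof. by rewrite /branch path_cat1 segment1. Qed.

Lemma dlift_single F c (D : 'M[R[i]]_2) :
  (forall i j, is_derive (c 1) 1 (fun w => F w i j) (D i j)) ->
  dlift (fun d => F (d 1)) c = D.
Proof.
move=> dF; apply/matrixP => i j; rewrite mxE; under eq_fun do rewrite branch_single.
by rewrite derive1E; case: (dF i j).
Qed.

Lemma is_derive_mx2 (z : R[i]) (p q r t : R[i] -> R[i]) (p' q' r' t' : R[i]) :
  is_derive z 1 p p' -> is_derive z 1 q q' -> is_derive z 1 r r' -> is_derive z 1 t t' ->
  forall i j, is_derive z 1 (fun w => mx2 (p w) (q w) (r w) (t w) i j) (mx2 p' q' r' t' i j).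
Proof.
by move=> dp dq dr dt -[[|[|//]] ?] [[|[|//]] ?]; under eq_fun do rewrite mxE; rewrite mxE.
Qed.

Lemma homotopic_endpoint M c d : path_homotopic M c d -> c 1 = d 1.
Proof.
move=> [H [_ _ Hc Hs]].
have I1 : `[0, 1]%classic (1 : R) by rewrite /= in_itv /= ler01 lexx.
by rewrite -(Hs 1 I1).2 -(Hc 1 I1).2.
Qed.

Lemma ratio_scale (k x y : R[i]) : k != 0 -> ratio (k * x) (k * y) = ratio x y.
Proof.
move=> k0; rewrite /ratio mulf_eq0 (negbTE k0) /=; case: ifP => // y0.
by rewrite -mulf_div divff// mul1r.
Qed.

Lemma ratio_cross (x y a b : R[i]) : ratio x y = ratio a b -> x * b = y * a.
Proof.
rewrite /ratio; case: eqVneq => [->|y0]; case: eqVneq => [->|b0] //; first by rewrite mulr0 mul0r.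
by move=> [/eqP]; rewrite eqr_div// => /eqP ->; rewrite mulrC.
Qed.

Lemma SU11_1 : SU11 (1%:M : 'M[R[i]]_2).
Proof.
exists 1, 0; split; last by rewrite normr1 normr0 expr1n expr0n subr0.
by apply/matrixP => -[[|[|//]] ?] [[|[|//]] ?]; rewrite !mxE //= ?oppr0.
Qed.

End SingleValuedLift.

(** * Exponential decay against polynomial growth *)

Section IrregularEnd.
Context {R : realType}.

Lemma sqn_cvg (T : Type) (F : set_system T) (h : T -> R[i]) z : Filter F ->
  h t @[t --> F] --> z -> sqn (h t) @[t --> F] --> sqn z.
Proof.
move=> FF hz; have oT : open [set: R[i]] by exact: openT.
have cs := class_C_cont (smooth_sqn oT (csmooth_id oT) 0%N) (I : [set: R[i]] z).
exact: (cvg_comp _ _ hz cs).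
Qed.

(* Comparing 'X and 'X * T with 'X * Q makes the additive constant of
   sqn_horner_le negligible at infinity. *)
Lemma exp_ratio_limit (Q T : {poly R[i]}) (k sg A B : R) (alpha beta : R -> R) :
  Q != 0 -> (size T <= size Q)%N -> 0 <= k -> sg ^+ 2 = 1 ->
  (forall t, 0 <= alpha t) -> (forall t, 0 <= beta t) ->
  alpha t @[t --> 0^'+] --> A -> beta t @[t --> 0^'+] --> B ->
  (\forall t \near 0^'+, sqn Q.[(sg / t)%:C] * beta t =
     k * expR (- (4 / t)) * (sqn T.[(sg / t)%:C] * alpha t)) -> B <= 0.
Proof.
move=> Q0 sTQ k0 sg1 a0 b0 aA bB eq.
have sXQ : size ('X * Q)%R = (size Q).+1 by rewrite mulrC size_mulX.
have s1 : (size ('X : {poly R[i]}) <= size ('X * Q)%R)%N.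
  by rewrite sXQ size_polyX ltnS size_poly_gt0.
have s2 : (size ('X * T)%R <= size ('X * Q)%R)%N.
  have [->|T0] := eqVneq T 0; first by rewrite mulr0 size_poly0.
  by rewrite sXQ mulrC size_mulX// ltnS.
have [C1 C10 hC1] := sqn_horner_le s1; have [C2 C20 hC2] := sqn_horner_le s2.
have lim0 : k * t * C2 * alpha t + C1 * (t * t) * beta t @[t --> 0^'+] -->
    k * 0 * C2 * A + C1 * (0 * 0) * B.
  have id0 : t @[t --> (0:R)^'+] --> (0 : R) by exact: cvg_at_right_filter cvg_id.
  apply: cvgD; apply: cvgM => //; [apply: cvgM; last exact: cvg_cst|]; apply: cvgM => //; try exact: cvg_cst.
  exact: cvgM.
rewrite !(mul0r, mulr0, addr0) in lim0.
apply: (ler_cvg_to bB lim0); near=> t.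
have t0 : 0 < t by [].
have tn0 : t != 0 by rewrite gt_eqF.
(* Linear decay of the exponential is all that the comparison needs. *)
have et : expR (- (4 / t)) <= t.
  rewrite expRN -[leRHS]invrK lef_pV2 ?posrE ?expR_gt0 ?invr_gt0//.
  apply: le_trans (expR_ge1Dx _); have : 0 < t^-1 by rewrite invr_gt0.
  by lra.
have eqt : sqn Q.[(sg / t)%:C] * beta t =
     k * expR (- (4 / t)) * (sqn T.[(sg / t)%:C] * alpha t) by near: t.
have := hC1 (sg / t)%:C; have := hC2 (sg / t)%:C.
rewrite !hornerM !hornerX !sqnM.
have -> : sqn (sg / t)%:C = (t * t)^-1.
  by rewrite /sqn /= expr0n addr0 exprMn sg1 mul1r expr2 invfM.
move: eqt; set q := sqn _; set w := sqn _; set E := expR _ in et *.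
have E0 : 0 <= E by rewrite expR_ge0.
have q0 : 0 <= q by exact: sqn_ge0.
have w0 : 0 <= w by exact: sqn_ge0.
move=> eqt h2 h1; have := a0 t; have := b0 t; set x := alpha t in eqt *; set y := beta t in eqt *.
move=> y0 x0.
set m := (t * t)^-1 in h1 h2.
have mt : t * t * m = 1 by rewrite divff// mulf_neq0.
have m0 : 0 < m by rewrite invr_gt0 mulr_gt0.
set L := 1 + m * q in h1 h2.
have L0 : 0 < L by rewrite ltr_pwDl// mulr_ge0// ltW.
(* Here L = 1 + |z Q|^2 at z = sg / t. The bound [C2] absorbs |z T|^2 into L, and [C1] absorbs the
   isolated [y] through 1 = t^2 |z|^2 <= C1 t^2 L; dividing by L leaves the quantity of [lim0],
   which tends to 0. *)
have g1 : y * L <= y + k * E * x * (C2 * L).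
  rewrite (_ : y * L = y + m * (q * y)); last by rewrite /L; ring.
  rewrite eqt lerD2l (_ : m * _ = k * E * x * (m * w)); last by ring.
  by rewrite ler_wpM2l// !mulr_ge0.
have g2 : 1 <= C1 * (t * t) * L.
  by rewrite -[leLHS]mt (mulrC C1) -(mulrA (t * t) C1) ler_wpM2l// mulr_ge0// ltW.
rewrite -(ler_pM2r L0) mulrDl; apply: le_trans g1 _; rewrite addrC; apply: lerD.
  rewrite (_ : k * t * C2 * x * L = k * t * x * (C2 * L)); last by ring.
  by rewrite ler_wpM2r ?mulr_ge0 ?(ltW L0)// ler_wpM2r// ler_wpM2l.
by rewrite mulrAC ler_peMl.
Unshelve. all: by end_near.
Qed.

End IrregularEnd.

(** * The face built from [P] and [g], and its ends *)

Section Construction.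
Context {R : realType} (n : nat) (P g : {poly R[i]}).
Hypothesis sP : size P = n.+1.
Hypothesis rootP : forall z, P.[z] = 0 <-> exists j : 'I_n, z = puncture j.
Hypothesis simpleP : forall j : 'I_n, (P^`()).[puncture j] != 0.
Hypothesis dg : g^`() = P * (P - P^`()^`()).
Hypothesis g_small : forall j : 'I_n, sqn g.[puncture j] <= 4^-1.

Let M : set R[i] := punctured_plane (@puncture R n).

Let ME z : M z <-> P.[z] != 0.
Proof.
split => [Mz|/eqP Pz j]; first by apply/eqP => /rootP[j zj]; have := Mz j; rewrite zj eqxx.
by apply/eqP => zj; apply: Pz; apply/rootP; exists j.
Qed.

Let PM z : M z -> P.[z] != 0. Proof. by move=> /ME. Qed.

Let oT : open [set: R[i]]. Proof. exact: openT. Qed.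

Lemma open_punctured : open M.
Proof.
rewrite openE => z /ME Pz.
have cs : {for z, continuous (fun w => sqn P.[w])}.
  by apply: (class_C_cont (smooth_sqn oT (csmooth_horner oT P) 0%N)).
have : nbhs (sqn P.[z]) [set x : R | x != 0].
  by apply: open_nbhs_nbhs; split; [exact: open_neq|rewrite /= sqn_eq0].
move=> h; have h2 : nbhs z [set w | sqn P.[w] != 0] by exact: cs h.
by apply: filterS h2 => w /=; rewrite sqn_eq0 => /ME.
Qed.

Let e (z : R[i]) : R[i] := (cexp z)^-1.
Let a1 (z : R[i]) : R[i] := cexp z / P.[z].
Let a2 (z : R[i]) : R[i] := - 2^-1 * e z / P.[z].
Let u1 (z : R[i]) : R[i] := cexp z * (P.[z] - (P^`()).[z]).
Let u2 (z : R[i]) : R[i] := 2^-1 * e z * (P.[z] + (P^`()).[z]).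
Let o (z : R[i]) : R[i] := (P.[z] * P.[z])^-1.
Let b1 (z : R[i]) : R[i] := u1 z - a1 z * g.[z].
Let b2 (z : R[i]) : R[i] := u2 z - a2 z * g.[z].

Let de (z : R[i]) : is_derive z 1 e (- e z).
Proof.
apply: is_derive_eq (is_deriveVc (cexp_neq0 z) (is_derive_cexp z)) _.
by rewrite /e; field; exact: cexp_neq0.
Qed.

Let dP (z : R[i]) := is_derive_horner P z.
Let dP' (z : R[i]) := is_derive_horner P^`() z.

Let da1 (z : R[i]) : M z -> is_derive z 1 a1 (o z * u1 z).
Proof.
move=> /PM Pz; apply: is_derive_eq (is_deriveMc (is_derive_cexp z) (is_deriveVc Pz (dP z))) _.
by rewrite /o /u1; field.
Qed.

Let da2 (z : R[i]) : M z -> is_derive z 1 a2 (o z * u2 z).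
Proof.
move=> /PM Pz.
have h := is_deriveMc (is_derive_cst (- 2^-1 : R[i]) z 1) (de z).
apply: is_derive_eq (is_deriveMc h (is_deriveVc Pz (dP z))) _.
by rewrite /o /u2 /=; field.
Qed.

Let du1 (z : R[i]) : is_derive z 1 u1 (cexp z * (P.[z] - (P^`()^`()).[z])).
Proof.
apply: is_derive_eq (is_deriveMc (is_derive_cexp z) (is_deriveBc (dP z) (dP' z))) _.
by ring.
Qed.

Let du2 (z : R[i]) : is_derive z 1 u2 (- (2^-1 * e z * (P.[z] - (P^`()^`()).[z]))).
Proof.
have h := is_deriveMc (is_derive_cst (2^-1 : R[i]) z 1) (de z).
apply: is_derive_eq (is_deriveMc h (is_deriveDc (dP z) (dP' z))) _.
by rewrite /=; ring.
Qed.

Let dgz (z : R[i]) : is_derive z 1 (horner g) (P.[z] * (P.[z] - (P^`()^`()).[z])).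
Proof. by have := is_derive_horner g z; rewrite dg hornerM hornerD hornerN. Qed.

Let db1 (z : R[i]) : M z -> is_derive z 1 b1 (- g.[z] * (o z * u1 z)).
Proof.
move=> Mz; have Pz := PM Mz.
apply: is_derive_eq (is_deriveBc (du1 z) (is_deriveMc (da1 Mz) (dgz z))) _.
by rewrite /a1; field.
Qed.

Let db2 (z : R[i]) : M z -> is_derive z 1 b2 (- g.[z] * (o z * u2 z)).
Proof.
move=> Mz; have Pz := PM Mz.
apply: is_derive_eq (is_deriveBc (du2 z) (is_deriveMc (da2 Mz) (dgz z))) _.
by rewrite /a2; field.
Qed.

Let do_ (z : R[i]) : M z -> derivable o z 1.
Proof.
move=> /PM Pz; have PP : P.[z] * P.[z] != 0 by rewrite mulf_neq0.
by case: (is_deriveVc (h := fun w => P.[w] * P.[w]) PP (is_deriveMc (dP z) (dP z))).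
Qed.

Let u1E (z : R[i]) : u1 z = a1 z * g.[z] + b1 z. Proof. by rewrite /b1; ring. Qed.
Let u2E (z : R[i]) : u2 z = a2 z * g.[z] + b2 z. Proof. by rewrite /b2; ring. Qed.

Let detF (z : R[i]) : M z -> a1 z * b2 z - a2 z * b1 z = 1.
Proof.
move=> /PM Pz; rewrite /b1 /b2 /a1 /a2 /u1 /u2 /e; field.
by rewrite Pz cexp_neq0.
Qed.

Let o0 (z : R[i]) : M z -> o z != 0.
Proof. by move=> /PM Pz; rewrite invr_eq0 mulf_neq0. Qed.

Let u0 (z : R[i]) : M z -> (u1 z != 0) || (u2 z != 0).
Proof.
move=> Mz; rewrite -negb_and; apply/negP => /andP[/eqP h1 /eqP h2].
have := detF Mz; rewrite (_ : _ - _ = a1 z * u2 z - a2 z * u1 z); last by rewrite /b1 /b2; ring.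
by rewrite h1 h2 !mulr0 subrr => /esym/eqP; rewrite oner_eq0.
Qed.

Let F z : 'M[R[i]]_2 := mx2 (a1 z) (b1 z) (a2 z) (b2 z).

Definition the_face : R[i] -> 'rV[R]_4 := face a1 a2 b1 b2.

Lemma the_face_ds2 z : M z -> ds2 the_face z = (sqn (o z) * (1 - sqn g.[z]) ^+ 2)%:M.
Proof.
by move=> Mz; exact: (ds2_face da1 da2 db1 db2 u1E u2E detF).
Qed.

Let oM := open_punctured.

Let cse : csmooth M e.
Proof. by apply: csmoothV => //; [move=> z _; exact: cexp_neq0|exact: csmooth_cexp]. Qed.

Let csPV : csmooth M (fun z => (P.[z])^-1).
Proof. by apply: csmoothV => //; exact: csmooth_horner. Qed.

Let csa1 : csmooth M a1.
Proof. by apply: csmoothM => //; exact: csmooth_cexp. Qed.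

Let csa2 : csmooth M a2.
Proof.
by apply: csmoothM => //; apply: csmoothM => //; exact: csmooth_cst.
Qed.

Let csb1 : csmooth M b1.
Proof.
apply: csmoothD => //; last by apply: csmoothN => //; apply: csmoothM => //; exact: csmooth_horner.
apply: csmoothM => //; first exact: csmooth_cexp.
by apply: csmoothD => //; [exact: csmooth_horner|apply: csmoothN => //; exact: csmooth_horner].
Qed.

Let csb2 : csmooth M b2.
Proof.
apply: csmoothD => //; last by apply: csmoothN => //; apply: csmoothM => //; exact: csmooth_horner.
apply: csmoothM => //; first by apply: csmoothM => //; exact: csmooth_cst.
by apply: csmoothD => //; exact: csmooth_horner.
Qed.

Let cso : csmooth M o.
Proof.
apply: csmoothV => //; first by move=> z Mz; rewrite mulf_neq0 ?PM.
by apply: csmoothM => //; exact: csmooth_horner.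
Qed.

Let P_neq0 : P != 0. Proof. by rewrite -size_poly_eq0 sP. Qed.

Let sdP : (size P^`() < size P)%N. Proof. exact: lt_size_deriv. Qed.

Let sddP : (size (P^`()^`()) < size P)%N.
Proof.
have [->|p0] := eqVneq P^`() 0; first by rewrite deriv0 size_poly0 sP.
exact: ltn_trans (lt_size_deriv p0) sdP.
Qed.

(** The leading term of [P - P''] is that of [P], so [g'] has degree 2n; sizes exceed degrees by
    one. *)
Let sg' : size g^`() = (n + n).+1.
Proof.
have s2 : size (P - P^`()^`()) = n.+1 by rewrite size_polyDl ?sP// size_polyN -sP.
rewrite dg size_mul ?P_neq0//; last by rewrite -size_poly_eq0 s2.
by rewrite sP s2 addSn addnS.
Qed.

Let g'_neq0 : g^`() != 0. Proof. by rewrite -size_poly_eq0 sg'. Qed.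

Let sg : ((n + n).+2 <= size g)%N.
Proof.
rewrite -sg'; apply: lt_size_deriv; apply: contra_neq g'_neq0 => ->; exact: deriv0.
Qed.

Lemma the_cmc1_face : cmc1_face M the_face.
Proof.
apply: (face_cmc1_face oM da1 da2 db1 db2 _ _ _ do_ u1E u2E detF o0 csa1 csa2 csb1 csb2 _ cso).
- by move=> z _; case: (du1 z).
- by move=> z _; case: (du2 z).
- by move=> z _; case: (dgz z).
- exact: csmooth_horner.
- exact: sqn_horner_dense.
Qed.

Lemma smooth_profile : smooth M (profile g P).
Proof.
move=> k; have sV : class_C k M (fun z => (sqn P.[z])^-1).
  apply: class_CV => //; first by move=> z Mz; rewrite sqn_eq0 PM.
  by apply: smooth_sqn => //; exact: csmooth_horner.
have s1 : class_C k M (fun z => sqn g.[z] - 1).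
  apply: class_CD => //; last exact: class_C_cst.
  by apply: smooth_sqn => //; exact: csmooth_horner.
apply: class_CM => //; last by under eq_fun do rewrite expr2; exact: class_CM.
apply: class_CD => //.
  by apply: class_C_ext (class_CM oM s1 s1) => // z _; ring.
apply: class_C_flat => //.
apply: class_C_ext (class_CD oM (class_C_cst k 4^-1 oM) (class_CN oM (class_CM oM s1 s1))) => //.
Qed.

Lemma riemannian_profile : riemannian M (fun z => (profile g P z)%:M).
Proof.
split => [i j k|z Mz]; last by apply: posdef_scalar; exact: (profile_gt0 _ PM).
under eq_fun do rewrite mxE; case: (i == j); first by under eq_fun do rewrite mulr1n; exact: smooth_profile.
by under eq_fun do rewrite mulr0n; exact: class_C_cst.
Qed.

(** [complete_conformal] is applied with h = 1 / P, which is unbounded near every puncture. As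
    [profile] is at least d (1 + |g|^2)^2 / |P|^4, both lower bounds follow from deg P' < deg P <=
    deg g. *)
Lemma complete_profile : complete_metric M (fun z => (profile g P z)%:M).
Proof.
have [d d0 hd] := @eta_lower R.
have sPg : (size P <= size g)%N by apply: leq_trans sg; rewrite sP !ltnS leqW// leq_addr.
have [C1 C10 hC1] := sqn_horner_le sPg.
have [C2 C20 hC2] := sqn_horner_le (leq_trans (ltnW sdP) sPg).
(* Small enough for both [q C1^2 <= d] and [q C2 <= d]. *)
pose q := d / (1 + C1 ^+ 2 + C2).
have D0 : 0 < 1 + C1 ^+ 2 + C2 by have := sqr_ge0 C1; lra.
have q0 : 0 < q by rewrite divr_gt0.
have k2 : Num.sqrt q ^+ 2 = q by rewrite sqr_sqrtr// ltW.
have profile_ge x z : M z -> x * sqn P.[z] ^+ 2 <= d * (1 + sqn g.[z]) ^+ 2 ->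
    x <= profile g P z.
  move=> Mz h; have p0 : 0 < sqn P.[z] ^+ 2 by rewrite exprn_gt0// sqn_gt0 PM.
  by rewrite /profile exprVn ler_pdivlMr//; apply: le_trans h _; apply: hd; exact: sqn_ge0.
have qD : q * (1 + C1 ^+ 2 + C2) = d by rewrite divfK// gt_eqF.
have q1 : q * C1 ^+ 2 <= d.
  by rewrite -qD ler_pM2l// addrAC lerDr addr_ge0.
have q2 : q * C2 <= d.
  by rewrite -qD ler_pM2l// lerDr addr_ge0// sqr_ge0.
apply: (@complete_conformal R M (profile g P) (fun z => P.[z]^-1)
  (fun z => - (P^`()).[z] / P.[z] ^+ 2) (Num.sqrt q) oM).
- by rewrite sqrtr_gt0.
- exact: class_C_cont (smooth_profile 0%N).
- by move=> z Mz; exact: is_deriveVc (PM Mz) (dP z).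
- move=> z Mz; have PP : P.[z] * P.[z] != 0 by rewrite mulf_neq0 ?PM.
  exact: contcM (contcN (is_derive_cont (dP' z)))
    (is_derive_cont (is_deriveVc (h := fun w => P.[w] * P.[w]) PP (is_deriveMc (dP z) (dP z)))).
- move=> z Mz; rewrite k2; apply: profile_ge => //.
  apply: le_trans (_ : q * (C1 * (1 + sqn g.[z])) ^+ 2 <= _).
    by rewrite ler_pM2l// ler_pXn2r ?nnegrE ?sqn_ge0// mulr_ge0// addr_ge0// sqn_ge0.
  by rewrite exprMn mulrA ler_wpM2r// sqr_ge0.
- move=> z Mz; rewrite k2; apply: profile_ge => //.
  have p0 : sqn P.[z] != 0 by rewrite sqn_eq0 PM.
  have -> : q * sqn (- (P^`()).[z] / P.[z] ^+ 2) * sqn P.[z] ^+ 2 = q * sqn (P^`()).[z].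
    rewrite -(mulrA q) [sqn P.[z] ^+ 2]expr2 -!sqnM -expr2 mulfVK ?expf_neq0 ?PM//.
    by rewrite /sqn !ReImE !sqrrN.
  have s1 : 1 <= 1 + sqn g.[z] by rewrite lerDl sqn_ge0.
  apply: le_trans (_ : q * (C2 * (1 + sqn g.[z])) <= _); first by rewrite ler_pM2l.
  rewrite mulrA; apply: ler_pM => //; first by rewrite mulr_ge0// ltW.
    exact: le_trans s1.
  by rewrite expr2 ler_peMr// (le_trans _ s1).
- move=> B l hl; apply/ME/negP => /eqP Pl.
  have B1 : 0 < `|B| + 1 by rewrite ltr_wpDl.
  have cs : {for l, continuous (fun w => sqn P.[w])}.
    by apply: (class_C_cont (smooth_sqn oT (csmooth_horner oT P) 0%N)).
  have nb : nbhs l [set w | sqn P.[w] < (`|B| + 1)^-1].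
    have nb0 : nbhs (sqn P.[l]) [set x | x < (`|B| + 1)^-1].
      apply: open_nbhs_nbhs; split; first exact: open_lt.
      by rewrite /= Pl /sqn /= expr0n addr0 invr_gt0.
    exact: cs nb0.
  have [r r0 hr] := nbhs_sqn nb; have [w [Mw wl]] := hl _ r0.
  have p0 : 0 < sqn P.[w] by rewrite sqn_gt0 PM.
  have -> : sqn (P.[w]^-1) = (sqn P.[w])^-1.
    apply: (mulIf (x := sqn P.[w])); first by rewrite gt_eqF.
    by rewrite -sqnM !mulVf ?PM ?gt_eqF// /sqn /= expr1n expr0n addr0.
  rewrite leNgt => /negP; apply; apply: (@lt_trans _ _ (`|B| + 1)).
    by rewrite ltr_pwDr// ler_norm.
  by rewrite -[ltLHS]invrK ltf_pV2 ?posrE ?invr_gt0//; exact: hr.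
Qed.

(** Contains all points where [eta] differs from (1 - s)^2, hence carries the modification; it
    misses the punctures, where |g|^2 <= 1/4 < 1/2. *)
Let near_circle : set R[i] := (fun z => sqn g.[z]) @^-1` `[2^-1, 3 / 2]%classic.

Lemma compact_near_circle : compact near_circle.
Proof.
have sX : (size ('X : {poly R[i]}) <= size g)%N by apply: leq_trans sg; rewrite size_polyX.
have [C C0 hC] := sqn_horner_le sX.
(* On this set |z|^2 <= C (1 + 3/2), which is at most B^2 because B >= 1. *)
pose B := 1 + C * (5 / 2).
apply: (@subclosed_compact _ _
  ((fun v : R * R => v.1 +i* v.2) @` (`[- B, B]%classic `*` `[- B, B]%classic))).
- apply: closed_comp; last exact: itv_closed.
  by move=> z _; apply: (class_C_cont (smooth_sqn oT (csmooth_horner oT g) 0%N)).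
- apply: continuous_compact; last by apply: compact_setX; exact: segment_compact.
  apply: continuous_subspaceT => v; apply: cvg_complex; [exact: cvg_fst|exact: cvg_snd].
- move=> z; rewrite /near_circle /= in_itv /= => /andP[_ s1].
  exists (complex.Re z, complex.Im z); last by case: z {s1}.
  have h : sqn z <= B ^+ 2.
    have := hC z; rewrite hornerX => /le_trans; apply.
    rewrite /B; nra.
  have B0 : 0 <= B by rewrite addr_ge0// mulr_ge0.
  split => /=; rewrite in_itv /= -ler_norml -(ler_pXn2r (n := 2)) ?nnegrE// real_normK ?num_real//;
    apply: le_trans h; [rewrite lerDl|rewrite lerDr]; exact: sqr_ge0.
Qed.

Lemma near_circle_sub : near_circle `<=` M.
Proof.
move=> z /=; rewrite /near_circle /= in_itv /= => /andP[s1 _]; apply/ME/eqP => /rootP[j zj].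
by have := g_small j; rewrite -zj => /(le_trans s1); lra.
Qed.

(** A single modification of the metric serves both completeness and finite total curvature. *)
Lemma modified_metric Q : Q (fun z => (profile g P z)%:M) -> has_modified_metric M the_face Q.
Proof.
move=> hQ; exists near_circle, (fun z => (profile g P z)%:M - ds2 the_face z).
have E : (fun z => ds2 the_face z + ((profile g P z)%:M - ds2 the_face z)) =
    (fun z => (profile g P z)%:M) by apply/funext => z; rewrite addrC subrK.
rewrite E; split => //; last exact: riemannian_profile.
- by split; [exact: compact_near_circle|exact: near_circle_sub].
- by move=> z Mz; rewrite the_face_ds2// -raddfB /= tr_scalar_mx.
- move=> z [Mz nz]; rewrite the_face_ds2// /profile eta_far.
    have Pz := PM Mz.
    have -> : sqn (o z) = (sqn P.[z])^-1 ^+ 2.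
      apply: (mulIf (x := sqn (P.[z] * P.[z]))); first by rewrite sqn_eq0 mulf_neq0.
      rewrite -sqnM mulVf ?mulf_neq0// sqnM -expr2 -exprMn mulVf ?sqn_eq0// expr1n.
      by rewrite /sqn expr0n addr0 expr1n.
    by rewrite mulrC subrr.
  rewrite leNgt; apply/negP => h; apply: nz; move: h; rewrite ltr_norml /near_circle /=; rewrite in_itv /=; lra.
Qed.

Lemma the_face_complete : complete_face M the_face.
Proof. exact: modified_metric complete_profile. Qed.

(** By [dlog_bound] the density is at most 4 D |g'|^2 / (1 + |g|^2)^2. Since [z], [g'] and [z g']
    have degree at most that of [g], both 1 + |z|^2 and (1 + |z|^2) |g'|^2 are bounded by multiples
    of 1 + |g|^2; their product gives the decay (1 + |z|^2)^-2. *)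
Lemma finite_total_curvature_profile : finite_total_curvature M (fun z => (profile g P z)%:M).
Proof.
have [D D0 hD] := @dlog_bound R.
have sg1 : (size g^`() <= size g)%N by apply: leq_trans sg; rewrite sg'.
have sg2 : (size ('X * g^`())%R <= size g)%N.
  by apply: leq_trans sg; rewrite size_mul ?polyX_eq0// size_polyX sg'.
have [A A0 hA] := sqn_horner_le sg1.
have [A' A'0 hA'] := sqn_horner_le sg2.
have sX : (size ('X : {poly R[i]}) <= size g)%N by apply: leq_trans sg; rewrite size_polyX.
have [C C0 hC] := sqn_horner_le sX.
apply: (finite_total_curvature_bound (C := 4 * D * ((1 + C) * (A + A')))).
  by rewrite !mulr_ge0// addr_ge0.
move=> z Mz; rewrite (profile_curvature_density oM g PM Mz).
have s0 := sqn_ge0 g.[z]; have z0 := sqn_ge0 z.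
set s := sqn g.[z] in s0 *; set x := sqn z in z0 *.
have x0 : 0 < (1 + x) ^+ 2 by rewrite exprn_gt0// ltr_pwDl.
rewrite ler_pdivlMr//.
have := hD s s0; have := hA z; have := hA' z; have := hC z.
rewrite hornerX hornerM hornerX sqnM -/s -/x.
set y := sqn _; set w := `|_| => h1 h2 h3 h4.
have y0 : 0 <= y by exact: sqn_ge0.
have w0 : 0 <= w by exact: normr_ge0.
have f1 : 1 + x <= (1 + C) * (1 + s) by lra.
have f2 : (1 + x) * y <= (A + A') * (1 + s) by lra.
have f3 : (1 + x) * ((1 + x) * y) <= ((1 + C) * (1 + s)) * ((A + A') * (1 + s)).
  by apply: ler_pM => //; rewrite ?mulr_ge0// addr_ge0.
apply: (@le_trans _ _ (4 * w * (((1 + C) * (1 + s)) * ((A + A') * (1 + s))))).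
  rewrite (_ : 4 * y * w * (1 + x) ^+ 2 = 4 * w * ((1 + x) * ((1 + x) * y))); last by ring.
  by rewrite ler_wpM2l// mulr_ge0.
rewrite (_ : 4 * w * _ = 4 * (w * (1 + s) ^+ 2) * ((1 + C) * (A + A'))); last by ring.
by rewrite ler_wpM2r ?mulr_ge0 ?addr_ge0// ler_wpM2l.
Qed.

Lemma the_face_finite_type : finite_type M the_face.
Proof. exact: modified_metric finite_total_curvature_profile. Qed.

Definition the_lift (c : R -> R[i]) : 'M[R[i]]_2 := F (c 1).

Definition the_gauss_map (z : R[i]) : option R[i] := ratio (u1 z) (u2 z).

Lemma the_lift_dlift z0 c : path_from M z0 c ->
  let z := c 1 in
  dlift the_lift c = mx2 (o z * u1 z) (- g.[z] * (o z * u1 z)) (o z * u2 z) (- g.[z] * (o z * u2 z)).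
Proof.
move=> [_ _ cM] z; have Mz : M z by apply: cM; rewrite /= in_itv /= ler01 lexx.
apply: dlift_single => i j; apply: is_derive_mx2; [exact: da1|exact: db1|exact: da2|exact: db2].
Qed.

Lemma the_lift_null z0 : null_lift M z0 the_face the_lift.
Proof.
split => [c d _ _ /homotopic_endpoint cd|c pc]; first by rewrite /the_lift cd.
have Mz : M (c 1) by case: pc => _ _; apply; rewrite /= in_itv /= ler01 lexx.
split.
- by rewrite /the_lift det_mx2 -(detF Mz); ring.
- move=> i j; under eq_fun do rewrite branch_single.
  by have [] := is_derive_mx2 (da1 Mz) (db1 Mz) (da2 Mz) (db2 Mz) i j.
- rewrite (the_lift_dlift pc) det_mx2; split; last by ring.
  apply/negP => /eqP/matrixP h; have := u0 Mz.
  have := h 0 0; have := h 1 0; rewrite !mxE /= => /eqP h2 /eqP h1.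
  by move: h1 h2; rewrite !mulf_eq0 (negbTE (o0 Mz)) /= => -> ->.
- exact: herm_face.
Qed.

Lemma the_gauss_mapP z0 : hyperbolic_gauss_map M z0 the_lift the_gauss_map.
Proof.
move=> c pc k; rewrite (the_lift_dlift pc) => hk.
have Mz : M (c 1) by case: pc => _ _; apply; rewrite /= in_itv /= ler01 lexx.
have [k0|k1] : k = 0 \/ k = 1 by case: k {hk} => [[|[|//]] ?]; [left|right]; exact: val_inj.
  by rewrite k0 !mxE /= ratio_scale ?o0.
rewrite k1 !mxE /= !(mulrA (- g.[c 1])) ratio_scale//.
apply: contra_neq hk => h0; rewrite k1; apply/colP => -[[|[|//]] ?];
  by rewrite !mxE /= mulrA h0 mul0r.
Qed.

(** Unlike the entries of [F], the functions [u1] and [u2] are entire; at a puncture [u1] reduces to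
    [- P'] times an exponential, nonzero because the root is simple. *)
Lemma regular_puncture j : regular_end (@puncture R n) the_gauss_map (Some j).
Proof.
have dshift (h : R[i] -> R[i]) (a w : R[i]) : derivable h (a + w) 1 -> derivable (fun w => h (a + w)) w 1.
  suff E : (fun k : R[i] => k^-1 *: (((fun w => h (a + w)) \o shift w) (k *: 1) - h (a + w))) =
      (fun k : R[i] => k^-1 *: ((h \o shift (a + w)) (k *: 1) - h (a + w))) by rewrite /derivable E.
  by apply/funext => k /=; rewrite addrCA.
exists (fun w => u1 (puncture j + w)), (fun w => u2 (puncture j + w)); split.
- apply: (@filterE _ _ (nbhs_filter (0 : R[i]))) => w; split; apply: dshift.
    by case: (du1 (puncture j + w)).
  by case: (du2 (puncture j + w)).
- have Pj : P.[puncture j] = 0 by apply/rootP; exists j.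
  apply/negP => /eqP[/eqP]; rewrite addr0 /u1 Pj sub0r mulf_eq0.
  rewrite (negbTE (cexp_neq0 _)) oppr_eq0 (negbTE (simpleP j)).
  by [].
- by rewrite near_withinE; apply: (@filterE _ _ (nbhs_filter (0 : R[i]))).
Qed.

(** If the Gauss map were [a : b] near infinity, its exponential growth along the positive real axis
    would force b(0) = 0, and its decay along the negative one a(0) = 0, a common zero. *)
Lemma irregular_infinity : ~ regular_end (@puncture R n) the_gauss_map None.
Proof.
move=> [a [b [dab ab0 hG]]].
have [da db] := nbhs_singleton dab.
have sQ : size (P - P^`()) = n.+1 by rewrite size_polyDl ?sP// size_polyN -sP.
have sT : size (P + P^`()) = n.+1 by rewrite size_polyDl ?sP// -sP.
have real0 (v : R) : (v * t)%:C @[t --> (0:R)^'+] --> (0 : R[i]).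
  have h : v * t @[t --> (0:R)^'+] --> (0 : R).
    rewrite -[X in _ --> X](mulr0 v); apply: cvgM; first exact: cvg_cst.
    exact: cvg_at_right_filter cvg_id.
  exact: (cvg_comp _ _ h (@continuous_real_complex R 0)).
have lim (h : R[i] -> R[i]) (v : R) : derivable h 0 1 ->
    sqn (h (v * t)%:C) @[t --> (0:R)^'+] --> sqn (h 0).
  move=> dh; apply: sqn_cvg.
  have ch : {for (0 : R[i]), continuous h} by have /derivableP/is_derive_cont := dh.
  exact: (cvg_comp _ _ (real0 v) ch).
(* Squared moduli of the cross-multiplied identity u1 / u2 = a / b at the real point v / t, the
   inverse of v t as v = 1 or -1; squaring turns the exponent 2z into 4z. *)
have key (v : R) : v ^+ 2 = 1 -> \forall t \near (0 : R)^'+,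
    expR (2 * (v / t)) * (sqn (P - P^`()).[(v / t)%:C] * sqn (b (v * t)%:C)) =
    4^-1 * expR (- (2 * (v / t))) * (sqn (P + P^`()).[(v / t)%:C] * sqn (a (v * t)%:C)).
  move=> v1; have v0 : v != 0 by apply: contra_eq_neq v1 => ->; rewrite expr0n eq_sym oner_neq0.
  have h2 : \forall t \near (0 : R)^'+, (v * t)%:C != 0 :> R[i] ->
      the_gauss_map ((v * t)%:C^-1) = ratio (a (v * t)%:C) (b (v * t)%:C).
    by move: hG; rewrite near_withinE => hG'; have := real0 v _ hG'.
  have tpos : \forall t \near (0 : R)^'+, 0 < t by exact: nbhs_right_gt.
  apply: filterS2 h2 tpos => t gt t0.
  have tn0 : t != 0 by rewrite gt_eqF.
  have vt0 : (v * t)%:C != 0 :> R[i] by rewrite eq_complex /= eqxx andbT mulf_neq0.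
  have := ratio_cross (gt vt0).
  have -> : (v * t)%:C^-1 = (v / t)%:C :> R[i].
    apply: (mulfI vt0); rewrite divff// -rcM.
    by rewrite mulrACA divff// -expr2 v1 mulr1.
  have sq_exp x : sqn (expR x)%:C = expR (2 * x) :> R.
    by rewrite /sqn /= [0 ^+ 2]expr0n addr0 expr2 -expRD; congr expR; ring.
  rewrite /u1 /u2 /e -cexpN -rcN !cexp_real => /(congr1 sqn).
  rewrite !sqnM !sq_exp -!hornerN -!hornerD.
  have -> : sqn (2^-1 : R[i]) = 4^-1.
    apply: (mulIf (x := sqn (2 : R[i]))); first by rewrite sqn_eq0 pnatr_eq0.
    rewrite -sqnM mulVf ?pnatr_eq0// -rc_nat /sqn /= !expr0n expr1n !addr0 -natrX.
    by rewrite mulVf// pnatr_eq0.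
  by rewrite mulrN -!mulrA.
have sqr1N : (-1 : R) ^+ 2 = 1 by rewrite sqrrN expr1n.
have sqn_le0 (z : R[i]) : sqn z <= 0 -> z = 0.
  by move=> h; apply/eqP; rewrite -sqn_eq0 eq_le h sqn_ge0.
have b0 : b 0 = 0.
  apply: sqn_le0; apply: (@exp_ratio_limit _ (P - P^`()) (P + P^`()) 4^-1 1 (sqn (a 0)) _
    (fun t => sqn (a (1 * t)%:C)) (fun t => sqn (b (1 * t)%:C))) => //.
  - by rewrite -size_poly_eq0 sQ.
  - by rewrite sQ sT.
  - by rewrite expr1n.
  - by move=> t; exact: sqn_ge0.
  - by move=> t; exact: sqn_ge0.
  - exact: (lim a 1 da).
  - exact: (lim b 1 db).
  have := key 1 (expr1n _ _); apply: filterS => t h.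
  apply: (mulfI (x := expR (2 * (1 / t)))); first by rewrite gt_eqF// expR_gt0.
  rewrite h [RHS]mulrA; congr (_ * _); rewrite [RHS]mulrCA; congr (_ * _); rewrite -expRD; congr expR.
  by rewrite div1r; ring.
have a0 : a 0 = 0.
  apply: sqn_le0; apply: (@exp_ratio_limit _ (P + P^`()) (P - P^`()) 4 (-1) (sqn (b 0)) _
    (fun t => sqn (b (-1 * t)%:C)) (fun t => sqn (a (-1 * t)%:C))) => //.
  - by rewrite -size_poly_eq0 sT.
  - by rewrite sQ sT.
  - by move=> t; exact: sqn_ge0.
  - by move=> t; exact: sqn_ge0.
  - exact: (lim b (-1) db).
  - exact: (lim a (-1) da).
  have := key (-1) sqr1N; apply: filterS => t h.
  apply: (mulfI (x := 4^-1 * expR (- (2 * (-1 / t))))); first by rewrite gt_eqF// mulr_gt0// expR_gt0.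
  rewrite -h [RHS]mulrA; congr (_ * _); rewrite mulrACA mulVf// mul1r -expRD; congr expR.
  by rewrite mulN1r; ring.
by move: ab0; rewrite a0 b0 eqxx.
Qed.

Lemma the_elliptic_end (en : option 'I_n) : elliptic_end (@puncture R n) 'i%C the_lift en.
Proof.
(* Distinct punctures are at distance at least 1, and |w| <= 1 / (n + 1) puts 1 / w outside the disc
   of radius n + 1, beyond every puncture. *)
pose r : R := if en is Some _ then 2^-1 else n.+1%:R^-1.
have r0 : 0 < r by rewrite /r; case: (en); rewrite invr_gt0.
have natC k : (k%:R : R[i]) = k%:R%:C by rewrite rc_nat.
have hr (w : R[i]) : w != 0 -> `|w| <= r%:C -> M (end_coord (@puncture R n) en w).
  rewrite /r; case: en {r r0} => [j|] w0 wr i /=; apply/eqP => h.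
    have ij : i != j by apply: contra_neq w0 => ij; move: h; rewrite ij -[X in _ = X]addr0 => /addrI.
    have := ler_Re_norm wr; rewrite (_ : w = (i%:R - j%:R)%:C); last first.
      by rewrite rcB !rc_nat -[i%:R]/(puncture i) -h /puncture addrC addKr.
    rewrite /= leNgt => /negP; apply.
    have [lt_ij|lt_ji|/val_inj e_ij] := ltngtP i j; last by rewrite e_ij eqxx in ij.
    - rewrite distrC; apply: lt_le_trans (ler_norm _); apply: (@lt_le_trans _ _ 1); first by lra.
      by rewrite lerBrDl natr1 ler_nat.
    - apply: lt_le_trans (ler_norm _); apply: (@lt_le_trans _ _ 1); first by lra.
      by rewrite lerBrDl natr1 ler_nat.
  have wi : w * i%:R = 1 by rewrite -[i%:R]/(puncture i) -h divff.
  have h1 : `|w| * i%:R = 1 by rewrite -(normr_nat (R[i])) -normrM wi normr1.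
  have : (1 : R[i]) <= n.+1%:R^-1%:C * i%:R by rewrite -[leLHS]h1 ler_wpM2r.
  rewrite natC -rcM (lecR 1) mulrC ler_pdivlMr// mul1r ler_nat => hni.
  by have := ltn_ord i; rewrite ltnNge (leq_trans (leqnSn _) hni).
pose q := end_circle (@puncture R n) en r 0.
have qE : q = end_coord (@puncture R n) en r%:C.
  rewrite /q /end_circle mulr0 cos0 sin0; congr end_coord.
  by rewrite (_ : 1 +i* 0 = 1) ?mulr1.
have Mq : M q.
  rewrite qE; apply: hr; first by rewrite eq_complex /= eqxx andbT gt_eqF.
  by rewrite normC_real lecR /sqn /= expr0n addr0 sqrtr_sqr ger0_norm// ltW.
have Imq : complex.Im q = 0.
  rewrite qE /end_coord; case: (en) => [j|]; first by rewrite ReImE /puncture natC /= addr0.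
  by rewrite /= mul0r oppr0.
(* As [q] is real, the segment has imaginary part 1 - t and meets the line of the punctures only at
   its end [q], which lies in [M]. *)
exists r, (segment 'i%C q); split.
- by split.
- split; last exact: segment1.
  split; [|by rewrite /segment mul0r addr0|].
    exact: continuous_subspaceT (@segment_continuous _ _ _).
  move=> t /=; rewrite in_itv /= => /andP[t0 t1].
  have [->|tn1] := eqVneq t 1; first by rewrite segment1.
  move=> j; apply/eqP => h.
  have : complex.Im (segment 'i%C q t) = 0 by rewrite h /puncture natC.
  rewrite /segment !ReImE /= Imq => /eqP.
  rewrite (_ : _ + _ = 1 - t); last by ring.
  by rewrite subr_eq0 eq_sym (negbTE tn1).
(* A lift depending only on endpoints has trivial monodromy, which is elliptic with angle 0. *)
exists 1%:M; split; first exact: SU11_1.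
  by move=> c _; rewrite mulmx1 /the_lift path_cat1.
exists 1%:M; [exact: SU11_1|exists 0].
rewrite invmx1 mulmx1 mul1mx cos0 sin0.
by apply/matrixP => -[[|[|//]] ?] [[|[|//]] ?]; rewrite !mxE //= ?oppr0.
Qed.

End Construction.

Theorem corollary5p8 (R : realType) (n : nat) :
  exists p : 'I_n -> complex R, injective p /\
  exists f : complex R -> 'rV[R]_4,
    [/\ cmc1_face (punctured_plane p) f,
        complete_face (punctured_plane p) f,
        finite_type (punctured_plane p) f &
        exists z0 F G,
          [/\ punctured_plane p z0,
              null_lift (punctured_plane p) z0 f F,
              hyperbolic_gauss_map (punctured_plane p) z0 F G &
              exists e0 : option 'I_n,
                (~ regular_end p G e0 /\ elliptic_end p z0 F e0) /\
                (forall e, e != e0 ->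
                   regular_end p G e /\ elliptic_end p z0 F e)]].
Proof.
have [P [g [sP rootP simpleP dg g_small]]] := @polynomial_data R n.
exists (@puncture R n); split; first exact: puncture_inj.
exists (the_face P g); split.
- exact: (the_cmc1_face sP rootP dg).
- exact: (the_face_complete sP rootP dg g_small).
- exact: (the_face_finite_type sP rootP dg g_small).
exists 'i%C, (the_lift P g), (the_gauss_map P).
have Mi : punctured_plane (@puncture R n) 'i%C.
  by move=> j; rewrite /puncture -rc_nat eq_complex /= oner_eq0 andbF.
split => //; [exact: the_lift_null|exact: the_gauss_mapP|].
exists None; split; first split.
- exact: (irregular_infinity sP).
- exact: the_elliptic_end.
by move=> [j|//] _; split; [exact: (regular_puncture rootP simpleP)|exact: the_elliptic_end].
Qed.
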